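(* There is a randomized fully dynamic algorithm that, on an $n$-vertex graph $G=(V,E)$ whose maximum degree is $\Delta$ at all times, maintains a proper vertex coloring $\chi: V\to\{1,\dots,\Delta+1\}$ with expected amortized update time $O(\log \Delta)$.
   Context: Dynamic setting: the vertex set $V$ is fixed, the graph starts with no edges, and it is modified by a sequence of edge insertions and deletions; the upper bound $\Delta$ on the maximum degree is known to the algorithm and holds at all times. After every update the algorithm must output a proper coloring (the endpoints of every edge get different colors). The sequence of updates is fixed by an oblivious adversary (it does not depend on the algorithm's random choices). Amortized update time $\alpha$ means that for every $t$, the total time spent on the first $t$ updates is at most $\alpha t$. *)

(* Defs.v *)
From Stdlib Require List.
From mathcomp Require Import all_boot all_order all_algebra.
Set Implicit Arguments. Unset Strict Implicit. Unset Printing Implicit Defensive.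
Import Order.TTheory GRing.Theory Num.Theory.

Inductive update := Ins of nat & nat | Del of nat & nat.

Definition graph := nat -> nat -> bool.   (* symmetric edge relation *)
Definition empty_graph : graph := fun _ _ => false.

Definition is_pair (u v x y : nat) : bool :=
  ((x == u) && (y == v)) || ((x == v) && (y == u)).

Definition apply_update (g : graph) (up : update) : graph :=
  match up with
  | Ins u v => fun x y => g x y || is_pair u v x y
  | Del u v => fun x y => g x y && ~~ is_pair u v x y
  end.

Definition graph_of (s : seq update) : graph := foldl apply_update empty_graph s.

Definition legal (n : nat) (g : graph) (up : update) : bool :=
  match up with
  | Ins u v => [&& u < n, v < n, u != v & ~~ g u v]
  | Del u v => [&& u < n, v < n, u != v & g u v]
  end.

Definition deg (n : nat) (g : graph) (v : nat) : nat := \sum_(y < n) g v y.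

Definition valid_seq (n D : nat) (s : seq update) : Prop :=
  forall i, i < size s ->
    legal n (graph_of (take i s)) (nth (Ins 0 0) s i) /\
    forall v, v < n -> deg n (graph_of (take i.+1 s)) v <= D.

Inductive instr :=
| IConst of nat & nat
| IAdd   of nat & nat & nat
| ISub   of nat & nat & nat    (* truncated subtraction                 *)
| IMul   of nat & nat & nat
| IDiv   of nat & nat & nat    (* R[d] := R[a] %/ R[b] (0 if R[b] = 0)  *)
| ILoad  of nat & nat
| IStore of nat & nat
| IJz    of nat & nat
| IJlt   of nat & nat & nat
| IRand  of nat & nat
| IRead.

Record config := Config {
  pc : nat;
  reg : nat -> nat;
  memory : nat -> nat;
  inp : seq update;
  ndone : nat
}.

Definition upd (f : nat -> nat) (i x : nat) : nat -> nat :=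
  fun j => if j == i then x else f j.

Section Machine.
Variables (w : nat) (P : seq instr).

Definition wrap (x : nat) : nat := x %% 2 ^ w.

Definition setreg (c : config) (d x : nat) : config :=
  Config c.(pc).+1 (upd c.(reg) d (wrap x)) c.(memory) c.(inp) c.(ndone).

Definition jump (c : config) (b : bool) (l : nat) : config :=
  Config (if b then l else c.(pc).+1) c.(reg) c.(memory) c.(inp) c.(ndone).

Definition encode (up : update) : nat * nat * nat :=
  match up with Ins u v => (1, u, v) | Del u v => (2, u, v) end.

(* list of successor configurations; [::] means halted; a RAND step has
   equiprobable successors *)
Definition step (c : config) : seq config :=
  if c.(pc) < size P then
    let R := c.(reg) in
    match nth IRead P c.(pc) with
    | IConst d k => [:: setreg c d k]
    | IAdd d a b => [:: setreg c d (R a + R b)]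
    | ISub d a b => [:: setreg c d (R a - R b)]
    | IMul d a b => [:: setreg c d (R a * R b)]
    | IDiv d a b => [:: setreg c d (R a %/ R b)]
    | ILoad d a => [:: setreg c d (c.(memory) (R a))]
    | IStore a r => [:: Config c.(pc).+1 R (upd c.(memory) (R a) (R r)) c.(inp) c.(ndone)]
    | IJz a l => [:: jump c (R a == 0) l]
    | IJlt a b l => [:: jump c (R a < R b) l]
    | IRand d a =>
        if R a == 0 then [:: setreg c d 0]
        else [seq setreg c d i | i <- iota 0 (R a)]
    | IRead =>
        match c.(inp) with
        | [::] => [::]
        | up :: rest =>
            let: (k, u, v) := encode up in
            [:: Config c.(pc).+1
                  (upd (upd (upd R 0 (wrap k)) 1 (wrap u)) 2 (wrap v))
                  c.(memory) rest c.(ndone).+1]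
        end
    end
  else [::].

Inductive reachable : config -> config -> Prop :=
| reach_refl c : reachable c c
| reach_step c c' c'' : List.In c' (step c) -> reachable c' c'' -> reachable c c''.

Definition at_read (c : config) : bool :=
  (c.(pc) < size P) && (if nth IRead P c.(pc) is IRead then true else false).

(* Expected number of steps taken from configurations satisfying [cnt],
   truncated after [fuel] steps (the expectation is a supremum over fuel). *)
Fixpoint ecost (cnt : config -> bool) (fuel : nat) (c : config) : rat :=
  match fuel with
  | 0 => 0
  | f.+1 =>
      let cs := step c in
      if cs is [::] then 0
      else ((cnt c)%:R + (\sum_(c' <- cs) ecost cnt f c') / (size cs)%:R)%R
  end.

Definition init_config (n D : nat) (s : seq update) : config :=
  Config 0 (upd (upd (fun _ => 0) 0 (wrap n)) 1 (wrap D)) (fun _ => 0) s 0.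

End Machine.

(* The coloring is stored in memory cells 0..n-1: chi(v) = M[v]. *)
Definition proper_coloring (n D : nat) (g : graph) (col : nat -> nat) : Prop :=
  (forall v, v < n -> 1 <= col v <= D.+1) /\
  (forall u v, u < n -> v < n -> g u v -> col u != col v).

(* Main.v *)
(** The algorithm stores for every vertex a level, a power of two, and sees to it
    that every vertex avoids the colors of its neighbours of higher level.  When a
    vertex [v] has to be recolored, it moves to a level [k] such that at least [k]
    neighbours lie strictly below [k] and fewer than [2 k] at or below it (or to
    level 1).  Its new color is uniform among the colors that no higher neighbour
    uses, rejected if a neighbour of level [k] or two lower neighbours have it; so
    at most one neighbour, of level at most [k / 2], has to be recolored next.
    The palette has at least [k] colors, of which at least a quarter is accepted.

    If an inserted edge joins two equal colors, one endpoint is recolored, chosen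
    with probability proportional to the level of the other one.  In expectation
    this is paid by the endpoint that was colored last: as the updates are
    oblivious, its color has matched that of one of its next [k / 16] partners with
    probability at most 1/16.  A vertex that climbs to level [k] borrows an amount
    proportional to [k], which stays below the number of insertions at it, and
    returns it when it is recolored.  This gives expected amortized time [O(1)],
    hence [O(log D)].

    The program is written in a small structured language whose memory is
    four-dimensional: an address is a number of four digits in base [n + D + 16]. *)
Require Import Defs.
From mathcomp Require Import all_boot all_order all_algebra.
From mathcomp Require Import zify.
Import Order.TTheory GRing.Theory Num.Theory.
Set Implicit Arguments. Unset Strict Implicit. Unset Printing Implicit Defensive.

(** * A structured language and its compilation *)

(** A uniform free color must be found in constant time, and the tables must cost only [O(n)] to set
    up. Both come from storing each set as a prefix of a permutation: the free colors are the
    remaining suffix, so one random position yields a color, and untouched zero memory already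
    denotes the identity with an empty prefix. Edges are bucketed by the larger endpoint level,
    because an edge to a higher neighbor then keeps its place whatever lower level the vertex takes.

    Rejection sampling has no worst-case bound, so costs are bounded by induction on the fuel of
    [ecost], a rejected color leading back to the same budget with less fuel. Obliviousness enters
    because the potential is a function of the remaining updates: the partners that a vertex will
    meet are fixed before its color is drawn. Two quantities live only in the analysis: insertion
    counters, which bound the debt of climbing, and time stamps, which attribute a monochromatic
    pair to the endpoint colored later, so that a new color never raises the potential of other
    vertices. *)

Definition mem4 := nat -> nat -> nat -> nat -> nat.

Record state := MkSt { rg : nat -> nat; mm : mem4 }.

Definition set4 (m : mem4) t x y z v : mem4 :=
  fun t' x' y' z' =>
    if [&& t' == t, x' == x, y' == y & z' == z] then v else m t' x' y' z'.

Definition setr (s : state) d v := MkSt (upd (rg s) d v) (mm s).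

Inductive cmd :=
| Const of nat & nat
| Add of nat & nat & nat
| Subn of nat & nat & nat
| Ld of nat & nat & nat & nat & nat
| St of nat & nat & nat & nat & nat
| Seq of cmd & cmd
| If of nat & nat & cmd & cmd
| While of nat & nat & cmd.

Definition addr_code t x y z :=
  [:: IConst 28 t; IMul 28 28 29; IAdd 28 28 x; IMul 28 28 29; IAdd 28 28 y;
      IMul 28 28 29; IAdd 28 28 z].

Fixpoint csize (c : cmd) : nat :=
  match c with
  | Const _ _ | Add _ _ _ | Subn _ _ _ => 1
  | Ld _ _ _ _ _ | St _ _ _ _ _ => 8
  | Seq a b => csize a + csize b
  | If _ _ a b => (csize b + csize a).+2
  | While _ _ a => (csize a).+2
  end.

(** Register 30 holds 0, so [IJz 30] is an unconditional jump. The else branch precedes the then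
    branch and a loop has its test at the end. This fixes the step counts charged by [wp]: one for a
    taken conditional, two otherwise, one per loop test and one to enter a loop. *)
Fixpoint compile (l : nat) (c : cmd) : seq instr :=
  match c with
  | Const d k => [:: IConst d k]
  | Add d a b => [:: IAdd d a b]
  | Subn d a b => [:: ISub d a b]
  | Ld d t x y z => addr_code t x y z ++ [:: ILoad d 28]
  | St t x y z r => addr_code t x y z ++ [:: IStore 28 r]
  | Seq a b => compile l a ++ compile (l + csize a) b
  | If a b c1 c2 =>
      IJlt a b (l + csize c2).+2 :: compile l.+1 c2 ++
      IJz 30 (l + csize c2 + csize c1).+2 :: compile (l + csize c2).+2 c1
  | While a b c1 =>
      IJz 30 (l + csize c1).+1 :: compile l.+1 c1 ++ [:: IJlt a b l.+1]
  end.

Lemma size_compile l c : size (compile l c) = csize c.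
Proof.
elim: c l => //= [a IHa b IHb|a b c1 IH1 c2 IH2|a b c1 IH1] l.
- by rewrite size_cat IHa IHb.
- by rewrite size_cat /= IH1 IH2; lia.
- by rewrite size_cat /= IH1; lia.
Qed.

Definition src r := r != 28.
Definition dst r := r \notin [:: 28; 29; 30].

Fixpoint wf (c : cmd) : bool :=
  match c with
  | Const d _ => dst d
  | Add d a b | Subn d a b => [&& dst d, src a & src b]
  | Ld d t x y z => [&& dst d, src x, src y, src z & t < 16]
  | St t x y z r => [&& src r, src x, src y, src z & t < 16]
  | Seq a b => wf a && wf b
  | If a b c1 c2 => [&& src a, src b, wf c1 & wf c2]
  | While a b c => [&& src a, src b & wf c]
  end.

(** * Weakest preconditions with step counts *)

Section Sem.
Variables (S W : nat).

Fixpoint wploop (f : state -> (state -> nat -> Prop) -> Prop) (a b : nat) (N : nat)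
    (s : state) (Q : state -> nat -> Prop) : Prop :=
  if rg s a < rg s b then
    if N is N'.+1 then
      f s (fun s1 n1 => wploop f a b N' s1 (fun s2 n2 => Q s2 (n1 + n2).+1))
    else False
  else Q s 1.

(* Total-correctness weakest precondition; the postcondition also receives the
   number of machine steps. *)
Fixpoint wp (c : cmd) (s : state) (Q : state -> nat -> Prop) : Prop :=
  match c with
  | Const d k => k < W /\ Q (setr s d k) 1
  | Add d a b => rg s a + rg s b < W /\ Q (setr s d (rg s a + rg s b)) 1
  | Subn d a b => Q (setr s d (rg s a - rg s b)) 1
  | Ld d t x y z =>
      [&& rg s x < S, rg s y < S & rg s z < S] /\
      Q (setr s d (mm s t (rg s x) (rg s y) (rg s z))) 8
  | St t x y z r =>
      [&& rg s x < S, rg s y < S & rg s z < S] /\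
      Q (MkSt (rg s) (set4 (mm s) t (rg s x) (rg s y) (rg s z) (rg s r))) 8
  | Seq c1 c2 => wp c1 s (fun s1 n1 => wp c2 s1 (fun s2 n2 => Q s2 (n1 + n2)))
  | If a b c1 c2 =>
      if rg s a < rg s b then wp c1 s (fun s1 n1 => Q s1 n1.+1)
      else wp c2 s (fun s1 n1 => Q s1 n1.+2)
  | While a b c1 => exists N, wploop (wp c1) a b N s (fun s1 n1 => Q s1 n1.+1)
  end.

Lemma wploop_mono f a b N s (Q Q' : state -> nat -> Prop) :
  (forall s (Q Q' : state -> nat -> Prop), (forall s' k, Q s' k -> Q' s' k) -> f s Q -> f s Q') ->
  (forall s' k, Q s' k -> Q' s' k) ->
  wploop f a b N s Q -> wploop f a b N s Q'.
Proof.
move=> Hf; elim: N s Q Q' => [|N IH] s Q Q' HQ /=; case: ifP => // _; try exact: HQ.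
by apply: Hf => s1 n1; apply: IH => s2 n2; apply: HQ.
Qed.

Lemma wp_mono c s (Q Q' : state -> nat -> Prop) :
  (forall s' k, Q s' k -> Q' s' k) -> wp c s Q -> wp c s Q'.
Proof.
elim: c s Q Q' => /= [d k|d a b|d a b|d t x y z|t x y z r|c1 IH1 c2 IH2|a b c1 IH1 c2 IH2|a b c1 IH1]
  s Q Q' HQ; try by [case=> H1 H2; split; [|apply: HQ]|apply: HQ].
- by apply: IH1 => s1 n1; apply: IH2 => s2 n2; apply: HQ.
- by case: ifP => _; [apply: IH1|apply: IH2] => s1 n1; apply: HQ.
- case=> N H; exists N; apply: wploop_mono H => // s1 n1; exact: HQ.
Qed.

(* [I k n s]: at most [k] iterations remain, [n] steps were spent so far. *)
Lemma wp_while (I : nat -> nat -> state -> Prop) N a b c s (Q : state -> nat -> Prop) :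
  I N 2 s ->
  (forall k n s, I k n s -> rg s a < rg s b ->
     exists k', k = k'.+1 /\ wp c s (fun s1 n1 => I k' (n + n1).+1 s1)) ->
  (forall k n s, I k n s -> ~~ (rg s a < rg s b) -> Q s n) ->
  wp (While a b c) s Q.
Proof.
move=> HI Hb He; exists N.
(* The count [n] of the invariant already includes the final test, which [n1] counts too; hence the
   predecessor. *)
have: forall k n s, I k n s -> wploop (wp c) a b k s (fun s1 n1 => Q s1 (n + n1).-1).
  elim=> [|k IH] n s1 HI1 /=; case: ifP => ab.
  - by have [k' []] := Hb _ _ _ HI1 ab.
  - by rewrite addn1 /=; apply: He HI1 _; rewrite ab.
  - have [k' [[<-] H]] := Hb _ _ _ HI1 ab.
    apply: wp_mono H => s2 n2 /IH; apply: wploop_mono => [s3 R R' HR|s3 n3]; first exact: wp_mono.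
    by have -> : (n + (n2 + n3).+1).-1 = ((n + n2).+1 + n3).-1 by lia.
  - by rewrite addn1 /=; apply: He HI1 _; rewrite ab.
by move=> /(_ _ _ _ HI); apply: wploop_mono => [s3 R R' HR|s3 n3 //]; exact: wp_mono.
Qed.

End Sem.

(** * Addresses and correctness of the compiler *)

Definition addr S t x y z := ((t * S + x) * S + y) * S + z.

Lemma addr_inj S t x y z t' x' y' z' :
  x < S -> y < S -> z < S -> x' < S -> y' < S -> z' < S ->
  (addr S t x y z == addr S t' x' y' z') = [&& t == t', x == x', y == y' & z == z'].
Proof.
have red a a' b b' : b < S -> b' < S -> (a * S + b == a' * S + b') = (a == a') && (b == b').
  move=> hb hb'; apply/eqP/andP => [E|[/eqP -> /eqP ->] //].
  have Ea : a = a'.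
    by move: (congr1 (divn^~ S) E); rewrite !divnMDl ?(divn_small hb) ?(divn_small hb') ?addn0 //; lia.
  by move: E; rewrite Ea => /addnI ->.
move=> hx hy hz hx' hy' hz'; rewrite /addr !red //.
by rewrite -!andbA.
Qed.

Lemma addr_lt S t x y z : t < S -> x < S -> y < S -> z < S -> addr S t x y z < S ^ 4.
Proof.
have red a b T : a < T -> b < S -> a * S + b < T * S.
  by move=> ha hb; apply: (@leq_trans (a.+1 * S)); [rewrite mulSn; lia|rewrite leq_mul2r ha orbT].
move=> ht hx hy hz; rewrite /addr; apply: leq_trans (red _ _ (S ^ 3) _ hz) _; last by rewrite -expnSr.
apply: leq_trans (red _ _ (S ^ 2) _ hy) _; last by rewrite -expnSr.
by apply: leq_trans (red _ _ S _ hx) _; last by rewrite -mulnn.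
Qed.

Section Sound.
Variables (w : nat) (P : seq instr) (S : nat).
Local Notation W := (2 ^ w).

Definition code_at l (cs : seq instr) := exists A B, P = A ++ cs ++ B /\ size A = l.

Lemma code_at_cat l c1 c2 :
  code_at l (c1 ++ c2) -> code_at l c1 /\ code_at (l + size c1) c2.
Proof.
move=> [A [B [E sA]]]; split.
  by exists A, (c2 ++ B); rewrite E -catA.
by exists (A ++ c1), B; rewrite size_cat sA E -!catA.
Qed.

Lemma code_at_cons l i c : code_at l (i :: c) ->
  (l < size P /\ nth IRead P l = i) /\ code_at l.+1 c.
Proof.
rewrite -cat1s => /code_at_cat [[A [B [E sA]]] H2]; split; last by rewrite addn1 in H2.
by rewrite E !size_cat nth_cat sA ltnn subnn /=; split=> //; lia.
Qed.

Definition dstep (c c' : config) :=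
  [/\ step w P c = [:: c'], ~~ at_read P c, inp c' = inp c & ndone c' = ndone c].

Inductive dsteps : nat -> config -> config -> Prop :=
| ds0 c : dsteps 0 c c
| dsS k c c1 c2 : dstep c c1 -> dsteps k c1 c2 -> dsteps k.+1 c c2.

Lemma dsteps_trans k1 k2 c1 c2 c3 :
  dsteps k1 c1 c2 -> dsteps k2 c2 c3 -> dsteps (k1 + k2) c1 c3.
Proof. by elim=> // k c c' c'' H1 _ IH /IH; rewrite addSn; apply: dsS. Qed.

Lemma dsteps1 c c' : dstep c c' -> dsteps 1 c c'.
Proof. by move=> H; apply: dsS H (ds0 _). Qed.

Lemma dsteps_inp k c c' : dsteps k c c' -> inp c' = inp c /\ ndone c' = ndone c.
Proof. by elim=> // {c c'} {}k c c1 c2 [_ _ <- <-]. Qed.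

Record Rel (c : config) (s : state) : Prop := MkRel {
  relR : forall i, i != 28 -> reg c i = rg s i;
  relS : rg s 29 = S;
  relz : rg s 30 = 0;
  relRW : forall i, reg c i < W;
  relMW : forall a, memory c a < W;
  relM : forall t x y z, t < S -> x < S -> y < S -> z < S ->
           memory c (addr S t x y z) = mm s t x y z }.

Lemma wrapE x : x < W -> Defs.wrap w x = x.
Proof. by move=> h; rewrite /Defs.wrap modn_small. Qed.

Lemma wrap_lt x : Defs.wrap w x < W.
Proof. by rewrite /Defs.wrap ltn_mod expn_gt0. Qed.

Lemma upd_lt f d v : (forall i, f i < W) -> v < W -> forall i, upd f d v i < W.
Proof. by move=> hf hv i; rewrite /upd; case: ifP. Qed.

Lemma dst_src d : dst d -> [/\ d != 28, d != 29 & d != 30].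
Proof. by rewrite /dst !inE !negb_or => /and3P. Qed.

Lemma Rel_setr c s d v : dst d -> Rel c s -> v < W -> Rel (setreg w c d v) (setr s d v).
Proof.
move=> /dst_src [d1 d2 d3] [h1 h2 h3 h4 h5 h6] hv; split=> //=.
- by move=> i hi; rewrite /upd wrapE //; case: eqP => // _; apply: h1.
- by rewrite /upd eq_sym (negbTE d2).
- by rewrite /upd eq_sym (negbTE d3).
- by apply: upd_lt => //; apply: wrap_lt.
Qed.

Lemma Rel_scratch c s v : Rel c s -> Rel (setreg w c 28 v) s.
Proof.
move=> [h1 h2 h3 h4 h5 h6]; split=> //=.
- by move=> i hi; rewrite /upd (negbTE hi); apply: h1.
- by apply: upd_lt => //; apply: wrap_lt.
Qed.

Lemma Rel_pc c s c' : Rel c s -> reg c' = reg c -> memory c' = memory c -> Rel c' s.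
Proof. by move=> [h1 h2 h3 h4 h5 h6] E1 E2; split; rewrite ?E1 ?E2. Qed.

Lemma jump_dstep c b l i : pc c < size P -> nth IRead P (pc c) = i ->
  (forall a l', i = IJz a l' -> b = (reg c a == 0) /\ l' = l) ->
  (if i is IJz _ _ then True else if i is IJlt a a' l' then b = (reg c a < reg c a') /\ l' = l else False) ->
  dstep c (jump c b l).
Proof.
move=> hp hn H1 H2; rewrite /dstep /step /at_read hp hn.
by case: i {hn} H1 H2 => // [a l' /(_ _ _ erefl) [-> ->]|a a' l' _ [-> ->]].
Qed.

Hypothesis S16 : 16 <= S.
Hypothesis SW : S ^ 4 <= W.

Lemma addr_sound l t x y z c s : code_at l (addr_code t x y z) ->
  [&& src x, src y & src z] -> t < S ->
  [&& rg s x < S, rg s y < S & rg s z < S] -> pc c = l -> Rel c s ->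
  exists c', [/\ dsteps 7 c c', Rel c' s, pc c' = l + 7, memory c' = memory c &
    reg c' 28 = addr S t (rg s x) (rg s y) (rg s z)].
Proof.
move=> hc /and3P[sx sy sz] ht /and3P[hx hy hz] hp hR.
have hSW k : k < S ^ 4 -> k < W by move=> h; exact: leq_trans h SW.
have := addr_lt ht hx hy hz.
set a7 := addr _ _ _ _ _ => /hSW l7.
have S0 : 0 < S by lia.
pose a6 := ((t * S + rg s x) * S + rg s y) * S.
pose a5 := ((t * S + rg s x) * S + rg s y).
pose a4 := ((t * S + rg s x) * S).
pose a3 := ((t * S + rg s x)).
pose a2 := t * S.
(* The partial sums of Horner's scheme only grow, so the bound on the complete address excludes
   overflow at every intermediate instruction. *)
have l6 : a6 < W by move: l7; rewrite /a7 /addr /a6; lia.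
have l5 : a5 < W by apply: leq_ltn_trans l6; rewrite /a6 -/a5 leq_pmulr.
have l4 : a4 < W by apply: leq_ltn_trans l5; rewrite /a5 -/a4 leq_addr.
have l3 : a3 < W by apply: leq_ltn_trans l4; rewrite /a4 -/a3 leq_pmulr.
have l2 : a2 < W by apply: leq_ltn_trans l3; rewrite /a3 -/a2 leq_addr.
have l1 : t < W by apply: leq_ltn_trans l2; rewrite /a2 leq_pmulr.
have one c0 i v l0 : (l0 < size P /\ nth IRead P l0 = i) -> pc c0 = l0 ->
    step w P c0 = [:: setreg w c0 28 v] -> (if i is IRead then false else true) ->
    dstep c0 (setreg w c0 28 v).
  by move=> [q1 q2] q3 q4 q5; split=> //; rewrite /at_read q3 q1 q2; case: (i) q5.
move: hc; rewrite /addr_code.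
move/code_at_cons=> [q1] /code_at_cons [q2] /code_at_cons [q3] /code_at_cons [q4].
move/code_at_cons=> [q5] /code_at_cons [q6] /code_at_cons [q7] _.
case: hR => h1 h2 h3 h4 h5 h6.
have hR : Rel c s by split.
pose c1 := setreg w c 28 t; pose c2 := setreg w c1 28 a2.
pose c3 := setreg w c2 28 a3; pose c4 := setreg w c3 28 a4.
pose c5 := setreg w c4 28 a5; pose c6 := setreg w c5 28 a6; pose c7 := setreg w c6 28 a7.
have R1 : Rel c1 s by exact: Rel_scratch.
have R2 : Rel c2 s by exact: Rel_scratch.
have R3 : Rel c3 s by exact: Rel_scratch.
have R4 : Rel c4 s by exact: Rel_scratch.
have R5 : Rel c5 s by exact: Rel_scratch.
have R6 : Rel c6 s by exact: Rel_scratch.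
have R7 : Rel c7 s by exact: Rel_scratch.
have r28 c0 v : v < W -> reg (setreg w c0 28 v) 28 = v.
  by move=> hv; rewrite /= /upd eqxx wrapE.
exists c7; split=> //; last by apply: r28.
- apply: (dsS (c1 := c1)); first (apply: (one _ _ _ _ q1 hp) => //).
    by rewrite /step hp; case: q1 => -> ->.
  apply: (dsS (c1 := c2)); first (apply: (one _ _ _ _ q2) => //; first by rewrite /= hp).
    by rewrite /step [pc _]/= hp; case: q2 => -> ->; rewrite (relR R1 (i := 29)) // h2 /c1 r28.
  apply: (dsS (c1 := c3)); first (apply: (one _ _ _ _ q3) => //; first by rewrite /= hp).
    by rewrite /step [pc _]/= hp; case: q3 => -> ->; rewrite (relR R2 (i := x)) // /c2 r28.
  apply: (dsS (c1 := c4)); first (apply: (one _ _ _ _ q4) => //; first by rewrite /= hp).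
    by rewrite /step [pc _]/= hp; case: q4 => -> ->; rewrite (relR R3 (i := 29)) // h2 /c3 r28.
  apply: (dsS (c1 := c5)); first (apply: (one _ _ _ _ q5) => //; first by rewrite /= hp).
    by rewrite /step [pc _]/= hp; case: q5 => -> ->; rewrite (relR R4 (i := y)) // /c4 r28.
  apply: (dsS (c1 := c6)); first (apply: (one _ _ _ _ q6) => //; first by rewrite /= hp).
    by rewrite /step [pc _]/= hp; case: q6 => -> ->; rewrite (relR R5 (i := 29)) // h2 /c5 r28.
  apply: dsteps1; apply: (one _ _ _ _ q7) => //; first by rewrite /= hp.
  by rewrite /step [pc _]/= hp; case: q7 => -> ->; rewrite (relR R6 (i := z)) // /c6 r28.
- by rewrite /= hp; lia.
Qed.

Lemma one_dstep c i c' : pc c < size P -> nth IRead P (pc c) = i ->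
  (if i is IRead then false else true) -> inp c' = inp c -> ndone c' = ndone c ->
  step w P c = [:: c'] -> dstep c c'.
Proof. by move=> h1 h2 h3 h4 h5 h6; split=> //; rewrite /at_read h1 h2; case: (i) h3. Qed.

(** Commands contain neither [IRand] nor [IRead], so a specification yields one deterministic run of
    the counted length. Random draws and input are handled in the glue between compiled blocks. *)
Theorem wp_sound c l conf s Q : wf c -> code_at l (compile l c) ->
  pc conf = l -> Rel conf s -> wp S W c s Q ->
  exists s' k conf', [/\ Q s' k, dsteps k conf conf', Rel conf' s' & pc conf' = l + csize c].
Proof.
elim: c l conf s Q => /= [d k|d a b|d a b|d t x y z|t x y z r|c1 IH1 c2 IH2|a b c1 IH1 c2 IH2|a b c1 IH1]
  l conf s Q.
- move=> hd /code_at_cons [[q1 q2] _] hp hR [hk hQ].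
  exists (setr s d k), 1, (setreg w conf d k); split=> //; last by rewrite /= hp addn1.
    by apply/dsteps1/(one_dstep (i := IConst d k)); rewrite ?hp // /step hp q1 q2.
  exact: Rel_setr.
- move=> /and3P[hd ha hb] /code_at_cons [[q1 q2] _] hp hR [hk hQ].
  exists (setr s d (rg s a + rg s b)), 1, (setreg w conf d (rg s a + rg s b));
    split=> //; last by rewrite /= hp addn1.
    apply/dsteps1/(one_dstep (i := IAdd d a b)); rewrite ?hp //.
    by rewrite /step hp q1 q2 !(relR hR).
  exact: Rel_setr.
- move=> /and3P[hd ha hb] /code_at_cons [[q1 q2] _] hp hR hQ.
  exists (setr s d (rg s a - rg s b)), 1, (setreg w conf d (rg s a - rg s b));
    split=> //; last by rewrite /= hp addn1.
    apply/dsteps1/(one_dstep (i := ISub d a b)); rewrite ?hp //.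
    by rewrite /step hp q1 q2 !(relR hR).
  apply: Rel_setr => //; apply: leq_ltn_trans (leq_subr _ _) _.
  by rewrite -(relR hR) //; apply: (relRW hR).
- move=> /and5P[hd hx hy hz ht] hc0; have [hc /code_at_cons [[q1 q2] _]] := code_at_cat (c1 := addr_code t x y z) hc0; move=> hp hR [hk hQ].
  have tS : t < S by lia.
  have [|c1 [d1 R1 p1 m1 r1]] := addr_sound hc _ tS hk hp hR; first by rewrite hx hy hz.
  case/and3P: hk => kx ky kz; rewrite /= in q1 q2.
  set v := mm s _ _ _ _ in hQ; have vE : memory c1 (reg c1 28) = v by rewrite r1 (relM R1).
  exists (setr s d v), 8, (setreg w c1 d v); split=> //; last by rewrite /= p1; lia.
    apply: (@dsteps_trans 7 1) d1 _; apply/dsteps1/(one_dstep (i := ILoad d 28)); rewrite ?p1 //.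
    by rewrite /step p1 q1 q2 vE.
  by apply: Rel_setr => //; rewrite -vE; apply: (relMW R1).
- move=> /and5P[hr hx hy hz ht] hc0; have [hc /code_at_cons [[q1 q2] _]] := code_at_cat (c1 := addr_code t x y z) hc0; move=> hp hR [hk hQ].
  have tS : t < S by lia.
  have [|c1 [d1 R1 p1 m1 r1]] := addr_sound hc _ tS hk hp hR; first by rewrite hx hy hz.
  case/and3P: hk => kx ky kz; rewrite /= in q1 q2.
  set s' := MkSt _ _ in hQ.
  exists s', 8, (Config (pc c1).+1 (reg c1) (upd (memory c1) (reg c1 28) (reg c1 r)) (inp c1) (ndone c1)).
  split=> //; last by rewrite /= p1; lia.
    apply: (@dsteps_trans 7 1) d1 _; apply/dsteps1/(one_dstep (i := IStore 28 r)); rewrite ?p1 //.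
    by rewrite /step p1 q1 q2 -p1.
  case: R1 => e1 e2 e3 e4 e5 e6; split=> //= [|t' x' y' z' ht' hx' hy' hz'].
    by apply: upd_lt.
  by rewrite /upd r1 addr_inj // /set4 e6 // e1.
- move=> /andP[w1 w2] /code_at_cat [hc1 hc2] hp hR hQ; rewrite size_compile in hc2.
  have [s1 [k1 [f1 [Q1 D1 R1 p1]]]] := IH1 _ _ _ _ w1 hc1 hp hR hQ.
  have [s2 [k2 [f2 [Q2 D2 R2 p2]]]] := IH2 _ _ _ _ w2 hc2 p1 R1 Q1.
  exists s2, (k1 + k2), f2; split=> //; first exact: dsteps_trans D2.
  by rewrite p2; lia.
- move=> /and4P[ha hb w1 w2] /code_at_cons [[q1 q2]] /code_at_cat [hc2] /code_at_cons [[q3 q4]] hc1 hp hR hQ.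
  rewrite size_compile in q3 q4 hc1.
  have := jump_dstep (b := rg s a < rg s b) (l := (l + csize c2).+2) (c := conf) (i := IJlt a b (l + csize c2).+2).
  rewrite hp !(relR hR) // => /(_ q1 q2) J.
  have {}J : dstep conf (jump conf (rg s a < rg s b) (l + csize c2).+2) by apply: J.
  have RJ : Rel (jump conf (rg s a < rg s b) (l + csize c2).+2) s by exact: Rel_pc hR _ _.
  case: ifP hQ J RJ => hlt hQ J RJ.
    rewrite !addSn in hc1.
    have [//|s1 [k1 [f1 [Q1 D1 R1 p1]]]] := IH1 (l + csize c2).+2 _ _ _ w1 hc1 _ RJ hQ.
    exists s1, k1.+1, f1; split=> //; first exact: dsS J D1.
    by rewrite p1; lia.
  have [|s1 [k1 [f1 [Q1 D1 R1 p1]]]] := IH2 l.+1 _ _ _ w2 hc2 _ RJ hQ.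
    by rewrite /= hp.
  pose f2 := jump f1 true (l + csize c2 + csize c1).+2.
  exists s1, k1.+2, f2; split=> //.
  - apply: dsS J _; rewrite -addn1; apply: dsteps_trans D1 _; apply: dsteps1.
    apply: (jump_dstep (i := IJz 30 (l + csize c2 + csize c1).+2)); rewrite ?p1 //.
    by move=> a' l' [<- <-]; rewrite (relR R1) // (relz R1).
  - exact: Rel_pc R1 _ _.
  - by rewrite /=; lia.
- move=> /and3P[ha hb w1] /code_at_cons [[q1 q2]] /code_at_cat [hc1] /code_at_cons [[q3 q4] _] hp hR [N hQ].
  rewrite size_compile in q3 q4.
  pose L := l.+1 + csize c1.
  (* Runs are first treated from the bottom test on, by induction on the iteration bound; entering
     the loop is then a single jump to that test. *)
  have main : forall N s conf Q, wploop (wp S W c1) a b N s Q -> pc conf = L -> Rel conf s ->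
    exists s' k conf', [/\ Q s' k, dsteps k conf conf', Rel conf' s' & pc conf' = L.+1].
    move=> {N s hQ hR Q hp conf}; elim=> [|N IH] s conf Q /= hQ hp hR.
      case: ifP hQ => // hlt hQ.
      exists s, 1, (jump conf false l.+1); split=> //; last by rewrite /= hp.
        apply/dsteps1/(jump_dstep (i := IJlt a b l.+1)); rewrite ?hp //.
        by rewrite !(relR hR) // hlt.
      exact: Rel_pc hR _ _.
    have J : dstep conf (jump conf (rg s a < rg s b) l.+1).
      apply: (jump_dstep (i := IJlt a b l.+1)); rewrite ?hp //.
      by rewrite !(relR hR).
    have RJ : Rel (jump conf (rg s a < rg s b) l.+1) s by exact: Rel_pc hR _ _.
    case: ifP hQ J RJ => hlt hQ J RJ; last first.
      by exists s, 1, (jump conf false l.+1); split=> //; [exact: dsteps1|rewrite /= hp].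
    have [//|s1 [k1 [f1 [Q1 D1 R1 p1]]]] := IH1 l.+1 _ _ _ w1 hc1 _ RJ hQ.
    have [//|s2 [k2 [f2 [Q2 D2 R2 p2]]]] := IH _ _ _ Q1 _ R1.
    exists s2, (k1 + k2).+1, f2; split=> //.
    by apply: dsS J _; apply: dsteps_trans D2.
  pose f0 := jump conf true L.
  have J : dstep conf f0.
    apply: (jump_dstep (i := IJz 30 (l + csize c1).+1)); rewrite ?hp //.
    by move=> a' l' [<- <-]; rewrite (relR hR) // (relz hR) /L; split=> //; lia.
  have [//||s1 [k1 [f1 [Q1 D1 R1 p1]]]] := main _ _ f0 _ hQ; first exact: Rel_pc hR _ _.
  exists s1, k1.+1, f1; split=> //; first exact: dsS J D1.
  by rewrite p1 /L; lia.
Qed.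

End Sound.

(** * Indexed sets in zero-initialised memory *)

(* Sets are stored under keys [(x, y)] as the first [cnt] entries of a permutation
   [pg] with inverse [qg]; positions and elements are numbered from 1, and a cell
   [0] stands for the identity, so that zero memory encodes empty sets.  Key
   [(x, 0)] holds the colors of the neighbours above [x] (with multiplicities in
   [hc]), key [(x, y)] with [y > 0] the successors of the neighbours [u] of [x]
   with [maxn (lv x) (lv u) = y]. *)
Definition col (m : mem4) v := m 0 0 0 v.
Definition lv (m : mem4) v := m 1 0 0 v.
Definition cnt (m : mem4) x y := m 2 0 x y.
Definition pg (m : mem4) x y i := if m 3 x y i == 0 then i else m 3 x y i.
Definition qg (m : mem4) x y e := if m 4 x y e == 0 then e else m 4 x y e.
Definition hc (m : mem4) x c := m 5 0 x c.
Definition tmp (m : mem4) i := m 6 0 0 i.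

Definition sm m x y e := qg m x y e <= cnt m x y.

Definition mov d a := Add d a 30.
(** Here and below [Subn 9 9 9] touches only the scratch register 9 and serves as a skip. *)
Definition ldp d t j :=
  Seq (Ld d t 3 4 j) (If 30 d (Subn 9 9 9) (mov d j)).
Definition swap_cmd :=
  Seq (ldp 6 4 5) (Seq (ldp 7 3 8) (Seq (St 3 3 4 6 7) (Seq (St 4 3 4 7 6)
  (Seq (St 3 3 4 8 5) (St 4 3 4 5 8))))).
(** Insertion swaps the element to the position right after the prefix, deletion to the last
    position of the prefix; moving the counter by one then changes the membership of this element
    alone. *)
Definition add_cmd :=
  Seq (Ld 8 2 30 3 4) (Seq (Add 8 8 26) (Seq (St 2 30 3 4 8) swap_cmd)).
Definition del_cmd :=
  Seq (Ld 8 2 30 3 4) (Seq swap_cmd (Seq (Subn 8 8 26) (St 2 30 3 4 8))).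
(* Adds (resp. removes) one occurrence of the color in register 12 to the
   multiset of colors seen by the vertex in register 3. *)
Definition inc_cmd :=
  Seq (Ld 9 5 30 3 12) (Seq (Add 8 9 26) (Seq (St 5 30 3 12 8)
  (If 30 9 (Subn 9 9 9) (Seq (mov 4 30) (Seq (mov 5 12) add_cmd))))).
Definition dec_cmd :=
  Seq (Ld 9 5 30 3 12) (Seq (Subn 9 9 26) (Seq (St 5 30 3 12 9)
  (If 30 9 (Subn 9 9 9) (Seq (mov 4 30) (Seq (mov 5 12) del_cmd))))).

Definition eqr (L : seq nat) (r r' : nat -> nat) := forall i, i \notin L -> r' i = r i.

Lemma eqr_trans L1 L2 L r1 r2 r3 : eqr L1 r1 r2 -> eqr L2 r2 r3 ->
  {subset L1 <= L} -> {subset L2 <= L} -> eqr L r1 r3.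
Proof.
move=> h1 h2 s1 s2 i hi; rewrite h2 ?h1 //; apply: contra hi; [exact: s1|exact: s2].
Qed.

Lemma eqr_upd L r r' d v : eqr L r r' -> d \in L -> eqr L r (upd r' d v).
Proof. by move=> h hd i hi; rewrite /upd; case: eqP hi => [->|_ hi]; [rewrite hd|exact: h]. Qed.

Lemma eqr_refl L r : eqr L r r. Proof. by []. Qed.

Section WpRules.
Variables S W : nat.
Local Notation wp := (wp S W).
Implicit Types (r : nat -> nat) (m : mem4) (Q : state -> nat -> Prop).

Lemma wpSeq c1 c2 s Q :
  wp c1 s (fun s1 n1 => wp c2 s1 (fun s2 n2 => Q s2 (n1 + n2))) -> wp (Seq c1 c2) s Q.
Proof. by []. Qed.

Lemma wpConst d k r m Q : k < W -> Q (MkSt (upd r d k) m) 1 -> wp (Const d k) (MkSt r m) Q.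
Proof. by split. Qed.

Lemma wpAdd d a b r m v Q : v < W -> r a + r b = v -> Q (MkSt (upd r d v) m) 1 ->
  wp (Add d a b) (MkSt r m) Q.
Proof. by move=> h1 h2 h3; split; rewrite /= h2. Qed.

Lemma wpSub d a b r m v Q : r a - r b = v -> Q (MkSt (upd r d v) m) 1 ->
  wp (Subn d a b) (MkSt r m) Q.
Proof. by move=> h2 h3; rewrite /= /setr h2. Qed.

Lemma wpLd d t x y z r m vx vy vz v Q : r x = vx -> r y = vy -> r z = vz ->
  vx < S -> vy < S -> vz < S -> m t vx vy vz = v ->
  Q (MkSt (upd r d v) m) 8 -> wp (Ld d t x y z) (MkSt r m) Q.
Proof. by move=> <- <- <- hx hy hz h2 h3; rewrite /= /setr h2 hx hy hz. Qed.

Lemma wpSt t x y z a r m vx vy vz v Q : r x = vx -> r y = vy -> r z = vz -> r a = v ->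
  vx < S -> vy < S -> vz < S ->
  Q (MkSt r (set4 m t vx vy vz v)) 8 -> wp (St t x y z a) (MkSt r m) Q.
Proof. by move=> <- <- <- <- hx hy hz h3; rewrite /= hx hy hz. Qed.

Lemma wpIf a b c1 c2 r m va vb Q : r a = va -> r b = vb ->
  (va < vb -> wp c1 (MkSt r m) (fun s n => Q s n.+1)) ->
  (vb <= va -> wp c2 (MkSt r m) (fun s n => Q s n.+2)) ->
  wp (If a b c1 c2) (MkSt r m) Q.
Proof. by move=> <- <- h1 h2 /=; case: ltnP => h; [apply: h1|apply: h2]. Qed.

End WpRules.
Arguments wpLd {S W d t x y z r m vx vy vz v Q}.
Arguments wpSt {S W t x y z a r m vx vy vz v Q}.
Arguments wpAdd {S W d a b r m v Q}.
Arguments wpSub {S W d a b r m v Q}.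
Arguments wpIf {S W a b c1 c2 r m va vb Q}.
Arguments wpSeq {S W c1 c2 s Q}.

Ltac side := first [by rewrite /upd /= | lia].

Lemma upd_eq f i x : upd f i x i = x. Proof. by rewrite /upd eqxx. Qed.

Section Sets.
Variables n D S W : nat.
Hypothesis SE : S = n + D + 16.
Hypothesis SW : 4 * S <= W.
Local Notation wp := (wp S W).

(* Register 28 is scratch space of the compiled code. *)
Definition regs_ok (r : nat -> nat) :=
  [/\ r 10 = n, r 11 = D, r 26 = 1, r 29 = S & r 30 = 0].

Lemma regs_ok_eqr L r r' : regs_ok r -> eqr L r r' ->
  all (fun i => i \notin L) [:: 10; 11; 26; 29; 30] -> regs_ok r'.
Proof. by move=> [h1 h2 h3 h4 h5] h /= /and5P[k1 k2 k3 k4 /andP[k5 _]]; split; rewrite h. Qed.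

Definition usize y := if y == 0 then D.+1 else n.

Record SOK (m : mem4) x y : Prop := MkSOK {
  sok_cnt : cnt m x y <= usize y;
  sok_p : forall i, 1 <= i <= usize y -> 1 <= pg m x y i <= usize y /\ qg m x y (pg m x y i) = i;
  sok_q : forall e, 1 <= e <= usize y -> 1 <= qg m x y e <= usize y /\ pg m x y (qg m x y e) = e }.

Lemma usize_lt y : usize y < S. Proof. by rewrite /usize; case: ifP => _; lia. Qed.

Definition swapm m x y e j : mem4 :=
  let i := qg m x y e in let f := pg m x y j in
  set4 (set4 (set4 (set4 m 3 x y i f) 4 x y f i) 3 x y j e) 4 x y e j.

Lemma ldp_spec d t j r m Q : d \notin [:: 3; 4; 9; 30; j] -> j != 9 -> r 30 = 0 ->
  r 3 < S -> r 4 < S -> r j < S ->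
  (forall r' k, eqr [:: d; 9] r r' -> k <= 11 ->
    r' d = (if m t (r 3) (r 4) (r j) == 0 then r j else m t (r 3) (r 4) (r j)) ->
    Q (MkSt r' m) k) -> wp (ldp d t j) (MkSt r m) Q.
Proof.
rewrite !inE !negb_or => /and5P[d3 d4 d9 d30 dj] j9 z hx hy hj H.
apply: wpSeq; apply: (wpLd (vx := r 3) (vy := r 4) (vz := r j)) => //.
set v := m t _ _ _ in H *.
have e30 : upd r d v 30 = 0 by rewrite /upd eq_sym (negbTE d30) z.
have q1 : eqr [:: d; 9] r (upd r d v) by apply: eqr_upd; rewrite ?inE ?eqxx.
apply: (wpIf (va := 0) (vb := v)) => //; first by rewrite upd_eq.
  move=> v0; apply: (wpSub); first reflexivity.
  apply: H => //; first by apply: eqr_upd; rewrite ?inE ?eqxx ?orbT.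
  by rewrite /upd eqxx (negbTE d9); case: (v) v0.
move=> v0; have {}v0 : v = 0 by lia.
apply: (wpAdd (v := r j)); first by lia.
  by rewrite e30 addn0 /upd eq_sym (negbTE dj).
by apply: H => //; [apply: eqr_upd; rewrite ?inE ?eqxx|rewrite upd_eq v0].
Qed.

Lemma swap_spec r m Q : r 30 = 0 -> SOK m (r 3) (r 4) -> r 3 < S -> r 4 < S ->
  1 <= r 5 <= usize (r 4) -> 1 <= r 8 <= usize (r 4) ->
  (forall r' k, eqr [:: 6; 7; 9] r r' -> k <= 54 ->
    Q (MkSt r' (swapm m (r 3) (r 4) (r 5) (r 8))) k) -> wp swap_cmd (MkSt r m) Q.
Proof.
move=> z ok hx hy he hj H; have lU := usize_lt (r 4).
have [hi _] := sok_q ok he; have [hf _] := sok_p ok hj.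
apply: wpSeq; apply: ldp_spec => // [|r1 k1 q1 hk1]; first by lia.
rewrite -/(qg m (r 3) (r 4) (r 5)) => e6; have Z1 : r1 30 = 0 by rewrite q1.
apply: wpSeq; apply: ldp_spec => //; rewrite ?q1 //; first by lia.
move=> r2 k2 q2 hk2; rewrite -/(pg m (r 3) (r 4) (r 8)) => e7.
have e3 : r2 3 = r 3 by rewrite q2 // q1.
have e4 : r2 4 = r 4 by rewrite q2 // q1.
have e5 : r2 5 = r 5 by rewrite q2 // q1.
have e8 : r2 8 = r 8 by rewrite q2 // q1.
have {}e6 : r2 6 = qg m (r 3) (r 4) (r 5) by rewrite q2.
apply: wpSeq; apply: wpSt; rewrite ?e3 ?e4 ?e5 ?e6 ?e7 ?e8; try reflexivity; try lia.
apply: wpSeq; apply: wpSt; rewrite ?e3 ?e4 ?e5 ?e6 ?e7 ?e8; try reflexivity; try lia.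
apply: wpSeq; apply: wpSt; rewrite ?e3 ?e4 ?e5 ?e6 ?e7 ?e8; try reflexivity; try lia.
apply: wpSt; rewrite ?e3 ?e4 ?e5 ?e6 ?e7 ?e8; try reflexivity; try lia.
by apply: H; [apply: (eqr_trans q1 q2) => i; rewrite !inE => /orP[]/eqP-> | lia].
Qed.

Lemma swapm_pg m x y e j x' y' k : SOK m x y -> 1 <= e <= usize y -> 1 <= j <= usize y ->
  pg (swapm m x y e j) x' y' k =
  if (x' == x) && (y' == y)
  then if k == j then e else if k == qg m x y e then pg m x y j else pg m x y k
  else pg m x' y' k.
Proof.
move=> ok he hj; have [hi _] := sok_q ok he; have [hf _] := sok_p ok hj.
rewrite {1}/pg /swapm /set4 /=; case: (eqVneq x' x) => [->|] //=; case: (eqVneq y' y) => [->|] //=.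
case: (k == j) => /=; first by case: (e) he.
by case: (k == qg m x y e) => //=; case: (pg m x y j) hf.
Qed.

Lemma swapm_qg m x y e j x' y' k : SOK m x y -> 1 <= e <= usize y -> 1 <= j <= usize y ->
  qg (swapm m x y e j) x' y' k =
  if (x' == x) && (y' == y)
  then if k == e then j else if k == pg m x y j then qg m x y e else qg m x y k
  else qg m x' y' k.
Proof.
move=> ok he hj; have [hi _] := sok_q ok he; have [hf _] := sok_p ok hj.
rewrite {1}/qg /swapm /set4 /=; case: (eqVneq x' x) => [->|] //=; case: (eqVneq y' y) => [->|] //=.
case: (k == e) => /=; first by case: (j) hj.
by case: (k == pg m x y j) => //=; case: (qg m x y e) hi.
Qed.

Lemma pq_swap m x y e j : SOK m x y -> 1 <= e <= usize y -> 1 <= j <= usize y ->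
  let m' := swapm m x y e j in
  (forall i, 1 <= i <= usize y -> 1 <= pg m' x y i <= usize y /\ qg m' x y (pg m' x y i) = i) /\
  (forall e, 1 <= e <= usize y -> 1 <= qg m' x y e <= usize y /\ pg m' x y (qg m' x y e) = e).
Proof.
move=> ok he hj m'; have [hi pi] := sok_q ok he; have [hf qf] := sok_p ok hj.
split=> k hk; rewrite !swapm_pg // !swapm_qg // !eqxx /=.
- have [hpk qpk] := sok_p ok hk.
  case: (eqVneq k j) => [->|kj]; first by rewrite eqxx.
  case: (eqVneq k (qg m x y e)) => [->|ki].
    by split=> //; rewrite eqxx; case: eqP => // E; rewrite -E qf.
  split=> //; have -> : (pg m x y k == e) = false by apply/eqP => E; rewrite -E qpk eqxx in ki.
  have -> // : (pg m x y k == pg m x y j) = false.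
  by apply/eqP => E; rewrite -qpk E qf eqxx in kj.
- have [hqk pqk] := sok_q ok hk.
  case: (eqVneq k e) => [->|ke]; first by rewrite eqxx.
  case: (eqVneq k (pg m x y j)) => [->|kf].
    by split=> //; rewrite eqxx; case: eqP => // E; rewrite -E pi.
  split=> //; have -> : (qg m x y k == j) = false by apply/eqP => E; rewrite -E pqk eqxx in kf.
  have -> // : (qg m x y k == qg m x y e) = false.
  by apply/eqP => E; rewrite -pqk E pi eqxx in ke.
Qed.

(* The effect on memory of inserting ([b = true]) or deleting ([b = false])
   element [e] in the set stored at key [(x, y)]. *)
Record set_eff (m m' : mem4) x y e (b : bool) : Prop := SetEff {
  se_tag : forall t a1 a2 a3, t \notin [:: 2; 3; 4] -> m' t a1 a2 a3 = m t a1 a2 a3;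
  se_ok : forall x' y', SOK m x' y' -> SOK m' x' y';
  se_sm : forall x' y' e', 1 <= e' <= usize y' ->
     sm m' x' y' e' = if [&& x' == x, y' == y & e' == e] then b else sm m x' y' e';
  se_cnt : cnt m' x y = if b then (cnt m x y).+1 else (cnt m x y).-1 }.

Lemma swapm_tag m x y e j t a1 a2 a3 : t \notin [:: 3; 4] -> swapm m x y e j t a1 a2 a3 = m t a1 a2 a3.
Proof. by rewrite !inE negb_or /swapm /set4 => /andP[/negbTE -> /negbTE ->]. Qed.

Lemma sok_other m m' x y : (forall t a, t \in [:: 3; 4] -> m' t x y a = m t x y a) -> cnt m' x y = cnt m x y ->
  SOK m x y -> SOK m' x y.
Proof.
move=> E1 E2 [h1 h2 h3]; split; first by rewrite E2.
  by move=> i /h2; rewrite /pg /qg !E1 //.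
by move=> i /h3; rewrite /pg /qg !E1 //.
Qed.

Lemma swapm_other m x y e j t x' y' k : (x' != x) || (y' != y) ->
  swapm m x y e j t x' y' k = m t x' y' k.
Proof. by rewrite /swapm /set4; case: (x' == x) => //=; case: (y' == y) => //=; rewrite !andbF. Qed.

Lemma add_spec r m Q : regs_ok r -> SOK m (r 3) (r 4) -> r 3 < S -> r 4 < S ->
  1 <= r 5 <= usize (r 4) -> ~~ sm m (r 3) (r 4) (r 5) ->
  (forall r' m' k, eqr [:: 6; 7; 8; 9] r r' -> set_eff m m' (r 3) (r 4) (r 5) true -> k <= 80 ->
    Q (MkSt r' m') k) -> wp add_cmd (MkSt r m) Q.
Proof.
move=> [_ _ o _ z] ok hx hy he; rewrite /sm -ltnNge => hs H; have lU := usize_lt (r 4).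
set x := r 3 in ok hx hs H *; set y := r 4 in ok hy hs he H lU *.
set e := r 5 in he hs H *; have [hq pq] := sok_q ok he.
have hc' : 1 <= (cnt m x y).+1 <= usize y by lia.
apply: wpSeq; apply: (wpLd (vx := 0) (vy := x) (vz := y)) => //; try lia.
rewrite -/(cnt m x y).
apply: wpSeq; apply: (wpAdd (v := (cnt m x y).+1)); first lia.
  by rewrite /upd /= o addn1.
apply: wpSeq; apply: (wpSt (vx := 0) (vy := x) (vz := y) (v := (cnt m x y).+1)); [> side .. | idtac].
set m1 := set4 _ _ _ _ _ _.
have ok1 : SOK m1 x y.
  have [h1 h2 h3] := ok; split=> //.
  by rewrite {1}/cnt /m1 /set4 !eqxx; case/andP: hc'.
have d1 t x' y' k : t != 2 -> m1 t x' y' k = m t x' y' k by rewrite /m1 /set4 => /negbTE ->.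
set r2 := upd _ _ _; have r23 : r2 3 = x by []. have r24 : r2 4 = y by []. have r25 : r2 5 = e by [].
have r28 : r2 8 = (cnt m x y).+1 by [].
apply: swap_spec; rewrite ?r23 ?r24 ?r25 ?r28 //.
move=> r' k hr hk; apply: H; last lia.
  by apply: (eqr_trans (r2 := r2) (L1 := [:: 8]) _ hr); [do 2 (apply: eqr_upd; last by [])|move=> i|move=> i];
    rewrite // !inE; [move/eqP ->|case/or3P=> /eqP ->].
set j := (cnt m x y).+1 in hc' *.
have [P1 P2] := pq_swap ok1 he hc'.
have hcn x' y' : cnt (swapm m1 x y e j) x' y' = if (x' == x) && (y' == y) then j else cnt m x' y'.
  by rewrite /cnt swapm_tag // /m1 /set4 /= andbT.
split.
- move=> t a1 a2 a3; rewrite !inE !negb_or => /and3P[t2 t3 t4].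
  by rewrite swapm_tag ?d1 // !inE negb_or t3.
- move=> x' y' ok'; case: (boolP ((x' == x) && (y' == y))) => [/andP[/eqP -> /eqP ->]|ne].
    by split=> //; rewrite hcn !eqxx; case/andP: hc'.
  apply: sok_other ok'; last by rewrite hcn (negbTE ne).
  by move=> t a; rewrite !inE => /orP[] /eqP ->; rewrite swapm_other -?negb_and // d1.
- move=> x' y' e' he'; rewrite /sm hcn swapm_qg //.
  case: (eqVneq x' x) he' => [->|] //=; case: (eqVneq y' y) => [->|] //= he'.
  rewrite -/(qg m1 x y e') -[qg m1 x y e]/(qg m x y e) -[pg m1 x y j]/(pg m x y j) -[qg m1 x y e']/(qg m x y e').
  case: (eqVneq e' e) => [_|ne]; first exact: leqnn.
  have [_ pj] := sok_p ok hc'.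
  (* The element displaced from position [j] lands on the old position of [e], which lies beyond
     [j], so it stays a non-member. *)
  case: (eqVneq e' (pg m x y j)) => [Ej|nj].
    rewrite Ej pj /j ltnn; apply/negbTE; rewrite -ltnNge.
    have : qg m x y e != j by apply/eqP => E; case/eqP: ne; rewrite Ej -E pq.
    by rewrite /j; lia.
  rewrite /j; apply/idP/idP; last lia.
  by rewrite leq_eqVlt => /orP[/eqP E|//]; case/eqP: nj; rewrite /j -E; have [] := sok_q ok he'.
- by rewrite hcn !eqxx.
Qed.

Lemma del_spec r m Q : regs_ok r -> SOK m (r 3) (r 4) -> r 3 < S -> r 4 < S ->
  1 <= r 5 <= usize (r 4) -> sm m (r 3) (r 4) (r 5) ->
  (forall r' m' k, eqr [:: 6; 7; 8; 9] r r' -> set_eff m m' (r 3) (r 4) (r 5) false -> k <= 80 ->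
    Q (MkSt r' m') k) -> wp del_cmd (MkSt r m) Q.
Proof.
move=> [_ _ o _ z] ok hx hy he; rewrite /sm => hs H; have lU := usize_lt (r 4).
set x := r 3 in ok hx hs H *; set y := r 4 in ok hy hs he H lU *.
set e := r 5 in he hs H *; have [hq pq] := sok_q ok he; have cU := sok_cnt ok.
have hc' : 1 <= cnt m x y <= usize y by lia.
have [hp qp] := sok_p ok hc'.
apply: wpSeq; apply: (wpLd (vx := 0) (vy := x) (vz := y)) => //; try lia.
rewrite -/(cnt m x y); set j := cnt m x y in hs cU hc' hp qp *.
set r2 := upd _ _ _; have r23 : r2 3 = x by []. have r24 : r2 4 = y by []. have r25 : r2 5 = e by [].
have r28 : r2 8 = j by [].
apply: wpSeq; apply: swap_spec; rewrite ?r23 ?r24 ?r25 ?r28 //.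
move=> r' k hr hk.
have r'8 : r' 8 = j by rewrite hr.
have r'3 : r' 3 = x by rewrite hr.
have r'4 : r' 4 = y by rewrite hr.
have r'30 : r' 30 = 0 by rewrite hr.
have r'26 : r' 26 = 1 by rewrite hr.
apply: wpSeq; apply: (wpSub (v := j.-1)); first by rewrite r'8 r'26 subn1.
apply: (wpSt (vx := 0) (vy := x) (vz := y) (v := j.-1)); [> side .. | rewrite ?upd_eq].
have [P1 P2] := pq_swap ok he hc'.
set m0 := swapm m x y e j in P1 P2 *; set m1 := set4 _ _ _ _ _ _.
have d1 t x' y' k' : t != 2 -> m1 t x' y' k' = m0 t x' y' k' by rewrite /m1 /set4 => /negbTE ->.
have hcn x' y' : cnt m1 x' y' = if (x' == x) && (y' == y) then j.-1 else cnt m x' y'.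
  by rewrite /cnt /m1 {1}/set4 /= /m0 swapm_tag.
apply: H; last lia.
  apply: eqr_upd => //.
  by apply: (eqr_trans (r2 := r2) (L1 := [:: 8]) _ hr); [apply: eqr_upd|move=> i|move=> i];
    rewrite // !inE; [move/eqP ->|case/or3P=> /eqP ->].
split.
- move=> t a1 a2 a3; rewrite !inE !negb_or => /and3P[t2 t3 t4].
  by rewrite d1 // /m0 swapm_tag // !inE negb_or t3.
- move=> x' y' ok'; case: (boolP ((x' == x) && (y' == y))) => [/andP[/eqP -> /eqP ->]|ne].
    by split; [rewrite hcn !eqxx /=; lia|exact: P1|exact: P2].
  apply: sok_other ok'; last by rewrite hcn (negbTE ne).
  by move=> t a; rewrite !inE => /orP[] /eqP ->; rewrite d1 // /m0 swapm_other -?negb_and.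
- move=> x' y' e' he'; rewrite /sm hcn -[qg m1 x' y' e']/(qg m0 x' y' e') swapm_qg //.
  case: (eqVneq x' x) he' => [->|] //=; case: (eqVneq y' y) => [->|] //= he'.
  case: (eqVneq e' e) => [_|ne]; first by apply/negbTE; lia.
  (* The last element of the prefix moves into the gap left by [e], strictly before [j], and stays a
     member. *)
  rewrite -/j; case: (eqVneq e' (pg m x y j)) => [Ej|nj].
    have : qg m x y e != j by apply/eqP => E; case/eqP: ne; rewrite Ej -E pq.
    by rewrite Ej qp leqnn; move=> *; apply/idP; lia.
  apply/idP/idP; first lia.
  by rewrite leq_eqVlt => /orP[/eqP E|]; [case/eqP: nj; rewrite -E; have [] := sok_q ok he'|lia].
- by rewrite hcn !eqxx.
Qed.

(* [b = true]: one more neighbour of color [c] above [x]; [b = false]: one less. *)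
Record hc_eff (m m' : mem4) x c (b : bool) : Prop := HcEff {
  he_tag : forall t a1 a2 a3, t \notin [:: 2; 3; 4; 5] -> m' t a1 a2 a3 = m t a1 a2 a3;
  he_ok : forall x' y', SOK m x' y' -> SOK m' x' y';
  he_hc : forall x' c', hc m' x' c' =
     if (x' == x) && (c' == c) then if b then (hc m x c).+1 else (hc m x c).-1 else hc m x' c';
  he_smy : forall x' y' e', 0 < y' -> 1 <= e' <= usize y' -> sm m' x' y' e' = sm m x' y' e';
  he_sm0 : forall x' c', 1 <= c' <= D.+1 ->
     sm m' x' 0 c' = if (x' == x) && (c' == c) then 0 < hc m' x c else sm m x' 0 c' }.

Lemma inc_spec r m Q : regs_ok r -> SOK m (r 3) 0 -> r 3 < S -> hc m (r 3) (r 12) < S ->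
  1 <= r 12 <= D.+1 -> sm m (r 3) 0 (r 12) = (0 < hc m (r 3) (r 12)) ->
  (forall r' m' k, eqr [:: 4; 5; 6; 7; 8; 9] r r' -> hc_eff m m' (r 3) (r 12) true -> k <= 110 ->
    Q (MkSt r' m') k) -> wp inc_cmd (MkSt r m) Q.
Proof.
move=> rok ok hx hh hcl hsm H; have [r10 r11 o r29 z] := rok.
set x := r 3 in ok hx hh hsm H *; set c := r 12 in hcl hh hsm H *.
apply: wpSeq; apply: (wpLd (vx := 0) (vy := x) (vz := c)) => //; try lia.
rewrite -/(hc m x c); set h := hc m x c in hh hsm *.
apply: wpSeq; apply: (wpAdd (v := h.+1)); [lia|by rewrite /upd /= o addn1|].
apply: wpSeq; apply: (wpSt (vx := 0) (vy := x) (vz := c) (v := h.+1)); [> side .. | idtac].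
set m1 := set4 _ _ _ _ _ _.
have d1 t x' y' k' : t != 5 -> m1 t x' y' k' = m t x' y' k' by rewrite /m1 /set4 => /negbTE ->.
have h1 x' c' : hc m1 x' c' = if (x' == x) && (c' == c) then h.+1 else hc m x' c' by [].
have ok1 x' y' : SOK m x' y' -> SOK m1 x' y'.
  by apply: sok_other => // t a; rewrite !inE => /orP[] /eqP ->; rewrite d1.
have q2 : eqr [:: 8; 9] r (upd (upd r 9 h) 8 h.+1) by do 2 (apply: eqr_upd; last by []).
set r2 := upd _ _ _ in q2 *.
apply: (wpIf (va := 0) (vb := h)) => // h0.
  apply: wpSub => //; apply: H.
  - do 2 (apply: eqr_upd; last by []); apply: eqr_upd => //.
  - split=> //.
    + by move=> t a1 a2 a3; rewrite !inE !negb_or => /and4P[_ _ _ t5]; rewrite d1.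
    + by move=> x' c' hc'; rewrite h1 !eqxx; case: ifP => // /andP[/eqP -> /eqP ->]; rewrite -[LHS]/(sm m x 0 c) hsm.
  - lia.
apply: wpSeq; apply: (wpAdd (v := 0)); [lia|by rewrite /r2 /upd /= z|].
apply: wpSeq; apply: (wpAdd (v := c)); [lia|by rewrite /r2 /upd /= z addn0|].
set r3 := upd _ _ _.
have q3 : eqr [:: 4; 5; 8; 9] r r3 by do 4 (apply: eqr_upd; last by []).
apply: add_spec; rewrite -?[r3 3]/x -?[r3 4]/0 -?[r3 5]/c //.
- exact: ok1.
- lia.
- by rewrite -[sm m1 x 0 c]/(sm m x 0 c) hsm -leqNgt.
move=> r' m' k hr [s1 s2 s3 s4] hk; apply: H; last lia.
  by apply: (eqr_trans q3 hr) => i; rewrite !inE => /or4P[]/eqP->.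
split.
- by move=> t a1 a2 a3; rewrite !inE !negb_or => /and4P[t2 t3 t4 t5]; rewrite s1 ?d1 // !inE !negb_or t2 t3.
- by move=> x' y' /ok1 /s2.
- by move=> x' c'; rewrite {1}/hc s1 // -/(hc m1 x' c') h1.
- by move=> x' y' e' y0 he; rewrite s3 // (gtn_eqF y0) andbF.
- move=> x' c' hc'; rewrite s3 // eqxx /=; case: ifP => // _.
  by rewrite /hc s1 // -/(hc m1 x c) h1 !eqxx.
Qed.

Lemma dec_spec r m Q : regs_ok r -> SOK m (r 3) 0 -> r 3 < S -> 0 < hc m (r 3) (r 12) ->
  1 <= r 12 <= D.+1 -> sm m (r 3) 0 (r 12) = (0 < hc m (r 3) (r 12)) ->
  (forall r' m' k, eqr [:: 4; 5; 6; 7; 8; 9] r r' -> hc_eff m m' (r 3) (r 12) false -> k <= 110 ->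
    Q (MkSt r' m') k) -> wp dec_cmd (MkSt r m) Q.
Proof.
move=> rok ok hx hh hcl hsm H; have [r10 r11 o r29 z] := rok.
set x := r 3 in ok hx hh hsm H *; set c := r 12 in hcl hh hsm H *.
apply: wpSeq; apply: (wpLd (vx := 0) (vy := x) (vz := c)) => //; try lia.
rewrite -/(hc m x c); set h := hc m x c in hh hsm *.
apply: wpSeq; apply: (wpSub (v := h.-1)); [by rewrite /upd /= o subn1|].
apply: wpSeq; apply: (wpSt (vx := 0) (vy := x) (vz := c) (v := h.-1)); [> side .. | idtac].
set m1 := set4 _ _ _ _ _ _.
have d1 t x' y' k' : t != 5 -> m1 t x' y' k' = m t x' y' k' by rewrite /m1 /set4 => /negbTE ->.
have h1 x' c' : hc m1 x' c' = if (x' == x) && (c' == c) then h.-1 else hc m x' c' by [].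
have ok1 x' y' : SOK m x' y' -> SOK m1 x' y'.
  by apply: sok_other => // t a; rewrite !inE => /orP[] /eqP ->; rewrite d1.
set r2 := upd _ _ _.
apply: (wpIf (va := 0) (vb := h.-1)) => // h0.
  apply: wpSub => //; apply: H.
  - do 2 (apply: eqr_upd; last by []); apply: eqr_upd => //.
  - split=> //.
    + by move=> t a1 a2 a3; rewrite !inE !negb_or => /and4P[_ _ _ t5]; rewrite d1.
    + move=> x' c' hc'; rewrite h1 !eqxx h0; case: ifP => // /andP[/eqP -> /eqP ->].
      by rewrite -[LHS]/(sm m x 0 c) hsm.
  - lia.
apply: wpSeq; apply: (wpAdd (v := 0)); [lia|by rewrite /r2 /upd /= z|].
apply: wpSeq; apply: (wpAdd (v := c)); [lia|by rewrite /r2 /upd /= z addn0|].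
set r3 := upd _ _ _.
have q3 : eqr [:: 4; 5; 8; 9] r r3 by do 4 (apply: eqr_upd; last by []).
apply: del_spec; rewrite -?[r3 3]/x -?[r3 4]/0 -?[r3 5]/c //.
- exact: ok1.
- lia.
- by rewrite -[sm m1 x 0 c]/(sm m x 0 c) hsm.
move=> r' m' k hr [s1 s2 s3 s4] hk; apply: H; last lia.
  by apply: (eqr_trans q3 hr) => i; rewrite !inE => /or4P[]/eqP->.
split.
- by move=> t a1 a2 a3; rewrite !inE !negb_or => /and4P[t2 t3 t4 t5]; rewrite s1 ?d1 // !inE !negb_or t2 t3.
- by move=> x' y' /ok1 /s2.
- by move=> x' c'; rewrite {1}/hc s1 // -/(hc m1 x' c') h1.
- by move=> x' y' e' y0 he; rewrite s3 // (gtn_eqF y0) andbF.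
- move=> x' c' hc'; rewrite s3 // eqxx /=; case: ifP => // _.
  by rewrite /hc s1 // -/(hc m1 x c) h1 !eqxx /=; lia.
Qed.

End Sets.

(** * Edge insertion and deletion *)

Definition set_cmd (b : bool) := if b then add_cmd else del_cmd.
Definition hc_cmd (b : bool) := if b then inc_cmd else dec_cmd.

(* Inserts or deletes the edge between the vertices in registers 1 and 2. *)
Definition edge_cmd (b : bool) :=
  Seq (Ld 13 1 30 30 1) (Seq (Ld 14 1 30 30 2)
  (Seq (Ld 15 0 30 30 1) (Seq (Ld 16 0 30 30 2)
  (Seq (mov 17 13) (Seq (If 13 14 (mov 17 14) (Subn 9 9 9))
  (Seq (mov 3 1) (Seq (mov 4 17) (Seq (Add 5 2 26) (Seq (set_cmd b)
  (Seq (mov 3 2) (Seq (mov 4 17) (Seq (Add 5 1 26) (Seq (set_cmd b)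
  (If 13 14 (Seq (mov 3 1) (Seq (mov 12 16) (hc_cmd b)))
  (If 14 13 (Seq (mov 3 2) (Seq (mov 12 15) (hc_cmd b))) (Subn 9 9 9)))))))))))))))).

Definition setE (g : graph) u v (b : bool) : graph :=
  fun x y => if is_pair u v x y then b else g x y.

Lemma sum_change (n : nat) (F F' : nat -> nat) v : v < n ->
  (forall w, w != v -> F' w = F w) ->
  \sum_(w < n) F' w + F v = \sum_(w < n) F w + F' v.
Proof.
move=> vn H; rewrite (bigD1 (Ordinal vn)) //= [in RHS](bigD1 (Ordinal vn)) //=.
rewrite (eq_bigr (fun w : 'I_n => F w)); first lia.
by move=> w /negP wv; apply: H; apply/eqP => E; apply: wv; apply/eqP/val_inj.
Qed.

Section Edge.
Variables n D S W : nat.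
Hypothesis SE : S = n + D + 16.
Hypothesis SW : 4 * S <= W.
Local Notation wp := (wp S W).
Local Notation regs_ok := (regs_ok n D S).
Local Notation SOK := (SOK n D).
Local Notation U := (usize n D).

Lemma set_spec b r m Q : regs_ok r -> SOK m (r 3) (r 4) -> r 3 < S -> r 4 < S ->
  1 <= r 5 <= U (r 4) -> sm m (r 3) (r 4) (r 5) = ~~ b ->
  (forall r' m' k, eqr [:: 6; 7; 8; 9] r r' -> set_eff n D m m' (r 3) (r 4) (r 5) b -> k <= 80 ->
    Q (MkSt r' m') k) -> wp (set_cmd b) (MkSt r m) Q.
Proof.
case: b => h1 h2 h3 h4 h5 h6 h7; first by apply: (add_spec SE SW); rewrite ?h6.
by apply: (del_spec SE); rewrite ?h6.
Qed.

Lemma hc_spec b r m Q : regs_ok r -> SOK m (r 3) 0 -> r 3 < S -> hc m (r 3) (r 12) < S ->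
  1 <= r 12 <= D.+1 -> sm m (r 3) 0 (r 12) = (0 < hc m (r 3) (r 12)) ->
  b || (0 < hc m (r 3) (r 12)) ->
  (forall r' m' k, eqr [:: 4; 5; 6; 7; 8; 9] r r' -> hc_eff n D m m' (r 3) (r 12) b -> k <= 110 ->
    Q (MkSt r' m') k) -> wp (hc_cmd b) (MkSt r m) Q.
Proof.
case: b => h1 h2 h3 h4 h5 h6 h7 h8; first by apply: (inc_spec SE SW).
by apply: (dec_spec SE SW).
Qed.

Definition above (g : graph) m x c : nat :=
  \sum_(u < n) (g x u && (lv m x < lv m u) && (col m u == c)).

(** The graph is a parameter because the tables hold fewer edges than the actual graph while a
    vertex is being recolored. Properness is left out: it fails during recoloring and is tracked by
    [proper_off]. *)
Record Inv (g : graph) (m : mem4) : Prop := MkInv {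
  i_sym : forall x u, g x u = g u x;
  i_irr : forall x, g x x = false;
  i_ok : forall x y, x < n -> SOK m x y;
  i_sm : forall x u y, x < n -> u < n -> 0 < y ->
    sm m x y u.+1 = g x u && (y == maxn (lv m x) (lv m u));
  i_hc : forall x c, x < n -> hc m x c = above g m x c;
  i_sm0 : forall x c, x < n -> 1 <= c <= D.+1 -> sm m x 0 c = (0 < hc m x c);
  i_lv : forall x, x < n -> exists i, lv m x = 2 ^ i;
  i_lvS : forall x, x < n -> lv m x < S;
  i_col : forall x, x < n -> 1 <= col m x <= D.+1 }.

Lemma lv_gt0 g m x : Inv g m -> x < n -> 0 < lv m x.
Proof. by move=> I /(i_lv I) [i ->]; rewrite expn_gt0. Qed.

Lemma eq_above g g' m m' x c : x < n -> (forall u, u < n -> g x u = g' x u) ->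
  (forall u, u < n -> lv m u = lv m' u) -> (forall u, u < n -> col m u = col m' u) ->
  above g m x c = above g' m' x c.
Proof. by move=> xn h1 h2 h3; apply: eq_bigr => u _; rewrite h1 // !h2 // h3. Qed.

Lemma above_le g m x c : above g m x c <= n.
Proof.
rewrite -[leqRHS]card_ord -sum1_card; apply: leq_sum => u _.
by case: (_ && _).
Qed.

Lemma above_setE g m u v x c : u < n -> v < n -> u != v ->
  above (setE g u v true) m x c = above (setE g u v false) m x c +
    [&& x == u, lv m u < lv m v & c == col m v] + [&& x == v, lv m v < lv m u & c == col m u].
Proof.
move=> un vn uv; rewrite /above.
case: (eqVneq x u) => [->|xu] /=.
  pose F b w := nat_of_bool (setE g u v b u w && (lv m u < lv m w) && (col m w == c)).
  rewrite (negbTE uv) addn0 -[LHS]/(\sum_(w < n) F true w) -[X in X + _]/(\sum_(w < n) F false w).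
  have := @sum_change n (F false) (F true) v vn.
  have -> : F false v = 0 by rewrite /F /setE /is_pair !eqxx.
  have -> : F true v = (lv m u < lv m v) && (c == col m v).
    by rewrite /F /setE /is_pair !eqxx /= [c == _]eq_sym.
  rewrite addn0 => -> // w wv.
  by rewrite /F /setE /is_pair (negbTE wv) andbF (negbTE uv).
case: (eqVneq x v) => [->|xv] /=.
  pose F b w := nat_of_bool (setE g u v b v w && (lv m v < lv m w) && (col m w == c)).
  rewrite addn0 -[LHS]/(\sum_(w < n) F true w) -[X in X + _]/(\sum_(w < n) F false w).
  have := @sum_change n (F false) (F true) u un.
  have -> : F false u = 0 by rewrite /F /setE /is_pair !eqxx orbT.
  have -> : F true u = (lv m v < lv m u) && (c == col m u).
    by rewrite /F /setE /is_pair !eqxx orbT /= [c == _]eq_sym.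
  rewrite addn0 => -> // w wu.
  by rewrite /F /setE /is_pair (negbTE wu) andbF eq_sym (negbTE uv).
rewrite !addn0; apply: eq_bigr => w _.
by rewrite /setE /is_pair (negbTE xu) (negbTE xv).
Qed.

Lemma Inv_ext g g' m : (forall x y, g x y = g' x y) -> Inv g m -> Inv g' m.
Proof.
move=> E [h1 h2 h3 h4 h5 h6 h7 h8 h9]; split=> //.
- by move=> x u; rewrite -!E.
- by move=> x; rewrite -E.
- by move=> x u y *; rewrite h4 // E.
- by move=> x c xn; rewrite h5 //; apply: eq_above.
Qed.

Lemma is_pair_sym u v x y : is_pair u v x y = is_pair u v y x.
Proof. by rewrite /is_pair orbC ![(x == _) && _]andbC. Qed.

Lemma edge_inv b g m m1 m2 m3 u v : Inv g m -> u < n -> v < n -> u != v -> g u v = ~~ b ->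
  set_eff n D m m1 u (maxn (lv m u) (lv m v)) v.+1 b ->
  set_eff n D m1 m2 v (maxn (lv m u) (lv m v)) u.+1 b ->
  (if lv m u < lv m v then hc_eff n D m2 m3 u (col m v) b
   else if lv m v < lv m u then hc_eff n D m2 m3 v (col m u) b else m3 = m2) ->
  Inv (setE g u v b) m3 /\
  (forall t a1 a2 a3, t \notin [:: 2; 3; 4; 5] -> m3 t a1 a2 a3 = m t a1 a2 a3).
Proof.
move=> I un vn uv guv E1 E2 E3; set B := maxn _ _ in E1 E2.
have T12 t a1 a2 a3 : t \notin [:: 2; 3; 4] -> m2 t a1 a2 a3 = m t a1 a2 a3.
  by move=> ht; rewrite (se_tag E2) // (se_tag E1).
have hc2 x c : hc m2 x c = hc m x c by rewrite /hc T12.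
have T t a1 a2 a3 : t \notin [:: 2; 3; 4; 5] -> m3 t a1 a2 a3 = m t a1 a2 a3.
  move=> ht; have ht' : t \notin [:: 2; 3; 4].
    by move: ht; rewrite !inE !negb_or => /and4P[-> -> -> _].
  rewrite -T12 //; move: E3; case: ifP => _; first by move/he_tag ->.
  by case: ifP => _; [move/he_tag ->|move->].
have Elv x : lv m3 x = lv m x by rewrite /lv T.
have Ecol x : col m3 x = col m x by rewrite /col T.
have B0 : 0 < B by rewrite /B leq_max (lv_gt0 I).
have OK x y : x < n -> SOK m3 x y.
  move=> xn; have O2 : SOK m2 x y by apply: (se_ok E2); apply: (se_ok E1); exact: (i_ok I).
  move: E3; case: ifP => _; first by move/he_ok; apply.
  by case: ifP => _; [move/he_ok; apply|move->].
have S3 x y e : 0 < y -> 1 <= e <= U y -> sm m3 x y e = sm m2 x y e.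
  move=> y0 he; move: E3; case: ifP => _; first by move/he_smy ->.
  by case: ifP => _; [move/he_smy ->|move->].
have lc := i_col I.
(* One equation serves insertion and deletion: the changed unit is added on the side that lacks it,
   which avoids truncated subtraction. *)
have HC3 x c : hc m3 x c + (~~ b && ([&& x == u, lv m u < lv m v & c == col m v]
     || [&& x == v, lv m v < lv m u & c == col m u])) =
   hc m x c + (b && ([&& x == u, lv m u < lv m v & c == col m v]
     || [&& x == v, lv m v < lv m u & c == col m u])).
  have ab a c' : a < n -> hc m a c' = above g m a c' by exact: (i_hc I).
  have pos : forall a a', a < n -> a' < n -> ~~ b -> g a a' -> lv m a < lv m a' -> 0 < hc m a (col m a').
    move=> a a' an an' nb ga la; rewrite ab // /above (bigD1 (Ordinal an')) //= ga la eqxx.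
    by rewrite addn_gt0.
  move: E3; case: (ltngtP (lv m u) (lv m v)) => luv E3; rewrite ?andbF ?andbT /=.
  - rewrite (he_hc E3) !hc2 orbF; case: ((x == u) && (c == col m v)) / andP => [[/eqP -> /eqP ->]|_].
      case: (boolP b) => nb /=; first by rewrite addn0 addn1.
      by have := pos _ _ un vn nb (etrans guv nb) luv; lia.
    by case: (b); lia.
  - rewrite (he_hc E3) !hc2 /=; case: ((x == v) && (c == col m u)) / andP => [[/eqP -> /eqP ->]|_].
      case: (boolP b) => nb /=; first by rewrite addn0 addn1.
      by have := pos _ _ vn un nb (etrans (i_sym I v u) (etrans guv nb)) luv; lia.
    by case: (b); lia.
  - by rewrite E3 hc2.
split=> //; split.
- move=> x y; rewrite /setE is_pair_sym; case: ifP => // _; exact: (i_sym I).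
- move=> x; rewrite /setE /is_pair (i_irr I); case: ifP => // /orP[] /andP[/eqP -> /eqP E];
  by rewrite E eqxx in uv.
- exact: OK.
- move=> x w y xn wn y0; have hw : 1 <= w.+1 <= U y by rewrite /usize (gtn_eqF y0).
  rewrite S3 // (se_sm E2) // (se_sm E1) // !eqSS !Elv (i_sm I) // /setE /is_pair.
  have uv' : (v == u) = false by rewrite eq_sym (negbTE uv).
  case: (eqVneq x u) => [Exu|xu] /=; case: (eqVneq x v) => [Exv|xv] /=.
  + by rewrite -Exu Exv eqxx in uv.
  + rewrite Exu; case: (eqVneq w v) => [->|wv]; rewrite ?andbT ?andbF //= ?orbF.
    by rewrite -/B; case: (y == B); rewrite ?andbT ?andbF // guv; case: (b).
  + rewrite Exv; case: (eqVneq w u) => [->|wu]; rewrite ?andbT ?andbF //=.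
    by rewrite maxnC -/B (i_sym I) guv; case: (y == B); rewrite ?andbT ?andbF //; case: (b).
  + by [].
- move=> x c xn; have := HC3 x c; rewrite (i_hc I) //.
  have -> : above (setE g u v b) m3 x c = above (setE g u v b) m x c.
    by apply: eq_above.
  have := above_setE g m x c un vn uv.
  have -> : above g m x c = above (setE g u v (~~ b)) m x c.
    apply: eq_above => // w wn; rewrite /setE /is_pair.
    by case: ifP => // /orP[] /andP[/eqP -> /eqP ->] //; rewrite (i_sym I).
  have : ~~ ([&& x == u, lv m u < lv m v & c == col m v] && [&& x == v, lv m v < lv m u & c == col m u]).
    by apply/negP => /andP[/and3P[/eqP -> _ _] /and3P[uv' _ _]]; rewrite uv' in uv.
  by case: [&& x == u, _ & _]; case: [&& x == v, _ & _]; case: (b) => //= _; lia.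
- move=> x c xn hcc.
  have S2 y : sm m2 y 0 c = sm m y 0 c.
    by rewrite (se_sm E2) // (se_sm E1) // [0 == B]ltn_eqF // !andbF.
  move: E3; case: ifP => _.
    move=> E3; rewrite (he_sm0 E3) //; case: ifP => [/andP[/eqP -> /eqP ->] //|ne].
    by rewrite S2 (i_sm0 I) // (he_hc E3) ne hc2.
  case: ifP => _; last by move->; rewrite S2 hc2 (i_sm0 I).
  move=> E3; rewrite (he_sm0 E3) //; case: ifP => [/andP[/eqP -> /eqP ->] //|ne].
  by rewrite S2 (i_sm0 I) // (he_hc E3) ne hc2.
- by move=> x xn; rewrite Elv; exact: (i_lv I).
- by move=> x xn; rewrite Elv; exact: (i_lvS I).
- by move=> x xn; rewrite Ecol; exact: (i_col I).
Qed.

Lemma edge_spec b g r m Q : regs_ok r -> Inv g m -> r 1 < n -> r 2 < n -> r 1 != r 2 ->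
  g (r 1) (r 2) = ~~ b ->
  (forall r' m' k, eqr [:: 3; 4; 5; 6; 7; 8; 9; 12; 13; 14; 15; 16; 17] r r' ->
    [/\ r' 13 = lv m (r 1), r' 14 = lv m (r 2), r' 15 = col m (r 1) & r' 16 = col m (r 2)] ->
    Inv (setE g (r 1) (r 2) b) m' ->
    (forall t a1 a2 a3, t \notin [:: 2; 3; 4; 5] -> m' t a1 a2 a3 = m t a1 a2 a3) ->
    k <= 330 -> Q (MkSt r' m') k) -> wp (edge_cmd b) (MkSt r m) Q.
Proof.
move=> rok I un vn uv guv H; have [r10 r11 o r29 z] := rok.
set u := r 1 in un uv guv H *; set v := r 2 in vn uv guv H *.
have lu := i_lvS I un; have lv_ := i_lvS I vn; have cu := i_col I un; have cv := i_col I vn.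
have lu0 := lv_gt0 I un; have lv0 := lv_gt0 I vn.
apply: wpSeq; apply: (wpLd (vx := 0) (vy := 0) (vz := u)); [> side .. | idtac].
apply: wpSeq; apply: (wpLd (vx := 0) (vy := 0) (vz := v)); [> side .. | idtac].
apply: wpSeq; apply: (wpLd (vx := 0) (vy := 0) (vz := u)); [> side .. | idtac].
apply: wpSeq; apply: (wpLd (vx := 0) (vy := 0) (vz := v)); [> side .. | idtac].
rewrite -/(lv m u) -/(lv m v) -/(col m u) -/(col m v).
apply: wpSeq; apply: (wpAdd (v := lv m u)); [lia|by rewrite /upd /= z addn0|].
pose B := maxn (lv m u) (lv m v).
pose L := [:: 3; 4; 5; 6; 7; 8; 9; 12; 13; 14; 15; 16; 17].
set r1 := upd _ 17 _.
have q1 : eqr L r r1 by do 5 (apply: eqr_upd; last by []).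
have main r2 k0 : k0 <= 36 -> eqr [:: 9; 17] r1 r2 -> r2 17 = B ->
  wp (Seq (mov 3 1) (Seq (mov 4 17) (Seq (Add 5 2 26) (Seq (set_cmd b)
  (Seq (mov 3 2) (Seq (mov 4 17) (Seq (Add 5 1 26) (Seq (set_cmd b)
  (If 13 14 (Seq (mov 3 1) (Seq (mov 12 16) (hc_cmd b)))
  (If 14 13 (Seq (mov 3 2) (Seq (mov 12 15) (hc_cmd b))) (Subn 9 9 9)))))))))))
  (MkSt r2 m) (fun s n => Q s (k0 + n)).
  move=> hk0 q2 r217.
  have r21 : r2 1 = u by rewrite q2.
  have r22 : r2 2 = v by rewrite q2.
  have r226 : r2 26 = 1 by rewrite q2.
  have r230 : r2 30 = 0 by rewrite q2.
  have BS : B < S by rewrite /B; lia.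
  apply: wpSeq; apply: (wpAdd (v := u)); [lia|by rewrite r21 r230 addn0|].
  apply: wpSeq; apply: (wpAdd (v := B)); [lia|by rewrite /upd /= r217 r230 addn0|].
  apply: wpSeq; apply: (wpAdd (v := v.+1)); [lia|by rewrite /upd /= r22 r226 addn1|].
  set r3 := upd _ 5 _.
  have q3 : eqr [:: 3; 4; 5] r2 r3 by do 3 (apply: eqr_upd; last by []).
  have hU : U B = n by rewrite /usize gtn_eqF // /B leq_max lu0.
  have B0 : 0 < B by rewrite /B leq_max lu0.
  have rok3 : regs_ok r3 by case: rok => *; split; rewrite q3 // q2 // q1.
  apply: wpSeq; apply: (set_spec rok3); rewrite -?[r3 3]/u -?[r3 4]/B -?[r3 5]/(v.+1) ?hU //.
  - exact: (i_ok I).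
  - lia.
  - by rewrite (i_sm I) // eqxx andbT.
  move=> r4 m4 k4 q4 E4 hk4.
  have r4E i : i \notin L -> r4 i = r i.
    move=> hi; rewrite q4; last by apply: contra hi; rewrite !inE => /or4P[]/eqP->.
    rewrite q3; last by apply: contra hi; rewrite !inE => /or3P[]/eqP->.
    rewrite q2; last by apply: contra hi; rewrite !inE => /orP[]/eqP->.
    by rewrite q1.
  have r417 : r4 17 = B by rewrite q4 // q3.
  apply: wpSeq; apply: (wpAdd (v := v)); [lia|by rewrite !r4E // z addn0|].
  apply: wpSeq; apply: (wpAdd (v := B)); [lia|by rewrite /upd /= r417 r4E // z addn0|].
  apply: wpSeq; apply: (wpAdd (v := u.+1)); [lia|by rewrite /upd /= !r4E // o addn1|].
  set r5 := upd _ 5 _.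
  have q5 : eqr [:: 3; 4; 5] r4 r5 by do 3 (apply: eqr_upd; last by []).
  have rok5 : regs_ok r5 by case: rok => *; split; rewrite q5 // r4E.
  apply: wpSeq; apply: (set_spec rok5); rewrite -?[r5 3]/v -?[r5 4]/B -?[r5 5]/(u.+1) ?hU //.
  - by apply: (se_ok E4); exact: (i_ok I).
  - lia.
  - rewrite (se_sm E4) ?hU // eqSS eq_sym (negbTE uv) /= (i_sm I) // (i_sym I).
    by rewrite maxnC -/B eqxx andbT.
  move=> r6 m6 k6 q6 E6 hk6.
  have r6E i : i \notin L -> r6 i = r i.
    move=> hi; rewrite q6; last by apply: contra hi; rewrite !inE => /or4P[]/eqP->.
    rewrite q5; last by apply: contra hi; rewrite !inE => /or3P[]/eqP->.
    exact: r4E.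
  have r6F i : i \in [:: 13; 14; 15; 16] -> r6 i = r1 i.
    by rewrite !inE => /or4P[] /eqP ->; rewrite q6 // q5 // q4 // q3 // q2.
  have fin r7 m7 k : k <= 330 -> eqr L r6 r7 -> eqr [:: 3; 4; 5; 6; 7; 8; 9; 12] r6 r7 ->
     (if lv m u < lv m v then hc_eff n D m6 m7 u (col m v) b
      else if lv m v < lv m u then hc_eff n D m6 m7 v (col m u) b else m7 = m6) ->
     Q (MkSt r7 m7) k.
    move=> hk q7 q7' E7; have [I7 T7] := edge_inv I un vn uv guv E4 E6 E7.
    apply: H => //; first by move=> i hi; rewrite q7 // r6E.
    by split; rewrite q7' // r6F.
  have sok6 x : x < n -> SOK m6 x 0.
    by move=> xn; apply: (se_ok E6); apply: (se_ok E4); exact: (i_ok I).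
  have hcE x c : hc m6 x c = hc m x c by rewrite /hc (se_tag E6) // (se_tag E4).
  have smE x c : 1 <= c <= D.+1 -> sm m6 x 0 c = sm m x 0 c.
    by move=> hc0; rewrite (se_sm E6) // (se_sm E4) // [0 == B]ltn_eqF // !andbF.
  have hcn x c : x < n -> hc m6 x c < S.
    by move=> xn; rewrite hcE (i_hc I) //; have := above_le g m x c; lia.
  have r630 : r6 30 = 0 by rewrite r6E.
  have pos x y : x < n -> y < n -> g x y = ~~ b -> lv m x < lv m y ->
      b || (0 < hc m6 x (col m y)).
    move=> xn yn; case: (b) => //= gxy lxy; rewrite hcE (i_hc I) //.
    by rewrite /above (bigD1 (Ordinal yn)) //= gxy lxy eqxx addn_gt0.
  have rok6 : regs_ok r6 by case: rok => *; split; rewrite r6E.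
  apply: (wpIf (va := lv m u) (vb := lv m v)); rewrite ?r6F // => luv.
    apply: wpSeq; apply: (wpAdd (v := u)); [lia|by rewrite r6E // r630 addn0|].
    apply: wpSeq; apply: (wpAdd (v := col m v)); [lia|by rewrite /upd /= r630 r6F // addn0|].
    set r7 := upd _ 12 _.
    have q7 : eqr [:: 3; 12] r6 r7 by do 2 (apply: eqr_upd; last by []).
    have rok7 : regs_ok r7 by exact: regs_ok_eqr rok6 q7 _.
    apply: (hc_spec rok7); rewrite -?[r7 3]/u -?[r7 12]/(col m v) //.
    - exact: sok6.
    - lia.
    - exact: hcn.
    - by rewrite smE // hcE (i_sm0 I).
    - exact: pos.
    move=> r8 m8 k8 q8 E8 hk8; apply: fin; last by rewrite luv.
    - lia.
    - by apply: (eqr_trans q7 q8) => i; rewrite !inE; [move=> /orP[]/eqP->|move=> /or4P[|||/or3P[]]/eqP->].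
    - by apply: (eqr_trans q7 q8) => i; rewrite !inE; [move=> /orP[]/eqP->|move=> /or4P[|||/or3P[]]/eqP->].
  apply: (wpIf (va := lv m v) (vb := lv m u)); rewrite ?r6F // => lvu.
    apply: wpSeq; apply: (wpAdd (v := v)); [lia|by rewrite r6E // r630 addn0|].
    apply: wpSeq; apply: (wpAdd (v := col m u)); [lia|by rewrite /upd /= r630 r6F // addn0|].
    set r7 := upd _ 12 _.
    have q7 : eqr [:: 3; 12] r6 r7 by do 2 (apply: eqr_upd; last by []).
    have rok7 : regs_ok r7 by exact: regs_ok_eqr rok6 q7 _.
    apply: (hc_spec rok7); rewrite -?[r7 3]/v -?[r7 12]/(col m u) //.
    - exact: sok6.
    - lia.
    - exact: hcn.
    - by rewrite smE // hcE (i_sm0 I).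
    - by apply: pos => //; rewrite (i_sym I).
    move=> r8 m8 k8 q8 E8 hk8; apply: fin; last by rewrite ltnNge luv lvu.
    - lia.
    - by apply: (eqr_trans q7 q8) => i; rewrite !inE; [move=> /orP[]/eqP->|move=> /or4P[|||/or3P[]]/eqP->].
    - by apply: (eqr_trans q7 q8) => i; rewrite !inE; [move=> /orP[]/eqP->|move=> /or4P[|||/or3P[]]/eqP->].
  apply: wpSub => //; apply: fin; last by rewrite !ltnNge luv lvu.
  - lia.
  - exact: eqr_upd.
  - exact: eqr_upd.
apply: wpSeq; apply: (wpIf (va := lv m u) (vb := lv m v)) => // luv.
  apply: (wpAdd (v := lv m v)); [lia|by rewrite /r1 /upd /= z addn0|].
  apply: (main _ 35); [by []|by apply: eqr_upd|].
  by rewrite /upd /= /B; lia.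
apply: wpSub => //; apply: (main _ 36); [by []|by apply: eqr_upd|].
by rewrite /r1 /upd /= /B; lia.
Qed.
End Edge.

Lemma eqr_tr L1 L2 L r1 r2 r3 : eqr L1 r1 r2 -> eqr L2 r2 r3 ->
  all [in L] L1 && all [in L] L2 -> eqr L r1 r3.
Proof. by move=> h1 h2 /andP[/allP s1 /allP s2]; apply: eqr_trans h1 h2 s1 s2. Qed.

Lemma eqr_sub L1 L r1 r2 : eqr L1 r1 r2 -> all [in L] L1 -> eqr L r1 r2.
Proof. by move=> h /allP s i hi; apply: h; apply: contra hi => /s. Qed.

(* Moves the edges of bucket [r 19] of vertex [r 2] out of the structure, pushing
   the other endpoints on the stack of size [r 18]. *)
Definition pull_cmd :=
  Seq (Ld 22 2 30 2 19) (While 30 22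
  (Seq (Ld 5 3 2 19 22) (Seq (If 30 5 (Subn 9 9 9) (mov 5 22))
  (Seq (Subn 1 5 26) (Seq (edge_cmd false)
  (Seq (St 6 30 30 18 1) (Seq (Add 18 18 26) (Ld 22 2 30 2 19)))))))).

Definition push_cmd :=
  While 30 18 (Seq (Subn 18 18 26) (Seq (Ld 1 6 30 30 18) (edge_cmd true))).

(** The graph that the tables represent while the edges from [v] to the stacked vertices [ts] are
    taken out. *)
Definition gminus (g : graph) v (ts : seq nat) : graph :=
  fun x y => g x y && ~~ ((x == v) && (y \in ts) || (y == v) && (x \in ts)).

Definition edge_regs := [:: 3; 4; 5; 6; 7; 8; 9; 12; 13; 14; 15; 16; 17].
Definition pull_regs := [:: 1, 18, 22 & edge_regs].

(** * Taking edges of a vertex out of the tables and putting them back *)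

Section Pull.
Variables n D S W : nat.
Hypothesis SE : S = n + D + 16.
Hypothesis SW : 4 * S <= W.
Local Notation wp := (wp S W).
Local Notation regs_ok := (regs_ok n D S).
Local Notation U := (usize n D).
Local Notation Inv := (Inv n D S).

Record TS (g : graph) v (ts : seq nat) (m : mem4) : Prop := MkTS {
  ts_uniq : uniq ts;
  ts_mem : forall u, u \in ts -> u < n /\ g v u;
  ts_tmp : forall j, j < size ts -> tmp m j = nth 0 ts j }.

Lemma ts_size g v ts m : TS g v ts m -> size ts <= n.
Proof.
case=> hu hm _; rewrite -[n in _ <= n](size_iota 0); apply: uniq_leq_size => // u /hm[].
by rewrite mem_iota.
Qed.

Lemma Inv_frame g m m' : (forall t a1 a2 a3, t < 6 -> m' t a1 a2 a3 = m t a1 a2 a3) ->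
  Inv g m -> Inv g m'.
Proof.
move=> E [h1 h2 h3 h4 h5 h6 h7 h8 h9].
have El x : lv m' x = lv m x by rewrite /lv E.
have Ec x : col m' x = col m x by rewrite /col E.
have Es x y e : sm m' x y e = sm m x y e by rewrite /sm /qg /cnt !E.
have Eh x c : hc m' x c = hc m x c by rewrite /hc E.
split=> //.
- by move=> x y /h3 => /(_ y); apply: sok_other; rewrite /cnt ?E // => t a; rewrite !inE => /orP[]/eqP->; rewrite E.
- by move=> x u y *; rewrite Es !El h4.
- by move=> x c xn; rewrite Eh h5 //; apply: eq_above.
- by move=> x c *; rewrite Es Eh h6.
- by move=> x xn; rewrite El; apply: h7.
- by move=> x xn; rewrite El; apply: h8.
- by move=> x xn; rewrite Ec; apply: h9.
Qed.

Lemma setE_gminus (g : graph) v ts u : (forall x y, g x y = g y x) -> g v u -> u \notin ts -> u != v ->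
  forall x y, setE (gminus g v (rcons ts u)) u v true x y = gminus g v ts x y.
Proof.
move=> sym gvu nu uv x y; rewrite /setE /is_pair /gminus !mem_rcons !inE.
case: (eqVneq x u) => [->|xu] /=; case: (eqVneq y v) => [->|yv] /=.
- by rewrite sym gvu (negbTE uv) /= (negbTE nu).
- by rewrite (negbTE uv) /=.
- case: (eqVneq x v) => [->|xv] /=; last by rewrite ?orbF.
  by rewrite [v == u]eq_sym (negbTE uv).
- case: (eqVneq x v) => [->|xv] //=; rewrite !orbF.
  by case: (eqVneq y u) => [->|yu] //=; rewrite gvu (negbTE nu).
Qed.

Lemma setE_gminus' g v ts u : u != v ->
  forall x y, setE (gminus g v ts) u v false x y = gminus g v (rcons ts u) x y.
Proof.
move=> uv x y; rewrite /setE /is_pair /gminus !mem_rcons !inE.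
case: (eqVneq x u) => [Exu|xu]; case: (eqVneq x v) => [Exv|xv];
  try (by rewrite -Exu Exv eqxx in uv);
  case: (eqVneq y u) => [Eyu|yu]; case: (eqVneq y v) => [Eyv|yv];
  try (by rewrite -Eyu Eyv eqxx in uv);
  by rewrite /= ?andbF ?orbT ?andbF ?orbF.
Qed.

Lemma pull_spec g v y ts r m Q : (forall x, g x x = false) -> regs_ok r -> r 2 = v -> v < n -> r 19 = y -> 0 < y -> y < S ->
  Inv (gminus g v ts) m -> TS g v ts m -> r 18 = size ts ->
  (forall r' m' ts' k, eqr pull_regs r r' -> Inv (gminus g v ts') m' -> TS g v ts' m' ->
    r' 18 = size ts' ->
    (forall u, u < n -> (u \in ts') = (u \in ts) || (g v u && (y == maxn (lv m v) (lv m u)))) ->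
    (forall t a1 a2 a3, t \notin [:: 2; 3; 4; 5; 6] -> m' t a1 a2 a3 = m t a1 a2 a3) ->
    size ts <= size ts' -> k <= 400 * (size ts' - size ts) + 10 ->
    Q (MkSt r' m') k) -> wp pull_cmd (MkSt r m) Q.
Proof.
move=> girr rok r2 vn r19 y0 yS I0 T0 r18 H; have [r10 r11 o r29 z] := rok.
have hU : U y = n by rewrite /usize gtn_eqF.
have cS m1 ts1 : Inv (gminus g v ts1) m1 -> cnt m1 v y < S.
  by move=> I1; have := sok_cnt (i_ok I1 y vn); rewrite hU; lia.
apply: wpSeq; apply: (wpLd (vx := 0) (vy := v) (vz := y)); [> side .. | idtac].
rewrite -/(cnt m v y).
(* Stacked vertices are distinct, so [n - size ts1] bounds the number of remaining iterations; each
   moved edge is charged 400 steps. *)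
pose J k c (s : state) := exists ts1, [/\ eqr pull_regs r (rg s),
   Inv (gminus g v ts1) (mm s), TS g v ts1 (mm s), rg s 18 = size ts1 &
   [/\ rg s 22 = cnt (mm s) v y,
   {subset ts <= ts1},
   (forall u, u \in ts1 -> (u \in ts) || (g v u && (y == maxn (lv m v) (lv m u)))),
   (forall t a1 a2 a3, t \notin [:: 2; 3; 4; 5; 6] -> mm s t a1 a2 a3 = m t a1 a2 a3) &
   [/\ n - size ts1 <= k, size ts <= size ts1 & c <= 400 * (size ts1 - size ts) + 2]]].
apply: (wp_while (I := J) (N := n)).
- exists ts; split=> //; first exact: eqr_upd.
  by split=> //; [move=> u ->|split=> //; rewrite ?subnn ?leq_subr; lia].
- move=> k c [r1 m1] [ts1 [q1 I1 T1 s1 [c1 sub1 new1 fr1 [k1 l1 n1]]]].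
  rewrite [rg _]/= [mm _]/= in q1 I1 T1 s1 c1 fr1.
  have E i : i \notin pull_regs -> r1 i = r i by move=> hi; rewrite q1.
  have r130 : r1 30 = 0 by rewrite E.
  rewrite -[rg _ 30]/(r1 30) -[rg _ 22]/(r1 22) r130 c1 => cpos.
  have hc1 : 1 <= cnt m1 v y <= U y by rewrite cpos (sok_cnt (i_ok I1 y vn)).
  have [hp qp] := sok_p (i_ok I1 y vn) hc1.
  set e := pg m1 v y (cnt m1 v y) in hp qp.
  pose u := e.-1; have eu : e = u.+1 by rewrite /u prednK //; case/andP: hp.
  have un : u < n by rewrite hU eu in hp.
  have : sm m1 v y u.+1 by rewrite /sm -eu qp.
  rewrite (i_sm I1) // => /andP[gvu ymax].
  have uv : u != v by apply/eqP => Eu; move: gvu; rewrite Eu (i_irr I1).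
  have [gvu' nu] : g v u /\ u \notin ts1.
    by move: gvu; rewrite /gminus eqxx /= negb_or => /and3P[-> ->].
  have szlt : size ts1 < n.
    have: uniq (rcons ts1 u) by rewrite rcons_uniq nu (ts_uniq T1).
    move=> hu; rewrite -[size ts1 < n]/((size ts1).+1 <= n) -(size_rcons ts1 u) -[n in _ <= n](size_iota 0).
    apply: uniq_leq_size => // x; rewrite mem_rcons inE mem_iota /= => /orP[/eqP ->//|/(ts_mem T1)[//]].
  have cS1 := cS _ _ I1.
  exists k.-1; split; first by lia.
  apply: wpSeq; apply: (wpLd (vx := v) (vy := y) (vz := cnt m1 v y) (v := m1 3 v y (cnt m1 v y)));
    [> by rewrite E // | by rewrite E // | by [] | lia | lia | lia | by [] | idtac].
  have step2 r2' c2 : c2 <= 4 -> eqr [:: 5; 9] r1 r2' -> r2' 5 = e ->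
    wp (Seq (Subn 1 5 26) (Seq (edge_cmd false)
      (Seq (St 6 30 30 18 1) (Seq (Add 18 18 26) (Ld 22 2 30 2 19))))) (MkSt r2' m1)
     (fun s k0 => J k.-1 (c + (8 + (c2 + k0))).+1 s).
    move=> hc2 q2 r25.
    have E2 i : i \notin pull_regs -> r2' i = r i.
      move=> hi; rewrite q2 ?E //; apply: contra hi; rewrite !inE => /orP[] /eqP -> //.
    apply: wpSeq; apply: (wpSub (v := u)); first by rewrite r25 E2 // o subn1.
    set r3 := upd _ _ _; have q3 : eqr [:: 1] r2' r3 by apply: eqr_upd.
    have rok3 : regs_ok r3 by case: rok => *; split; rewrite q3 // E2.
    have r31 : r3 1 = u by [].
    have r32 : r3 2 = v by rewrite q3 // E2.
    apply: wpSeq; apply: (edge_spec SE SW rok3 I1); rewrite ?r31 ?r32 //.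
      by rewrite (i_sym I1).
    move=> r4 m4 k4 q4 _ I4 fr4 hk4.
    have q14 : eqr (1 :: edge_regs) r1 r4 by apply: (eqr_tr (eqr_tr q2 q3 _ (L := [:: 1; 5; 9])) q4).
    have q04 : eqr pull_regs r r4 by apply: (eqr_tr q1 q14).
    have r430 : r4 30 = 0 by rewrite q04.
    have r418 : r4 18 = size ts1 by rewrite q14.
    have r41 : r4 1 = u by rewrite q4.
    have r4E i : i \notin pull_regs -> r4 i = r i by move=> hi; rewrite q04.
    apply: wpSeq; apply: (wpSt (vx := 0) (vy := 0) (vz := size ts1) (v := u));
     [> by [] | by [] | by [] | by [] | lia | lia | lia | idtac].
    set m5 := set4 _ _ _ _ _ _.
    have I5 : Inv (gminus g v (rcons ts1 u)) m5.
      apply: (@Inv_frame _ m4).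
        by move=> t a1 a2 a3; rewrite /m5 /set4 => ht; rewrite ltn_eqF.
      apply: Inv_ext I4; exact: setE_gminus'.
    apply: wpSeq; apply: (wpAdd (v := (size ts1).+1));
      [lia|by rewrite r418 r4E // o addn1|].
    apply: (wpLd (vx := 0) (vy := v) (vz := y) (v := cnt m5 v y));
     [> by rewrite /upd /= r4E // | by rewrite /upd /= r4E // | by rewrite /upd /= r4E // | lia | lia | lia | by [] | idtac].
    exists (rcons ts1 u); split=> /=.
    - by apply: eqr_upd => //; apply: eqr_upd.
    - exact: I5.
    - split.
      + by rewrite rcons_uniq nu (ts_uniq T1).
      + by move=> w; rewrite mem_rcons inE => /orP[/eqP ->//|/(ts_mem T1)].
      + move=> j; rewrite size_rcons ltnS => hj.
        rewrite /tmp /m5 /set4 /= nth_rcons; case: (eqVneq j (size ts1)) => [->|nj].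
          by rewrite ltnn.
        have hj' : j < size ts1 by lia.
        by rewrite hj' fr4 // -/(tmp m1 j) (ts_tmp T1).
    - by rewrite size_rcons.
    - split=> //.
      + by move=> w /sub1; rewrite mem_rcons inE => ->; rewrite orbT.
      + move=> w; rewrite mem_rcons inE => /orP[/eqP ->|/new1 //].
        rewrite gvu' /=; move: ymax.
        have -> : lv m1 v = lv m v by rewrite /lv fr1.
        have -> : lv m1 u = lv m u by rewrite /lv fr1.
        by move=> ->; rewrite orbT.
      + move=> t a1 a2 a3 ht; have ht' : t \notin [:: 2; 3; 4; 5].
          by move: ht; rewrite !inE !negb_or => /and5P[-> -> -> -> _].
        have t6 : (t == 6) = false by apply/negbTE; move: ht; rewrite !inE !negb_or => /and5P[].
        by rewrite /m5 /set4 t6 /= fr4 // fr1.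
      + by rewrite size_rcons; split; lia.
  have upd5 x : eqr [:: 5; 9] r1 (upd r1 5 x) by exact: eqr_upd.
  apply: wpSeq; apply: (wpIf (va := 0) (vb := m1 3 v y (cnt m1 v y))); [by rewrite /upd /= E|by []| |] => h0.
    apply: wpSub; first by [].
    apply: (step2 _ 2) => //; first by apply: eqr_upd.
    by rewrite /upd /= /e /pg; case: eqP h0 => // ->.
  apply: (wpAdd (v := cnt m1 v y)); [lia|by rewrite /upd /= c1 r130 addn0|].
  apply: (step2 _ 3) => //; first by apply: eqr_upd.
  by rewrite /upd /= /e /pg; case: eqP h0 => //; lia.
- move=> k c [r1 m1] [ts1 [q1 I1 T1 s1 [c1 sub1 new1 fr1 [k1 l1 n1]]]].
  rewrite [rg _]/= [mm _]/= in q1 I1 T1 s1 c1 fr1.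
  have r130 : r1 30 = 0 by rewrite q1.
  rewrite -[rg _ 30]/(r1 30) -[rg _ 22]/(r1 22) r130 c1 -leqNgt leqn0 => /eqP c0.
  apply: (H r1 m1 ts1) => //; last by lia.
  move=> u un; apply/idP/idP; first exact: new1.
  case/orP => [/sub1 //|/andP[gvu ymax]].
  have : ~~ sm m1 v y u.+1.
    rewrite /sm c0 -ltnNge; have hu : 1 <= u.+1 <= U y by rewrite hU.
    by have [/andP[]] := sok_q (i_ok I1 y vn) hu.
  rewrite (i_sm I1) //.
  have -> : lv m1 v = lv m v by rewrite /lv fr1.
  have -> : lv m1 u = lv m u by rewrite /lv fr1.
  rewrite ymax andbT /gminus gvu eqxx /= negbK => /orP[//|/andP[/eqP Euv]].
  by move: gvu; rewrite Euv girr.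
Qed.

Lemma push_spec g v ts r m Q : (forall x y, g x y = g y x) -> (forall x, g x x = false) ->
  regs_ok r -> r 2 = v -> v < n ->
  Inv (gminus g v ts) m -> TS g v ts m -> r 18 = size ts ->
  (forall r' m' k, eqr pull_regs r r' -> Inv g m' -> r' 18 = 0 ->
    (forall t a1 a2 a3, t \notin [:: 2; 3; 4; 5] -> m' t a1 a2 a3 = m t a1 a2 a3) ->
    k <= 350 * size ts + 2 ->
    Q (MkSt r' m') k) -> wp push_cmd (MkSt r m) Q.
Proof.
move=> gsym girr rok r2 vn I0 T0 r18 H; have [r10 r11 o r29 z] := rok.
have szn := ts_size T0.
pose J k c (s : state) := [/\ eqr pull_regs r (rg s),
   Inv (gminus g v (take k ts)) (mm s), rg s 18 = k, k <= size ts &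
   (forall t a1 a2 a3, t \notin [:: 2; 3; 4; 5] -> mm s t a1 a2 a3 = m t a1 a2 a3) /\
   c <= 350 * (size ts - k) + 2].
apply: (wp_while (I := J) (N := size ts)).
- by split=> //; [rewrite take_size|split=> //; lia].
- move=> k c [r1 m1] [q1 I1 s1 k1 [fr1 c1]].
  rewrite [rg _]/= [mm _]/= in q1 I1 s1 fr1.
  have E i : i \notin pull_regs -> r1 i = r i by move=> hi; rewrite q1.
  have r130 : r1 30 = 0 by rewrite E.
  have r126 : r1 26 = 1 by rewrite E.
  rewrite -[rg _ 30]/(r1 30) -[rg _ 18]/(r1 18) r130 s1 => kpos.
  case: k kpos k1 I1 s1 c1 => [//|k] _ k1 I1 s1 c1; exists k; split; first by [].
  set u := nth 0 ts k.
  have uts : u \in ts by apply: mem_nth.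
  have [un gvu] := ts_mem T0 uts.
  have uv : u != v by apply/eqP => Eu; move: gvu; rewrite Eu girr.
  have tk : take k.+1 ts = rcons (take k ts) u by rewrite (take_nth 0).
  have nu : u \notin take k ts.
    have := take_uniq k.+1 (ts_uniq T0); rewrite tk rcons_uniq => /andP[] //.
  apply: wpSeq; apply: (wpSub (v := k)); first by rewrite s1 r126 subn1.
  apply: wpSeq; apply: (wpLd (vx := 0) (vy := 0) (vz := k) (v := u));
    [> by rewrite /upd /= | by rewrite /upd /= | by [] | lia | lia | lia | idtac | idtac].
    by rewrite fr1 // -/(tmp m k) (ts_tmp T0).
  set r3 := upd _ _ _; have q3 : eqr [:: 1; 18] r1 r3 by do 2 (apply: eqr_upd; last by []).
  have q03 := eqr_tr q1 q3 (L := pull_regs) isT.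
  have rok3 : regs_ok r3 by exact: regs_ok_eqr rok q03 _.
  have r31 : r3 1 = u by [].
  have r32 : r3 2 = v by rewrite q03.
  have gm : gminus g v (take k.+1 ts) u v = ~~ true.
    by rewrite /gminus tk [u \in _]mem_rcons mem_head eqxx orbT andbF.
  apply: (edge_spec SE SW rok3 I1); rewrite ?r31 ?r32 //.
  move=> r4 m4 k4 q4 _ I4 fr4 hk4; split.
  - by apply: (eqr_tr q03 q4).
  - by apply: Inv_ext I4; rewrite tk; apply: setE_gminus.
  - by rewrite -[rg _ _]/(r4 18) q4.
  - by lia.
  - by split; [move=> t a1 a2 a3 ht; rewrite -[mm _]/m4 fr4 // fr1|lia].
- move=> k c [r1 m1] [q1 I1 s1 k1 [fr1 c1]].
  rewrite [rg _]/= [mm _]/= in q1 I1 s1 fr1.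
  have r130 : r1 30 = 0 by rewrite q1.
  rewrite -[rg _ 30]/(r1 30) -[rg _ 18]/(r1 18) r130 s1 -leqNgt leqn0 => /eqP k0.
  apply: H => //; last lia.
  - apply: Inv_ext I1 => x y; rewrite k0 take0 /gminus.
    by rewrite !in_nil !andbF andbT.
  - by rewrite s1.
Qed.

(** Every neighbor of [v] left in the tables lies strictly above both the old and the new level.
    Then no bucket index changes, since the larger level is that of the neighbor, and no multiset
    counts the color of [v], since only lower neighbors record it. Level and color can therefore be
    changed by plain stores. *)
Lemma Inv_setv g m m' v : Inv g m -> v < n ->
  (forall t a1 a2 a3, 1 < t < 6 -> m' t a1 a2 a3 = m t a1 a2 a3) ->
  (forall x, x != v -> lv m' x = lv m x) -> (forall x, x != v -> col m' x = col m x) ->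
  (forall u, u < n -> g v u -> lv m v < lv m u /\ lv m' v < lv m u) ->
  (exists i, lv m' v = 2 ^ i) -> lv m' v < S -> 1 <= col m' v <= D.+1 -> Inv g m'.
Proof.
move=> [h1 h2 h3 h4 h5 h6 h7 h8 h9] vn fr El Ec nb lv2 lvS cD.
have Es x y e : sm m' x y e = sm m x y e by rewrite /sm /qg /cnt !fr.
have Eh x c : hc m' x c = hc m x c by rewrite /hc fr.
have nvv : g v v = false by rewrite h2.
split=> //.
- by move=> x y /h3 => /(_ y); apply: sok_other; rewrite /cnt ?fr // => t a; rewrite !inE => /orP[]/eqP->; rewrite fr.
- move=> x u y xn un y0; rewrite Es h4 //.
  case: (eqVneq x v) => [->|xv].
    case: (boolP (g v u)) => //= gvu; have [l1 l2] := nb _ un gvu.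
    have uv : u != v by apply/eqP => Eu; rewrite Eu nvv in gvu.
    by rewrite (El _ uv); congr (_ == _); lia.
  rewrite (El _ xv); case: (eqVneq u v) => [->|uv]; last by rewrite El.
  case: (boolP (g x v)) => //= gxv; have [l1 l2] := nb x xn (etrans (h1 v x) gxv).
  by congr (_ == _); lia.
- move=> x c xn; rewrite Eh h5 //; apply: eq_bigr => u _; congr (nat_of_bool _).
  case: (eqVneq x v) => [->|xv].
    case: (boolP (g v u)) => //= gvu; have [l1 l2] := nb _ (ltn_ord u) gvu.
    have uv : (u : nat) != v by apply/eqP => Eu; rewrite Eu nvv in gvu.
    by rewrite (El _ uv) (Ec _ uv) l1 l2.
  rewrite (El _ xv); case: (eqVneq (u : nat) v) => [->|uv]; last by rewrite El // Ec.
  case: (boolP (g x v)) => //= gxv; have [l1 l2] := nb x xn (etrans (h1 v x) gxv).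
  by have [-> ->] : (lv m x < lv m v) = false /\ (lv m x < lv m' v) = false by lia.
- by move=> x c *; rewrite Es Eh h6.
- by move=> x xn; case: (eqVneq x v) => [->//|xv]; rewrite El //; apply: h7.
- by move=> x xn; case: (eqVneq x v) => [->//|xv]; rewrite El //; apply: h8.
- by move=> x xn; case: (eqVneq x v) => [->//|xv]; rewrite Ec //; apply: h9.
Qed.

End Pull.

(** * Recoloring *)

(* Chooses the new level of vertex [r 2] and moves it there, leaving the edges to
   vertices that are not strictly above it on the stack. *)
Definition lift_loop :=
  Seq (Add 20 19 19) (Seq (Add 21 18 26)
  (While 20 21 (Seq (mov 19 20) (Seq pull_cmd (Seq (Add 20 19 19) (Add 21 18 26)))))).
(** The bucket of the own level mixes all neighbors at or below it. If they are fewer than twice the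
    level, the vertex is first put down to level 1, which sorts them into buckets of their own
    levels; otherwise the climb continues from the present level. *)
Definition lift_init :=
  Seq (Ld 19 1 30 30 2) (Seq (mov 18 30) (Seq pull_cmd (Seq (Add 20 19 19)
  (If 18 20 (Seq (St 1 30 30 2 26) (Seq push_cmd (Seq (mov 19 26) pull_cmd)))
     (Subn 9 9 9))))).
Definition lift_cmd :=
  Seq lift_init (Seq lift_loop
  (Seq (St 1 30 30 2 19) (Seq (Ld 34 2 30 2 30) (Seq (Add 35 11 26) (Subn 35 35 34))))).

Definition lift_regs := [:: 19, 20, 21, 34, 35 & pull_regs].

(** No power of two lies strictly between [b] and [2 b]; hence the neighbors that separate two
    consecutive thresholds form exactly one bucket. *)
Lemma pow2_le a b i j : a = 2 ^ i -> b = 2 ^ j -> (a <= b + b) = (a <= b) || (a == b + b).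
Proof.
move=> -> ->; rewrite addnn -mul2n -expnS !leq_exp2l // eqn_exp2l //.
by rewrite [in LHS]leq_eqVlt ltnS orbC.
Qed.

Section Recolor.
Variables n D S W : nat.
Hypothesis SE : S = n + D + 16.
Hypothesis SW : 4 * S <= W.
Local Notation wp := (wp S W).
Local Notation regs_ok := (regs_ok n D S).
Local Notation Inv := (Inv n D S).
Local Notation TS := (TS n).

Section Vertex.
Variables (g : graph) (v : nat) (m0 : mem4).
Hypothesis gsym : forall x y, g x y = g y x.
Hypothesis girr : forall x, g x x = false.
Hypothesis vn : v < n.
Hypothesis I0 : Inv g m0.

(* The edges of [v] to vertices of level at most [i] are on the stack [ts]. *)
Record Lifted (i : nat) (ts : seq nat) (m : mem4) : Prop := MkLifted {
  li_inv : Inv (gminus g v ts) m;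
  li_ts : TS g v ts m;
  li_mem : forall u, u < n -> g v u -> (u \in ts) = (lv m0 u <= i);
  li_lv : forall x, x != v -> lv m x = lv m0 x;
  li_col : forall x, col m x = col m0 x }.

Lemma nbr_neq u : g v u -> u != v.
Proof. by move=> gvu; apply/eqP => E; rewrite E girr in gvu. Qed.

Lemma TS_frame ts m m' : (forall i, tmp m' i = tmp m i) -> TS g v ts m -> TS g v ts m'.
Proof. by move=> E [h1 h2 h3]; split=> // j hj; rewrite E h3. Qed.

Lemma lift_init_spec r Q : regs_ok r -> r 2 = v ->
  (forall r' m' ts i k, eqr lift_regs r r' -> Lifted i ts m' ->
    r' 18 = size ts -> r' 19 = i -> (exists j, i = 2 ^ j) -> i < S -> lv m' v <= i ->
    i = 1 \/ 2 * i <= size ts ->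
    k <= 1500 * lv m0 v + 400 * size ts + 100 -> Q (MkSt r' m') k) ->
  wp lift_init (MkSt r m0) Q.
Proof.
move=> rok r2 H; have [r10 r11 o r29 z] := rok.
have lS := i_lvS I0 vn; set l := lv m0 v in lS H *.
have l0 : 0 < l by exact: (lv_gt0 I0).
apply: wpSeq; apply: (wpLd (vx := 0) (vy := 0) (vz := v) (v := l)); [> side .. | idtac].
apply: wpSeq; apply: (wpAdd (v := 0)); [lia | by rewrite /upd /= z | idtac].
set r1 := upd _ _ _; have q1 : eqr [:: 18; 19] r r1 by do 2 (apply: eqr_upd; last by []).
have rok1 : regs_ok r1 by exact: regs_ok_eqr rok q1 _.
have g0 x y : g x y = gminus g v [::] x y by rewrite /gminus !in_nil !andbF andbT.
have T0 m : TS g v [::] m by [].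
apply: wpSeq; apply: (pull_spec (v := v) (y := l) SE SW girr rok1 _ vn _ l0 lS (Inv_ext g0 I0) (T0 _)).
- by rewrite q1.
- by [].
- by [].
move=> r2' m2 ts k2 q2 I2 T2 s2 mem2 fr2 _ hk2; rewrite [size [::]]/= subn0 in hk2.
have q02 := eqr_tr q1 q2 (L := lift_regs) isT.
have r219 : r2' 19 = l by rewrite q2.
have lv2 x : lv m2 x = lv m0 x by rewrite /lv fr2.
have col2 x : col m2 x = col m0 x by rewrite /col fr2.
have mem2' u : u < n -> g v u -> (u \in ts) = (lv m0 u <= l).
  by move=> un gvu; rewrite mem2 // gvu in_nil /=; rewrite -/l; lia.
have L2 : Lifted l ts m2 by split.
apply: wpSeq; apply: (wpAdd (v := l + l)); [lia | by rewrite r219 | idtac].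
set r3 := upd _ _ _; have q3 : eqr [:: 20] r2' r3 by exact: eqr_upd.
have q03 := eqr_tr q02 q3 (L := lift_regs) isT.
have rok3 : regs_ok r3 by exact: regs_ok_eqr rok q03 _.
have [_ _ o3 _ z3] := rok3.
have r318 : r3 18 = size ts by rewrite q3.
have r319 : r3 19 = l by rewrite q3.
have r32 : r3 2 = v by rewrite q03.
have tn := ts_size T2.
apply: (wpIf (va := size ts) (vb := l + l)) => [//|//|lt|ge]; last first.
  apply: wpSub; first by [].
  apply: (H _ m2 ts l); [|exact: L2|by []|by []|exact: (i_lv I0)|by []|by rewrite lv2|right; lia|lia].
  exact: (eqr_tr q03 (eqr_upd (L := [:: 9]) _ (eqr_refl _) _)).
(* Fewer than [2 l] edges are on the stack here, so putting all of them back costs [O(l)], charged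
   to the old level. *)
apply: wpSeq; apply: (wpSt (vx := 0) (vy := 0) (vz := v) (v := 1)); [> by [] | by [] | by [] | by [] | lia | lia | lia | idtac].
set m4 := set4 _ _ _ _ _ _.
have lv4 : lv m4 v = 1 by rewrite /lv /m4 /set4 !eqxx.
have lv4x x : x != v -> lv m4 x = lv m0 x.
  by move=> xv; rewrite -lv2 /lv /m4 /set4 (negbTE xv) !andbF.
have I4 : Inv (gminus g v ts) m4.
  apply: (Inv_setv SE SW I2 vn) => //.
  - by move=> t a1 a2 a3 /andP[h1 h2]; rewrite /m4 /set4 gtn_eqF.
  - by move=> x xv; rewrite lv4x // lv2.
  - move=> u un; rewrite /gminus eqxx /= negb_or => /and3P[gvu nu _].
    by move: nu; rewrite mem2' // lv4 !lv2 -/l; lia.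
  - by exists 0.
  - by rewrite lv4; lia.
  - exact: (i_col I2).
have T4 : TS g v ts m4 by apply: TS_frame T2.
apply: wpSeq; apply: (push_spec SE SW gsym girr rok3 r32 vn I4 T4 r318).
move=> r5 m5 k5 q5 I5 r518 fr5 hk5.
have q05 := eqr_tr q03 q5 (L := lift_regs) isT.
have lv5 x : lv m5 x = lv m4 x by rewrite /lv fr5.
have col5 x : col m5 x = col m0 x by rewrite /col fr5 // -[m4 0 _ _ _]/(col m2 x) col2.
apply: wpSeq; apply: (wpAdd (v := 1)); [lia | by rewrite !q05 // o z | idtac].
set r6 := upd _ _ _; have q6 : eqr [:: 19] r5 r6 by exact: eqr_upd.
have q06 := eqr_tr q05 q6 (L := lift_regs) isT.
have rok6 : regs_ok r6 by exact: regs_ok_eqr rok q06 _.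
have S1 : 1 < S by lia.
apply: (pull_spec (v := v) (y := 1) SE SW girr rok6 _ vn _ isT S1 (Inv_ext g0 I5) (T0 _)).
- by rewrite q06.
- by [].
- by rewrite q6.
move=> r7 m7 ts7 k7 q7 I7 T7 s7 mem7 fr7 _ hk7; rewrite [size [::]]/= subn0 in hk7.
have q07 := eqr_tr q06 q7 (L := lift_regs) isT.
have lv7 x : lv m7 x = lv m4 x by rewrite /lv fr7 // -[m5 1 _ _ _]/(lv m5 x).
apply: (H r7 m7 ts7 1) => //.
- split=> //.
  + move=> u un gvu; have uv := nbr_neq gvu.
    rewrite mem7 // gvu in_nil /= !lv5 lv4 lv4x //.
    by have := lv_gt0 I0 un; lia.
  + by move=> x xv; rewrite lv7 lv4x.
  + by move=> x; rewrite /col fr7 // -[m5 0 _ _ _]/(col m5 x) col5.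
- by rewrite q7.
- by exists 0.
- by rewrite lv7 lv4.
- by left.
- by lia.
Qed.

Lemma lift_loop_spec r m ts i Q : regs_ok r -> r 2 = v -> Lifted i ts m ->
  r 18 = size ts -> r 19 = i -> (exists j, i = 2 ^ j) -> i < S -> lv m v <= i ->
  i = 1 \/ 2 * i <= size ts ->
  (forall r' m' ts' i' k, eqr lift_regs r r' -> Lifted i' ts' m' ->
    r' 18 = size ts' -> r' 19 = i' -> (exists j, i' = 2 ^ j) -> i' < S -> lv m' v <= i' ->
    size ts' < 2 * i' -> i' = 1 \/ i' <= count (fun u => lv m0 u < i') ts' ->
    size ts <= size ts' ->
    k <= 400 * (size ts' - size ts) + 20 * i' + 10 -> Q (MkSt r' m') k) ->
  wp lift_loop (MkSt r m) Q.
Proof.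
move=> rok r2 L r18 r19 p2 iS lvi hi H; have [r10 r11 o r29 z] := rok.
have szn ts1 i1 m1 : Lifted i1 ts1 m1 -> size ts1 <= n by move=> /li_ts /ts_size.
have tn := szn _ _ _ L.
apply: wpSeq; apply: (wpAdd (v := i + i)); [lia | by rewrite r19 | idtac].
apply: wpSeq; apply: (wpAdd (v := (size ts).+1)); [lia | by rewrite /upd /= r18 o addn1 | idtac].
(* The middle alternative [2 * i1 <= size ts1] covers an entry without reset; it contradicts the
   failed loop test and so cannot survive to the exit. *)
pose J k c (s : state) := exists ts1 i1, [/\ eqr lift_regs r (rg s), Lifted i1 ts1 (mm s),
  [/\ rg s 18 = size ts1, rg s 19 = i1, rg s 20 = i1 + i1 & rg s 21 = (size ts1).+1],
  [/\ exists j, i1 = 2 ^ j, i1 < S & lv (mm s) v <= i1] &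
  [/\ [\/ i1 = 1, 2 * i1 <= size ts1 | i1 <= count (fun u => lv m0 u < i1) ts1],
      size ts <= size ts1, n.+1 - i1 <= k & c <= 400 * (size ts1 - size ts) + 20 * i1 + 2]].
apply: (wp_while (I := J) (N := n.+1)).
- exists ts, i; split=> //; first by do 2 (apply: eqr_upd; last by []).
  by split=> //; [case: hi; [apply: Or31|apply: Or32]|lia|lia].
- move=> k c [r1 m1] [ts1 [i1 [q1 L1 [s1 e1 d1 t1] [[j p1] iS1 lv1] [h1 l1 k1 c1]]]].
  rewrite [rg _]/= in q1 s1 e1 d1 t1; rewrite [mm _]/= in L1 lv1.
  rewrite -[rg _ 20]/(r1 20) -[rg _ 21]/(r1 21) d1 t1 => lt.
  have tn1 := szn _ _ _ L1.
  exists k.-1; split; first by lia.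
  have i1pos : 0 < i1 by rewrite p1 expn_gt0.
  have r130 : r1 30 = 0 by rewrite q1.
  apply: wpSeq; apply: (wpAdd (v := i1 + i1)); [lia | by rewrite d1 r130 addn0 | idtac].
  set r3 := upd _ _ _; have q3 : eqr [:: 19] r1 r3 by exact: eqr_upd.
  have q03 := eqr_tr q1 q3 (L := lift_regs) isT.
  have rok3 : regs_ok r3 by exact: regs_ok_eqr rok q03 _.
  have y0 : 0 < i1 + i1 by lia.
  have yS : i1 + i1 < S by lia.
  apply: wpSeq; apply: (pull_spec (v := v) (y := i1 + i1) SE SW girr rok3 _ vn _ y0 yS (li_inv L1) (li_ts L1)).
  + by rewrite q03.
  + by [].
  + by rewrite q3.
  move=> r4 m4 ts4 k4 q4 I4 T4 s4 mem4 fr4 l4 hk4.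
  have q04 := eqr_tr q03 q4 (L := lift_regs) isT.
  have r419 : r4 19 = i1 + i1 by rewrite q4.
  have tn4 := ts_size T4.
  have lv4 x : lv m4 x = lv m1 x by rewrite /lv fr4.
  have L4 : Lifted (i1 + i1) ts4 m4.
    split=> //.
    + move=> u un gvu; rewrite mem4 // gvu (li_mem L1) //=.
      have uv := nbr_neq gvu; rewrite (li_lv L1 uv).
      have [i' lu2] := i_lv I0 un; rewrite (pow2_le lu2 p1).
      by congr (_ || _); apply/eqP/eqP; lia.
    + by move=> x xv; rewrite lv4 (li_lv L1).
    + by move=> x; rewrite /col fr4 // -/(col m1 x) (li_col L1).
  apply: wpSeq; apply: (wpAdd (v := (i1 + i1) + (i1 + i1))); [lia | by rewrite r419 | idtac].
  apply: (wpAdd (v := (size ts4).+1)); [lia | by rewrite /upd /= s4 q04 // o addn1 | idtac].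
  exists ts4, (i1 + i1); split=> //.
  + by apply: eqr_upd => //; apply: eqr_upd.
  + split=> //; first by exists j.+1; rewrite p1 addnn -mul2n expnS.
    by rewrite -[mm _]/m4 lv4; lia.
  + split=> //; [|lia|lia|lia].
    (* The vertices stacked before this round number at least [2 * i1] by the loop test, and all of
       them have level at most [i1]. *)
    apply: Or33; apply: (@leq_trans (size ts1)); first by lia.
    rewrite -size_filter; apply: uniq_leq_size; first exact: (ts_uniq (li_ts L1)).
    move=> u hu; have [un gvu] := ts_mem (li_ts L1) hu.
    rewrite mem_filter mem4 // hu andbT /=.
    by move: hu; rewrite (li_mem L1) //; lia.
- move=> k c [r1 m1] [ts1 [i1 [q1 L1 [s1 e1 d1 t1] [p1 iS1 lv1] [h1 l1 k1 c1]]]].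
  rewrite [rg _]/= in q1 s1 e1 d1 t1; rewrite [mm _]/= in L1 lv1.
  rewrite -[rg _ 20]/(r1 20) -[rg _ 21]/(r1 21) d1 t1 => lt.
  apply: (H r1 m1 ts1 i1) => //; [lia| |lia].
  by case: h1 => [h|h|h]; [left|lia|right].
Qed.

Lemma lift_spec r Q : regs_ok r -> r 2 = v ->
  (forall r' m' ts i k, eqr lift_regs r r' -> Lifted i ts m' -> lv m' v = i ->
    r' 18 = size ts -> r' 19 = i -> (exists j, i = 2 ^ j) ->
    size ts < 2 * i -> i = 1 \/ i <= count (fun u => lv m0 u < i) ts ->
    r' 34 = cnt m' v 0 -> r' 35 = D.+1 - cnt m' v 0 ->
    k <= 3000 * (lv m0 v + i) -> Q (MkSt r' m') k) ->
  wp lift_cmd (MkSt r m0) Q.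
Proof.
move=> rok r2 H; have [r10 r11 o r29 z] := rok.
apply: wpSeq; apply: (lift_init_spec rok r2).
move=> r1 m1 ts1 i1 k1 q1 L1 s1 e1 p1 b1 lv1 h1 c1.
have rok1 : regs_ok r1 by exact: regs_ok_eqr rok q1 _.
have r12 : r1 2 = v by rewrite q1.
apply: wpSeq; apply: (lift_loop_spec rok1 r12 L1 s1 e1 p1 b1 lv1 h1).
move=> r3 m3 ts i k3 q13 L3 s3 e3 p3 b3 lv3 sz3 h3 mono c3.
have q3 := eqr_tr q1 q13 (L := lift_regs) isT.
have tn := ts_size (li_ts L3).
apply: wpSeq; apply: (wpSt (vx := 0) (vy := 0) (vz := v) (v := i)); [> by rewrite q3 | by rewrite q3 | by rewrite q3 | by [] | lia | lia | lia | idtac].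
set m4 := set4 _ _ _ _ _ _.
have lv4 : lv m4 v = i by rewrite /lv /m4 /set4 !eqxx.
have lv4x x : x != v -> lv m4 x = lv m3 x.
  by move=> xv; rewrite /lv /m4 /set4 (negbTE xv) !andbF.
have I4 : Inv (gminus g v ts) m4.
  apply: (Inv_setv SE SW (li_inv L3) vn) => //.
  - by move=> t a1 a2 a3 /andP[h5 h6]; rewrite /m4 /set4 gtn_eqF.
  - move=> u un; rewrite /gminus eqxx /= negb_or => /and3P[gvu nu _].
    move: nu; rewrite (li_mem L3) // lv4 (li_lv L3 (nbr_neq gvu)); lia.
  - by rewrite lv4.
  - by rewrite lv4.
  - exact: (i_col (li_inv L3)).
have L4 : Lifted i ts m4.
  split=> //; first by apply: TS_frame (li_ts L3).
  - exact: (li_mem L3).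
  - by move=> x xv; rewrite lv4x // (li_lv L3).
  - exact: (li_col L3).
have cU := sok_cnt (i_ok I4 0 vn).
apply: wpSeq; apply: (wpLd (vx := 0) (vy := v) (vz := 0) (v := cnt m4 v 0)); [> by rewrite q3 | by rewrite q3 | by rewrite q3 | lia | lia | lia | by [] | idtac].
apply: wpSeq; apply: (wpAdd (v := D.+1)); [lia | by rewrite /upd /= !q3 // r11 o addn1 | idtac].
apply: (wpSub (v := D.+1 - cnt m4 v 0)); first by [].
apply: (H _ m4 ts i) => //.
- by do 3 (apply: eqr_upd; last by []).
- have i0 : 0 < i by case: p3 => j ->; rewrite expn_gt0.
  by have := lv_gt0 I0 vn; lia.
Qed.

End Vertex.
End Recolor.

(* Reads off color number [r 36] of the palette of vertex [r 2] and compares it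
   with the colors of the stacked vertices; a match strictly below the level of
   [r 2] scores 1 and is stored in register 24, a match on the same level scores 2. *)
Definition scan_cmd :=
  Seq (Add 25 34 26) (Seq (Add 25 25 36) (Seq (Ld 37 3 2 30 25)
  (Seq (If 30 37 (Subn 9 9 9) (mov 37 25)) (Seq (mov 23 30) (Seq (mov 31 30)
  (While 31 18 (Seq (Ld 1 6 30 30 31) (Seq (Ld 38 0 30 30 1) (Seq (Ld 39 1 30 30 1)
    (Seq (If 38 37 (Subn 9 9 9) (If 37 38 (Subn 9 9 9)
      (If 39 19 (Seq (Add 23 23 26) (mov 24 1)) (Seq (Add 23 23 26) (Add 23 23 26)))))
    (Add 31 31 26))))))))))).

Definition finish_cmd := Seq (St 0 30 30 2 37) (Seq push_cmd (mov 2 24)).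

Definition dispatch_cmd :=
  Seq (Add 25 26 26) (If 0 25
    (Seq (edge_cmd true) (Seq (Add 33 13 14) (Seq (mov 32 30)
       (If 15 16 (Subn 9 9 9) (If 16 15 (Subn 9 9 9) (mov 32 26))))))
    (Seq (edge_cmd false) (mov 32 30))).

Definition pick_cmd := If 36 13 (Subn 9 9 9) (mov 2 1).

Definition prep_cmd :=
  Seq (Const 26 1) (Seq (mov 31 30)
  (While 31 10 (Seq (St 0 30 30 31 26) (Seq (St 1 30 30 31 26) (Add 31 31 26))))).

Definition scan_regs := [:: 1; 9; 23; 24; 25; 31; 37; 38; 39].

Definition match_score (m : mem4) i c u :=
  if col m u == c then if lv m u < i then 1 else 2 else 0.
Definition score m i ts c := \sum_(u <- ts) match_score m i c u.

(** * Testing a random color and installing it *)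

Section Scan.
Variables n D S W : nat.
Hypothesis SE : S = n + D + 16.
Hypothesis SW : 4 * S <= W.
Local Notation wp := (wp S W).
Local Notation regs_ok := (regs_ok n D S).
Local Notation SOK := (SOK n D).
Local Notation U := (usize n D).
Local Notation Inv := (Inv n D S).
Local Notation TS := (TS n).

Lemma scan_spec g v r m ts i a Q : regs_ok r -> r 2 = v -> v < n -> TS g v ts m ->
  SOK m v 0 ->
  r 18 = size ts -> r 19 = i -> r 34 = cnt m v 0 -> r 36 = a -> cnt m v 0 + a < D.+1 ->
  (forall r' k, eqr scan_regs r r' ->
    r' 37 = pg m v 0 (cnt m v 0 + a).+1 ->
    r' 23 = score m i ts (r' 37) ->
    (r' 23 = 1 -> [/\ r' 24 \in ts, col m (r' 24) = r' 37 & lv m (r' 24) < i]) ->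
    k <= 40 * size ts + 30 -> Q (MkSt r' m) k) ->
  wp scan_cmd (MkSt r m) Q.
Proof.
move=> rok r2 vn T ok r18 r19 r34 r36 aD H; have [r10 r11 o r29 z] := rok.
have tn := ts_size T.
set pos := (cnt m v 0 + a).+1.
have hpos : 1 <= pos <= U 0 by rewrite /pos /usize /=.
apply: wpSeq; apply: (wpAdd (v := (cnt m v 0).+1)); [lia | by rewrite r34 o addn1 | idtac].
apply: wpSeq; apply: (wpAdd (v := pos)); [lia | by rewrite /upd /= r36 | idtac].
apply: wpSeq; apply: (wpLd (vx := v) (vy := 0) (vz := pos) (v := m 3 v 0 pos));
  [> by [] | by [] | by [] | lia | lia | lia | by [] | idtac].
set r1 := upd _ _ _.
have q1 : eqr [:: 25; 37] r r1 by do 3 (apply: eqr_upd; last by []).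
set c := pg m v 0 pos.
have [cU _] := sok_p ok hpos; rewrite -/c in cU.
have uS (u : nat) : u \in ts -> u < S by move=> /(ts_mem T) []; lia.
have rest r3 k0 : k0 <= 5 -> eqr [:: 9; 25; 37] r r3 -> r3 37 = c ->
  wp (Seq (mov 23 30) (Seq (mov 31 30)
  (While 31 18 (Seq (Ld 1 6 30 30 31) (Seq (Ld 38 0 30 30 1) (Seq (Ld 39 1 30 30 1)
    (Seq (If 38 37 (Subn 9 9 9) (If 37 38 (Subn 9 9 9)
      (If 39 19 (Seq (Add 23 23 26) (mov 24 1)) (Seq (Add 23 23 26) (Add 23 23 26)))))
    (Add 31 31 26)))))))) (MkSt r3 m) (fun s k => Q s (10 + (k0 + k))).
  move=> hk0 q3 r337.
  have r330 : r3 30 = 0 by rewrite q3.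
  apply: wpSeq; apply: (wpAdd (v := 0)); [lia | by rewrite r330 | idtac].
  apply: wpSeq; apply: (wpAdd (v := 0)); [lia | by rewrite /upd /= r330 | idtac].
  pose J k b (s : state) := exists j, [/\ eqr scan_regs r (rg s), mm s = m,
    [/\ rg s 31 = j, rg s 37 = c & j <= size ts],
    rg s 23 = score m i (take j ts) c /\
      (rg s 23 = 1 -> [/\ rg s 24 \in ts, col m (rg s 24) = c & lv m (rg s 24) < i]) &
    size ts - j <= k /\ b <= 40 * j + 2].
  apply: (wp_while (I := J) (N := size ts)).
  - exists 0; split=> //.
    + by do 2 (apply: eqr_upd; last by []); apply: (eqr_sub q3).
    + by rewrite take0 /score big_nil.
    + by rewrite subn0.
  - move=> k b [r4 m4] [j [q4 m4E [j4 c4 jt] [sc4 w4] [k4 b4]]].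
    rewrite [mm _]/= in m4E; rewrite [rg _]/= in q4 j4 c4 sc4 w4; subst m4.
    have r418 : r4 18 = size ts by rewrite q4.
    rewrite -[rg _ 31]/(r4 31) -[rg _ 18]/(r4 18) j4 r418 => jlt.
    exists k.-1; split; first by lia.
    have r430 : r4 30 = 0 by rewrite q4.
    have r426 : r4 26 = 1 by rewrite q4.
    have r419 : r4 19 = i by rewrite q4.
    set u := nth 0 ts j; have uts : u \in ts by apply: mem_nth.
    have hu := uS _ uts.
    apply: wpSeq; apply: (wpLd (vx := 0) (vy := 0) (vz := j) (v := u));
      [> by [] | by [] | by [] | lia | lia | lia | by rewrite -/(tmp m j) (ts_tmp T) | idtac].
    apply: wpSeq; apply: (wpLd (vx := 0) (vy := 0) (vz := u) (v := col m u));
      [> by [] | by [] | by [] | lia | lia | lia | by [] | idtac].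
    apply: wpSeq; apply: (wpLd (vx := 0) (vy := 0) (vz := u) (v := lv m u));
      [> by [] | by [] | by [] | lia | lia | lia | by [] | idtac].
    set r5 := upd _ _ _.
    have q5 : eqr [:: 1; 38; 39] r4 r5 by do 3 (apply: eqr_upd; last by []).
    have tk : score m i (take j.+1 ts) c = score m i (take j ts) c + match_score m i c u.
      by rewrite (take_nth 0) // -cats1 /score big_cat /= big_seq1.
    (* Bounds the running score, so that adding to register 23 cannot overflow. *)
    have scb : score m i (take j ts) c <= 2 * j.
      rewrite /score; apply: (@leq_trans (\sum_(w <- take j ts) 2)).
        by apply: leq_sum => w _; rewrite /match_score; case: ifP => // _; case: ifP.
      by rewrite big_const_seq count_predT iter_addn_0 size_take; case: ifP; lia.
    have fin r6 k6 : k6 <= 14 -> eqr [:: 9; 23; 24] r5 r6 ->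
       r6 23 = score m i (take j.+1 ts) c ->
       (r6 23 = 1 -> [/\ r6 24 \in ts, col m (r6 24) = c & lv m (r6 24) < i]) ->
       wp (Add 31 31 26) (MkSt r6 m)
        (fun s k2 => J k.-1 (b + (8 + (8 + (8 + (k6 + k2))))).+1 s).
      move=> hk6 q6 s6 w6.
      have r631 : r6 31 = j by rewrite q6 // q5.
      have r626 : r6 26 = 1 by rewrite q6 // q5.
      apply: (wpAdd (v := j.+1)); [lia | by rewrite r631 r626 addn1 | idtac].
      exists j.+1; split=> //.
      - apply: eqr_upd => //.
        exact: (eqr_tr (eqr_tr q4 q5 (L := scan_regs) isT) q6).
      - by split=> //; rewrite -[rg _ _]/(r6 37) q6 // q5.
      - by lia.
    have r523 : r5 23 = r4 23 by rewrite q5.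
    have same : col m u != c -> r4 23 = score m i (take j.+1 ts) c.
      by move=> ne; rewrite tk /match_score (negbTE ne) addn0.
    apply: wpSeq; apply: (wpIf (va := col m u) (vb := c)); [by []|by rewrite /r5 /upd /=|move=> lt|move=> ge].
      apply: wpSub; first by [].
      apply: (fin _ 2) => //; first by apply: eqr_upd.
        by rewrite -[upd _ _ _ 23]/(r5 23) r523; apply: same; rewrite ltn_eqF.
    apply: (wpIf (va := c) (vb := col m u)); [by rewrite /r5 /upd /=|by []|move=> lt|move=> le].
      apply: wpSub; first by [].
      apply: (fin _ 4) => //; first by apply: eqr_upd.
        by rewrite -[upd _ _ _ 23]/(r5 23) r523; apply: same; rewrite gtn_eqF.
    have E : col m u = c by apply/eqP; rewrite eqn_leq le ge.
    apply: (wpIf (va := lv m u) (vb := i)); [by []|by rewrite q5|move=> lt|move=> gei].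
      apply: wpSeq; apply: (wpAdd (v := (r4 23).+1)); [lia|by rewrite r523 q5 // r426 addn1|].
      apply: (wpAdd (v := u)); [lia|by rewrite /upd /= -[r5 1]/u q5 // r430 addn0|].
      apply: (fin _ 7) => //; first by do 2 (apply: eqr_upd; last by []).
        by rewrite /upd /= tk /match_score E eqxx lt addn1 sc4.
    apply: wpSeq; apply: (wpAdd (v := (r4 23).+1)); [lia|by rewrite r523 q5 // r426 addn1|].
    apply: (wpAdd (v := (r4 23).+2)); [lia|by rewrite /upd /= q5 // r426 addn1|].
    apply: (fin _ 8) => //; first by do 2 (apply: eqr_upd; last by []).
      by rewrite /upd /= tk /match_score E eqxx ltnNge gei /= addn2 sc4.
  - move=> k b [r4 m4] [j [q4 m4E [j4 c4 jt] [sc4 w4] [k4 b4]]].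
    rewrite [mm _]/= in m4E; rewrite [rg _]/= in q4 j4 c4 sc4 w4; subst m4.
    have r418 : r4 18 = size ts by rewrite q4.
    rewrite -[rg _ 31]/(r4 31) -[rg _ 18]/(r4 18) j4 r418 -leqNgt => jge.
    apply: H => //; [by rewrite c4 sc4 take_oversize|by rewrite c4|].
    have -> : size ts = j by lia.
    lia.
have r130 : r1 30 = 0 by rewrite q1.
apply: wpSeq; apply: (wpIf (va := 0) (vb := m 3 v 0 pos)); [by []|by []|move=> h0|move=> h0].
  apply: wpSub; first by [].
  apply: (rest _ 2) => //; first by apply: eqr_upd => //; apply: (eqr_sub q1).
  by rewrite /upd /= /c /pg; case: eqP h0 => // ->.
apply: (wpAdd (v := pos)); [lia | by rewrite /upd /= -[r1 25]/pos q1 // z addn0 | idtac].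
apply: (rest _ 3) => //; first by apply: eqr_upd => //; apply: (eqr_sub q1).
by rewrite /upd /= /c /pg; case: eqP h0 => //; lia.
Qed.

Lemma finish_spec g v r m ts Q : (forall x y, g x y = g y x) -> (forall x, g x x = false) ->
  regs_ok r -> r 2 = v -> v < n -> Inv (gminus g v ts) m -> TS g v ts m -> r 18 = size ts ->
  (forall u, u < n -> g v u -> u \notin ts -> lv m v < lv m u) ->
  1 <= r 37 <= D.+1 -> r 24 < W ->
  (forall r' m' k, eqr (2 :: pull_regs) r r' -> r' 2 = r 24 -> Inv g m' ->
    (forall x, lv m' x = lv m x) ->
    (forall x, col m' x = if x == v then r 37 else col m x) ->
    k <= 350 * size ts + 20 -> Q (MkSt r' m') k) ->
  wp finish_cmd (MkSt r m) Q.
Proof.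
move=> gsym girr rok r2 vn I T r18 hi hc h24 H; have [r10 r11 o r29 z] := rok.
apply: wpSeq; apply: (wpSt (vx := 0) (vy := 0) (vz := v) (v := r 37));
  [> by [] | by [] | by [] | by [] | lia | lia | lia | idtac].
set m4 := set4 _ _ _ _ _ _.
have col4 x : col m4 x = if x == v then r 37 else col m x by rewrite /col /m4 /set4.
have I4 : Inv (gminus g v ts) m4.
  apply: (Inv_setv SE SW I vn) => //.
  - by move=> t a1 a2 a3 /andP[h5 h6]; rewrite /m4 /set4 gtn_eqF //; lia.
  - by move=> x xv; rewrite col4 (negbTE xv).
  - move=> u un; rewrite /gminus eqxx /= negb_or => /and3P[gvu nu _].
    by rewrite -[lv m4 v]/(lv m v); have := hi u un gvu nu.
  - exact: (i_lv I).
  - exact: (i_lvS I).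
  - by rewrite col4 eqxx.
have T4 : TS g v ts m4 by apply: TS_frame T.
apply: wpSeq; apply: (push_spec SE SW gsym girr rok r2 vn I4 T4 r18).
move=> r' m' k q I' r'18 fr hk.
apply: (wpAdd (v := r 24)); [by []|by rewrite !q // z addn0|].
apply: H => //.
- by apply: eqr_upd => //; apply: (eqr_sub q).
- by move=> x; rewrite /lv fr.
- by move=> x; rewrite -col4 /col fr.
- by lia.
Qed.

End Scan.

(** * The potential *)

(** The largest [l - 16 * j] over all [j >= 1] for which the [j]-th partner matches. It anticipates
    the cost of a future conflict at level [l]; the linear decay means that passing one partner
    raises it by at most 16, a constant charged to that insertion. *)
Fixpoint threat (mt : nat -> bool) (l : nat) (ps : seq nat) : nat :=
  if ps is u :: ps' then maxn (if mt u then l - 16 else 0) (threat mt (l - 16) ps')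
  else 0.

Lemma threat_mono (mt mt' : nat -> bool) l ps : (forall u, mt' u -> mt u) -> threat mt' l ps <= threat mt l ps.
Proof.
move=> H; elim: ps l => //= u ps IH l; rewrite geq_max !leq_max IH orbT andbT.
by case: (boolP (mt' u)) => [/H ->|_]; rewrite ?leqnn.
Qed.

Lemma threat_shift mt l ps : threat mt l ps <= threat mt (l - 16) ps + 16.
Proof.
elim: ps l => //= u ps IH l; rewrite geq_max; apply/andP; split.
  by case: (mt u) => //; lia.
by apply: leq_trans (IH _) _; rewrite leq_add2r leq_maxr.
Qed.

Lemma threat_small mt l ps : l <= 16 -> threat mt l ps = 0.
Proof.
elim: ps l => //= u ps IH l hl; rewrite IH; last lia.
by case: (mt u) => //; lia.
Qed.

Lemma sum_pick (F : nat) (f : nat -> nat) c x :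
  {in gtn F &, injective f} -> \sum_(a < F) (if f a == c then x else 0) <= x.
Proof.
move=> inj; case: (boolP [exists a : 'I_F, f a == c]) => [/existsP [a /eqP fa]|].
  rewrite (bigD1 a) //= fa eqxx big1 ?addn0 // => b ba.
  case: eqP => // fb; case/negP: ba; apply/eqP/val_inj/inj; rewrite ?inE ?ltn_ord //.
  by rewrite fb fa.
by rewrite negb_exists => /forallP H; rewrite big1 // => a _; rewrite (negbTE (H a)).
Qed.

(* A uniformly random color of a palette of size [F] carries an expected threat
   of at most [l ^ 2 / (32 F)]. *)
Lemma threat_sum (F : nat) (f cl : nat -> nat) (p : pred nat) l ps :
  {in gtn F &, injective f} ->
  32 * \sum_(a < F) threat (fun u => (cl u == f a) && p u) l ps <= l * l.
Proof.
move=> inj; elim: ps l => [|u ps IH] l /=; first by rewrite big1.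
case: (leqP l 16) => hl.
  rewrite big1 // => a _; rewrite threat_small; last by lia.
  by case: ifP => // _; lia.
apply: (@leq_trans (32 * ((l - 16) + \sum_(a < F) threat (fun u => (cl u == f a) && p u) (l - 16) ps))).
  rewrite leq_mul2l /=.
  apply: (@leq_trans (\sum_(a < F) (if f a == cl u then l - 16 else 0) +
      \sum_(a < F) threat (fun u => (cl u == f a) && p u) (l - 16) ps)).
    rewrite -big_split /=; apply: leq_sum => a _.
    rewrite eq_sym; case: (f a == cl u) => /=; last by rewrite max0n.
    by case: (p u); lia.
  by rewrite leq_add2r; apply: sum_pick.
(* The identity [32 (l - 16) + (l - 16)^2 = l^2 - 256] is the reason for 32, twice the decay 16. *)
by rewrite mulnDr; have := IH (l - 16); nia.
Qed.

(** A neighbor matches at most one color of an injective palette, scoring 1 if it is lower and 2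
    otherwise; adding the number of lower ones evens this out to 2 each. *)
Lemma score_sum (F : nat) (f : nat -> nat) m i ts :
  {in gtn F &, injective f} ->
  \sum_(a < F) score m i ts (f a) + count (fun u => lv m u < i) ts <= 2 * size ts.
Proof.
move=> inj; rewrite /score exchange_big /=.
elim: ts => [|u ts IH] /=; first by rewrite big_nil.
rewrite big_cons; move: IH; set s0 := \sum_(j <- ts) _ => IH.
suff : \sum_(a < F) match_score m i (f a) u + (lv m u < i) <= 2.
  by move=> H; rewrite addnACA mulnS; apply: leq_add H IH.
have := @sum_pick F f (col m u) (if lv m u < i then 1 else 2) inj.
rewrite /match_score; under eq_bigr => a _ do rewrite eq_sym.
by case: (lv m u < i) => /= H; rewrite ?addn1 ?addn0.
Qed.

(** Only insertions can create conflicts, so deletions have no partner. *)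
Definition partner v (up : update) : option nat :=
  if up is Ins a b then if a == v then Some b else if b == v then Some a else None
  else None.
Definition partners v (q : seq update) : seq nat := pmap (partner v) q.

(* [stamp u <= stamp v]: the current color of [v] was chosen after that of [u]. *)
Definition matching (m : mem4) (stamp : nat -> nat) v u :=
  [&& col m u == col m v, stamp u <= stamp v & u != v].

Definition Th m stamp q v := threat (matching m stamp v) (lv m v) (partners v q).

(* [cW] bounds the cost of a recoloring step per unit of level. *)
Section Pot.
Variable cW : nat.
(** A recoloring at level [i] spends [cW * i] on machine steps and [2 * cW * i] on the expected
    threat of the accepted color, and hands [cQ] times at most half the level, [4 * cW * i], to the
    next vertex: together [cA * i]. The budget [cQ] per unit of the old level repays the debt [cA]
    and leaves [cW] for steps. [cB] is twice [cQ] for the sake of [Phi_conflict]; [cK] gives [cA]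
    and [16 * cB] to each of two endpoints, plus 1000 for steps. *)
Definition cA := 7 * cW.
Definition cQ := 8 * cW.
Definition cB := 16 * cW.
Definition cK := 2 * cA + 32 * cB + 1000.

(** The credit of insertions not yet borrowed by climbing; [low_levels] keeps the subtraction
    exact. *)
Definition PotA (ins : nat -> nat) m v := cA * ((ins v).+1 - lv m v).
Definition Pot ins m stamp q v := PotA ins m v + cB * Th m stamp q v.

Variable n : nat.

(** The summand [cK * size q] prepays the pending updates, so the initial value bounds the total
    expected cost. *)
Definition Phi ins m stamp q := \sum_(v < n) Pot ins m stamp q v + cK * size q.

Definition Rest ins m stamp q v := \sum_(x < n | (x : nat) != v) Pot ins m stamp q x.

(* The potential of a state in which [v] is about to be recolored. *)
Definition PhiX ins m stamp q v :=
  Rest ins m stamp q v + PotA ins m v + cK * size q.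

Lemma Phi_split ins m stamp q v : v < n ->
  Phi ins m stamp q = PhiX ins m stamp q v + cB * Th m stamp q v.
Proof.
move=> vn; rewrite /Phi /PhiX (bigD1 (Ordinal vn)) //= /Rest.
have -> : \sum_(x < n | (x : nat) != v) Pot ins m stamp q x =
          \sum_(i < n | i != Ordinal vn) Pot ins m stamp q i.
  by apply: eq_bigl => x.
by rewrite /Pot; lia.
Qed.

Lemma PhiX_le ins m stamp q v : v < n -> PhiX ins m stamp q v <= Phi ins m stamp q.
Proof. by move=> vn; rewrite (Phi_split _ _ _ _ vn) leq_addr. Qed.

Definition newstamp (stamp : nat -> nat) v x :=
  if x == v then (\max_(y < n) stamp y).+1 else stamp x.

Lemma newstamp_lt stamp v x : x < n -> stamp x < newstamp stamp v v.
Proof.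
move=> xn; rewrite /newstamp eqxx ltnS.
exact: (leq_bigmax (F := fun y : 'I_n => stamp y) (Ordinal xn)).
Qed.

(** The new color of [v] carries the newest stamp, so [v] no longer counts in the threat of any
    other vertex: conflicts with [v] are now charged to [v]. *)
Lemma Rest_recolor ins m m' stamp q v : v < n ->
  (forall x, x != v -> lv m' x = lv m x) -> (forall x, x != v -> col m' x = col m x) ->
  Rest ins m' (newstamp stamp v) q v <= Rest ins m stamp q v.
Proof.
move=> vn El Ec; apply: leq_sum => x xv; rewrite /Pot /PotA /Th El // leq_add2l leq_mul2l.
apply/orP; right; apply: threat_mono => u /and3P[h1 h2 h3].
have uv : u != v.
  apply/eqP => Eu; move: h2; rewrite {1}Eu leqNgt [newstamp stamp v x]/newstamp (negbTE xv).
  by rewrite newstamp_lt.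
rewrite Ec // (Ec x xv) in h1; rewrite /newstamp (negbTE uv) (negbTE xv) in h2.
by rewrite /matching h1 h2.
Qed.

Lemma Th_recolor m' stamp q v c (cl : nat -> nat) : (forall u, u != v -> col m' u = cl u) -> col m' v = c ->
  Th m' stamp q v <= threat (fun u => (cl u == c) && (u != v)) (lv m' v) (partners v q).
Proof.
move=> Ec Ev; apply: threat_mono => u /and3P[h1 h2 h3].
by rewrite -Ec // -Ev h1.
Qed.

Definition addins (ins : nat -> nat) u v x := ins x + ((x == u) || (x == v)).

Section Insert.
Variables (ins stamp : nat -> nat) (m m' : mem4) (q : seq update) (u v : nat).
Hypothesis un : u < n.
Hypothesis vn : v < n.
Hypothesis uv : u != v.
Hypothesis El : forall x, lv m' x = lv m x.
Hypothesis Ec : forall x, col m' x = col m x.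
Let ins' := addins ins u v.
Let q0 := Ins u v :: q.

Lemma matching_eq x y : matching m' stamp x y = matching m stamp x y.
Proof. by rewrite /matching !Ec. Qed.

Lemma Th_eq q1 x : Th m' stamp q1 x = Th m stamp q1 x.
Proof.
rewrite /Th El; apply/eqP; rewrite eqn_leq; apply/andP; split; apply: threat_mono => y;
by rewrite matching_eq.
Qed.

Lemma partners_ins x : partners x q0 =
  if u == x then v :: partners x q else if v == x then u :: partners x q else partners x q.
Proof. by rewrite /q0 /= ; case: (u == x) => //; case: (v == x). Qed.

Lemma Th_ins x : Th m' stamp q x <= Th m stamp q0 x + 16 * ((x == u) || (x == v)).
Proof.
rewrite Th_eq /Th partners_ins [x == u]eq_sym [x == v]eq_sym.
have := threat_shift (matching m stamp x) (lv m x) (partners x q).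
by case: (u == x) => /=; [|case: (v == x) => /=]; lia.
Qed.

Lemma Th_hit x y : (x, y) = (u, v) \/ (x, y) = (v, u) -> matching m stamp x y ->
  lv m x <= Th m stamp q0 x + 16.
Proof.
move=> h mt; rewrite /Th partners_ins; case: h => [[Ex Ey]|[Ex Ey]]; rewrite {x}Ex {y}Ey in mt *.
  by rewrite eqxx /= mt; lia.
by rewrite (negbTE uv) eqxx /= mt; lia.
Qed.

Lemma PotA_ins x : PotA ins' m' x <= PotA ins m x + cA * ((x == u) || (x == v)).
Proof. by rewrite /PotA El /ins' /addins; case: (_ || _); nia. Qed.

Lemma sum_pair (F : nat -> nat) c :
  \sum_(x < n) c * (((x : nat) == u) || ((x : nat) == v)) = 2 * c.
Proof.
rewrite -big_distrr /= (bigD1 (Ordinal un)) //= (bigD1 (Ordinal vn)) /=; last first.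
  by apply/eqP => /(congr1 val) /= E; case/eqP: uv.
rewrite !eqxx orbT big1 ?addn0; first lia.
move=> x /andP[xu xv].
case: (eqVneq (x : nat) u) => [E|_]; first by case/eqP: xu; apply/val_inj.
by case: (eqVneq (x : nat) v) => [E|_] //; case/eqP: xv; apply/val_inj.
Qed.

Lemma Phi_insert : Phi ins' m' stamp q + 1000 <= Phi ins m stamp q0.
Proof.
rewrite /Phi; have E : cK * size q0 = cK + cK * size q by rewrite /= mulnS.
have K : cK = 2 * cA + 32 * cB + 1000 by [].
suff : \sum_(x < n) Pot ins' m' stamp q x <= \sum_(x < n) Pot ins m stamp q0 x + (2 * cA + 2 * (16 * cB)) by lia.
rewrite -[2 * cA](sum_pair id) -[2 * (16 * cB)](sum_pair id) -!big_split /=; apply: leq_sum => x _.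
have := PotA_ins x; have := Th_ins x; rewrite /Pot.
by case: (_ || _); rewrite ?muln1 ?muln0 ?addn0; nia.
Qed.

Lemma PhiX_insert x y : (x, y) = (u, v) \/ (x, y) = (v, u) ->
  PhiX ins' m' stamp q x + cB * (Th m stamp q0 x + 16) + 1000 <= Phi ins m stamp q0.
Proof.
move=> hxy; have xn : x < n by case: hxy => -[-> _].
have xE : ((x == u) || (x == v)) = true by case: hxy => -[-> _]; rewrite eqxx ?orbT.
rewrite (Phi_split _ _ _ _ xn) /PhiX.
have E : cK * size q0 = cK + cK * size q by rewrite /= mulnS.
have K : cK = 2 * cA + 32 * cB + 1000 by [].
have HA := PotA_ins x; rewrite xE muln1 in HA.
(* Only the other endpoint raises [Rest]; the share [16 * cB] of [x] itself stays available and
   completes its threat to [Th + 16]. *)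
suff : Rest ins' m' stamp q x <= Rest ins m stamp q0 x + (cA + 16 * cB) by lia.
pose G (z : nat) := (cA + 16 * cB) * ((z == u) || (z == v)).
have -> : cA + 16 * cB = \sum_(z < n | (z : nat) != x) G z.
  have := sum_pair id (cA + 16 * cB); rewrite (bigD1 (Ordinal xn)) //= xE muln1.
  have -> : \sum_(z < n | (z : nat) != x) G z = \sum_(i < n | i != Ordinal xn) G i.
    by apply: eq_bigl => z.
  by rewrite /G; lia.
rewrite /Rest -big_split /=; apply: leq_sum => z _.
have := PotA_ins z; have := Th_ins z; rewrite /Pot /G.
by case: (_ || _); rewrite ?muln1 ?muln0 ?addn0; nia.
Qed.

(* The endpoint colored last pays for the recoloring: it is recolored with
   probability proportional to the level of the other endpoint. *)
Lemma Phi_conflict : col m u = col m v ->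
  lv m u * (PhiX ins' m' stamp q v + cQ * lv m v) +
  lv m v * (PhiX ins' m' stamp q u + cQ * lv m u) + (lv m u + lv m v) * 1000
  <= (lv m u + lv m v) * Phi ins m stamp q0.
Proof.
move=> cuv.
have main x y : (x, y) = (u, v) \/ (x, y) = (v, u) -> matching m stamp x y ->
  lv m y * (PhiX ins' m' stamp q x + cQ * lv m x) +
  lv m x * (PhiX ins' m' stamp q y + cQ * lv m y) + (lv m x + lv m y) * 1000
  <= (lv m x + lv m y) * Phi ins m stamp q0.
  move=> h mt; have hit := Th_hit h mt; have P := PhiX_insert h.
  have [xn yn] : x < n /\ y < n by case: h => -[-> ->].
  have Py := PhiX_le ins' m' stamp q yn.
  have := Th_ins x; have -> : ((x == u) || (x == v)) = true by case: h => -[-> _]; rewrite eqxx ?orbT.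
  rewrite muln1 => Tx; rewrite (Phi_split ins' m' stamp q xn) in Py.
  set Px := PhiX ins' m' stamp q x in P Py *; set Z := Th m stamp q0 x + 16 in hit P Tx.
  apply: (@leq_trans ((lv m x + lv m y) * (Px + cB * Z + 1000))); last by rewrite leq_mul2l P orbT.
  (* If [y] is recolored, [x] keeps its threat; if [x] is recolored, the credit [cB * Z] is
     released, where [Z] is at least [lv m x]. *)
  have h1 : lv m x * PhiX ins' m' stamp q y <= lv m x * (Px + cB * Z).
    by rewrite leq_mul2l; apply/orP; right; apply: (leq_trans Py); rewrite leq_add2l leq_mul2l Tx orbT.
  have h2 : lv m y * (cB * lv m x) <= lv m y * (cB * Z) by rewrite !leq_mul2l hit !orbT.
  (* With these weights both recoloring costs equal [cQ * lv m x * lv m y]. The released credit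
     occurs with weight [lv m y] only and must cover both, hence the factor two. *)
  have cBQ : cB = cQ + cQ by rewrite /cB /cQ; lia.
  move: h1 h2; rewrite {2}cBQ.
  clear Py P cBQ; move: (PhiX _ _ _ _ y) Px (cB * Z) cQ => a b c cq; nia.
case: (leqP (stamp u) (stamp v)) => h.
  have := main v u (or_intror erefl); rewrite /matching cuv eqxx h uv => /(_ isT); lia.
have := main u v (or_introl erefl); rewrite /matching cuv eqxx (ltnW h) eq_sym uv => /(_ isT); lia.
Qed.

End Insert.
End Pot.

(** * The palette *)

Lemma deg_size n (g : graph) v : deg n g v = size [seq u <- iota 0 n | g v u].
Proof.
rewrite /deg -(big_mkord xpredT (fun u => nat_of_bool (g v u))) /index_iota subn0.
rewrite size_filter -sum1_count [RHS]big_mkcond.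
by apply: eq_bigr => u _; case: (g v u).
Qed.

Section Palette.
Variables n D S : nat.
Local Notation Inv := (Inv n D S).
Local Notation TS := (TS n).

Record Sampling (g : graph) v i ts m : Prop := MkSampling {
  sa_inv : Inv (gminus g v ts) m;
  sa_ts : TS g v ts m;
  sa_mem : forall u, u < n -> g v u -> (u \in ts) = (lv m u <= i);
  sa_lv : lv m v = i;
  sa_pow : exists j, i = 2 ^ j;
  sa_size : size ts < 2 * i;
  sa_low : i = 1 \/ i <= count (fun u => lv m u < i) ts }.

Variables (g : graph) (v i : nat) (ts : seq nat) (m : mem4).
Hypothesis girr : forall x, g x x = false.
Hypothesis vn : v < n.
Hypothesis degD : deg n g v <= D.
Hypothesis sa : Sampling g v i ts m.

Let F := D.+1 - cnt m v 0.
Let f a := pg m v 0 (cnt m v 0 + a).+1.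

Lemma above_in_nbrs c : 0 < hc m v c ->
  c \in [seq col m u | u <- [seq u <- iota 0 n | gminus g v ts v u]].
Proof.
rewrite (i_hc (sa_inv sa)) // /above lt0n => /negP h; apply/negPn/negP => nc; apply: h.
rewrite sum_nat_eq0; apply/forallP => u; apply/implyP => _; rewrite eqb0; apply/negP.
move=> /andP[/andP[gu _] /eqP cu]; case/negP: nc; rewrite -cu; apply: map_f.
by rewrite mem_filter gu mem_iota /=.
Qed.

(** Every color used above [v] belongs to a neighbor still in the tables, and those neighbors are
    disjoint from the stacked ones. *)
Lemma used_le_deg : size ts + cnt m v 0 <= deg n g v.
Proof.
have ok := i_ok (sa_inv sa) 0 vn; have cU := sok_cnt ok.
pose ns := [seq u <- iota 0 n | gminus g v ts v u].
have c1 : cnt m v 0 <= size ns.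
  rewrite -[cnt m v 0](size_iota 1) -(size_map (pg m v 0) (iota 1 _)) -(size_map (col m) ns).
  have inj : {in iota 1 (cnt m v 0) &, injective (pg m v 0)}.
    move=> x y; rewrite !mem_iota => hx hy E.
    have [_ qx] := sok_p ok (i := x) ltac:(lia).
    have [_ qy] := sok_p ok (i := y) ltac:(lia).
    by rewrite -qx E.
  have un : uniq [seq pg m v 0 j | j <- iota 1 (cnt m v 0)].
    by rewrite (map_inj_in_uniq inj) iota_uniq.
  apply: uniq_leq_size; first exact: un.
  move=> c /mapP [j]; rewrite mem_iota => hj ->; apply: above_in_nbrs.
  have [hp qp] := sok_p ok (i := j) ltac:(lia).
  by rewrite -(i_sm0 (sa_inv sa)) // /sm qp; lia.
apply: leq_trans (leq_add (leqnn _) c1) _; rewrite deg_size -size_cat; apply: uniq_leq_size.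
  rewrite cat_uniq (ts_uniq (sa_ts sa)) filter_uniq ?iota_uniq // andbT.
  apply/hasPn => u; rewrite mem_filter /gminus eqxx /= negb_or -!andbA => /and4P[_ nu _ _].
  by [].
move=> u; rewrite mem_cat !mem_filter !mem_iota /= => /orP[/(ts_mem (sa_ts sa)) [-> ->] //|].
by rewrite /gminus => /andP[/andP[-> _] ->].
Qed.

Lemma palette_inj : {in gtn F &, injective f}.
Proof.
move=> a b; rewrite !inE /F => ha hb E.
have ok := i_ok (sa_inv sa) 0 vn.
have [_ qa] := sok_p ok (i := (cnt m v 0 + a).+1) ltac:(rewrite /usize /=; lia).
have [_ qb] := sok_p ok (i := (cnt m v 0 + b).+1) ltac:(rewrite /usize /=; lia).
by move: qa; rewrite -/(f a) E /f qb; lia.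
Qed.

Lemma palette_free a : a < F -> 1 <= f a <= D.+1 /\ hc m v (f a) = 0.
Proof.
rewrite /F => ha; have ok := i_ok (sa_inv sa) 0 vn.
have [hp qa] := sok_p ok (i := (cnt m v 0 + a).+1) ltac:(rewrite /usize /=; lia).
split=> //; have := i_sm0 (sa_inv sa) vn hp; rewrite /sm qa -/(f a).
by case: (hc m v (f a)) => // h; lia.
Qed.

Lemma palette_size : size ts < F.
Proof. by rewrite /F; have := used_le_deg; lia. Qed.

Lemma level_pos : 0 < i.
Proof. by case: (sa_pow sa) => j ->; rewrite expn_gt0. Qed.

Lemma low_le_size : i = 1 \/ i <= size ts.
Proof. by case: (sa_low sa) => h; [left|right]; rewrite // (leq_trans h) // count_size. Qed.

Lemma level_le_palette : i <= F.
Proof. by have := palette_size; case: low_le_size => h; lia. Qed.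

(** A rejected color has score at least 2, while all scores sum to at most [2 * size ts] minus the
    number of lower neighbors. For [i > 1] more than half of the stack is lower, so the sum is at
    most [3/2 * size ts], and [size ts < F]. For [i = 1] the stack has at most one vertex. *)
Lemma bad_colors : 4 * \sum_(a < F) (1 < score m i ts (f a)) <= 3 * F.
Proof.
have H : 2 * \sum_(a < F) (1 < score m i ts (f a)) <= \sum_(a < F) score m i ts (f a).
  rewrite big_distrr /=; apply: leq_sum => a _.
  by case: (ltnP 1 (score m i ts (f a))) => h; rewrite ?muln1 ?muln0.
have s := score_sum m i ts palette_inj; have p := palette_size; have z := sa_size sa.
have i0 := level_pos.
case: (sa_low sa) => h; first by lia.
by lia.
Qed.

Lemma score_nbr x c : x \in ts -> col m x = c -> match_score m i c x <= score m i ts c /\ 0 < match_score m i c x.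
Proof.
move=> xt xc; split; first by rewrite /score (big_rem x xt) /= leq_addr.
by rewrite /match_score xc eqxx; case: ifP.
Qed.

Lemma score_two x y c : x \in ts -> y \in ts -> x != y -> col m x = c -> col m y = c ->
  1 < score m i ts c.
Proof.
move=> xt yt xy xc yc; rewrite /score (big_rem x xt) /=.
have yr : y \in rem x ts by rewrite (mem_rem_uniq x (ts_uniq (sa_ts sa))) !inE eq_sym xy.
rewrite (big_rem y yr) /= /match_score xc yc eqxx.
by case: ifP; case: ifP; lia.
Qed.

(** A palette color does not occur among the higher neighbors, so every conflict of the new color is
    on the stack and visible to the scan. *)
Lemma free_not_above a x : a < F -> x < n -> g v x -> col m x = f a -> x \in ts.
Proof.
move=> ha xn gvx cx; have [_ h0] := palette_free ha; apply/negPn/negP => nx.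
move: h0; rewrite (i_hc (sa_inv sa)) // => /eqP; rewrite /above sum_nat_eq0 => /forallP /(_ (Ordinal xn)) /=.
rewrite eqb0 cx eqxx andbT => /negP; apply.
have vx : (x == v) = false by apply/eqP => E; rewrite E girr in gvx.
rewrite /gminus gvx eqxx (negbTE nx) vx /=.
by move: nx; rewrite (sa_mem sa) // (sa_lv sa); lia.
Qed.

End Palette.

(** * The complete program *)

Section Glue.
Variables n D S W : nat.
Hypothesis SE : S = n + D + 16.
Hypothesis SW : 4 * S <= W.
Local Notation wp := (wp S W).
Local Notation regs_ok := (regs_ok n D S).
Local Notation Inv := (Inv n D S).

Lemma dispatch_spec b g r m Q : regs_ok r -> r 0 = (if b then 1 else 2) ->
  Inv g m -> r 1 < n -> r 2 < n -> r 1 != r 2 -> g (r 1) (r 2) = ~~ b ->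
  (forall r' m' k, eqr [:: 25, 32, 33 & edge_regs] r r' ->
    Inv (setE g (r 1) (r 2) b) m' ->
    (forall x, lv m' x = lv m x) -> (forall x, col m' x = col m x) ->
    r' 32 = (b && (col m (r 1) == col m (r 2))) ->
    (b -> r' 13 = lv m (r 1) /\ r' 33 = lv m (r 1) + lv m (r 2)) ->
    k <= 400 -> Q (MkSt r' m') k) -> wp dispatch_cmd (MkSt r m) Q.
Proof.
move=> rok r0 I un vn uv guv H; have [r10 r11 o r29 z] := rok.
apply: wpSeq; apply: (wpAdd (v := 2)); [lia|by rewrite o|].
set r1 := upd _ _ _; have q1 : eqr [:: 25] r r1 by exact: eqr_upd.
have rok1 : regs_ok r1 by exact: regs_ok_eqr rok q1 _.
have r11' : r1 1 = r 1 by rewrite q1.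
have r12 : r1 2 = r 2 by rewrite q1.
have lu := i_lvS I un; have lv' := i_lvS I vn.
apply: (wpIf (va := r 0) (vb := 2)); [by rewrite q1|by []|move=> lt|move=> ge].
- case: b r0 guv H => [r0|r0]; last by rewrite r0 in lt.
  move=> guv H.
  apply: wpSeq; apply: (edge_spec SE SW rok1 I); rewrite ?r11' ?r12 //.
  move=> r2 m2 k2 q2 [e13 e14 e15 e16] I2 fr2 hk2.
  have q02 := eqr_tr q1 q2 (L := [:: 25, 32, 33 & edge_regs]) isT.
  have r230 : r2 30 = 0 by rewrite q02.
  have r226 : r2 26 = 1 by rewrite q02.
  apply: wpSeq; apply: (wpAdd (v := lv m (r 1) + lv m (r 2))); [lia|by rewrite e13 e14|].
  apply: wpSeq; apply: (wpAdd (v := 0)); [lia|by rewrite /upd /= r230|].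
  set r3 := upd _ _ _; have q3 : eqr [:: 32; 33] r2 r3 by do 2 (apply: eqr_upd; last by []).
  have q03 := eqr_tr q02 q3 (L := [:: 25, 32, 33 & edge_regs]) isT.
  have fin r4 k4 : k4 <= 10 -> eqr [:: 9; 32] r3 r4 -> r4 32 = (col m (r 1) == col m (r 2)) ->
     Q (MkSt r4 m2) (1 + (k2 + (1 + (1 + k4)))).+1.
    move=> hk4 q4 e32; apply: H => //.
    - exact: (eqr_tr q03 q4).
    - by move=> x; rewrite /lv fr2.
    - by move=> x; rewrite /col fr2.
    - by move=> _; rewrite !q4 //; split=> //; rewrite q3.
    - lia.
  apply: (wpIf (va := col m (r 1)) (vb := col m (r 2))); [by rewrite q3|by rewrite q3|move=> l1|move=> g1].
    apply: wpSub; first by [].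
    apply: (fin _ 2) => //; first exact: eqr_upd.
    by rewrite ltn_eqF.
  apply: (wpIf (va := col m (r 2)) (vb := col m (r 1))); [by rewrite q3|by rewrite q3|move=> l2|move=> g2].
    apply: wpSub; first by [].
    apply: (fin _ 4) => //; first exact: eqr_upd.
    by rewrite gtn_eqF.
  apply: (wpAdd (v := 1)); [lia|by rewrite !q3 // r226 r230|].
  apply: (fin _ 5) => //; first exact: eqr_upd.
  by rewrite eqn_leq g1 g2.
- case: b r0 guv H => [r0|r0]; first by rewrite r0 in ge.
  move=> guv H.
  apply: wpSeq; apply: (edge_spec SE SW rok1 I); rewrite ?r11' ?r12 //.
  move=> r2 m2 k2 q2 [e13 e14 e15 e16] I2 fr2 hk2.
  have q02 := eqr_tr q1 q2 (L := [:: 25, 32, 33 & edge_regs]) isT.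
  apply: (wpAdd (v := 0)); [lia|by rewrite q02 // z|].
  apply: H => //.
  - exact: eqr_upd.
  - by move=> x; rewrite /lv fr2.
  - by move=> x; rewrite /col fr2.
  - lia.
Qed.

Lemma pick_spec r m Q : regs_ok r -> r 1 < S ->
  (forall r' k, eqr [:: 2; 9] r r' -> r' 2 = (if r 36 < r 13 then r 2 else r 1) ->
    k <= 3 -> Q (MkSt r' m) k) -> wp pick_cmd (MkSt r m) Q.
Proof.
move=> rok r1 H; have [r10 r11 o r29 z] := rok.
apply: (wpIf (va := r 36) (vb := r 13)); [by []|by []|move=> lt|move=> ge].
  apply: wpSub; first by [].
  by apply: H => //; [exact: eqr_upd|rewrite lt].
apply: (wpAdd (v := r 1)); [lia|by rewrite z addn0|].
by apply: H => //; [exact: eqr_upd|rewrite ltnNge ge].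
Qed.

(** Only colors and levels are initialized; the zero cells of all other tables are valid empty sets.
    This keeps the preprocessing linear in [n]. *)
Lemma prep_spec r Q : r 10 = n -> r 11 = D -> r 29 = S -> r 30 = 0 ->
  (forall r' m' k, regs_ok r' -> Inv empty_graph m' ->
    (forall v, v < n -> lv m' v = 1) -> (forall v, v < n -> col m' v = 1) ->
    k <= 20 * n + 10 -> Q (MkSt r' m') k) ->
  wp prep_cmd (MkSt r (fun _ _ _ _ => 0)) Q.
Proof.
move=> r10 r11 r29 z H.
apply: wpSeq; apply: wpConst; first lia.
apply: wpSeq; apply: (wpAdd (v := 0)); [lia|by rewrite /upd /= z|].
pose J k c (s : state) := exists j, [/\ regs_ok (rg s), rg s 31 = j, j <= n,
  forall t x y u, mm s t x y u = [&& t < 2, x == 0, y == 0 & u < j] &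
  n - j <= k /\ c <= 20 * j + 2].
apply: (wp_while (I := J) (N := n)).
- exists 0; split=> //; last by rewrite subn0.
  by move=> t x y u; rewrite !andbF.
- move=> k c [r1 m1] [j [rok1 e31 jn m1E [k1 c1]]].
  rewrite [rg _]/= in rok1 e31; rewrite [mm _]/= in m1E.
  have [h10 h11 o h29 h30] := rok1.
  rewrite -[rg _ 31]/(r1 31) -[rg _ 10]/(r1 10) e31 h10 => jlt.
  exists k.-1; split; first by lia.
  apply: wpSeq; apply: (wpSt (vx := 0) (vy := 0) (vz := j) (v := 1));
    [> by [] | by [] | by [] | by [] | lia | lia | lia | idtac].
  apply: wpSeq; apply: (wpSt (vx := 0) (vy := 0) (vz := j) (v := 1));
    [> by [] | by [] | by [] | by [] | lia | lia | lia | idtac].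
  apply: (wpAdd (v := j.+1)); [lia|by rewrite e31 o addn1|].
  exists j.+1; split=> //.
  + move=> t x y u; rewrite [mm _]/= /set4 !m1E [u < j.+1]ltnS [u <= j]leq_eqVlt.
    by case: t => [|[|t]] //=; case: (x == 0) => //=; case: (y == 0) => //=; case: (u == j).
  + by lia.
- move=> k c [r1 m1] [j [rok1 e31 jn m1E [k1 c1]]].
  rewrite [rg _]/= in rok1 e31; rewrite [mm _]/= in m1E.
  have [h10 h11 o h29 h30] := rok1.
  rewrite -[rg _ 31]/(r1 31) -[rg _ 10]/(r1 10) e31 h10 -leqNgt => jge.
  have jE : j = n by lia.
  rewrite jE in m1E.
  have lvE v : v < n -> lv m1 v = 1 by rewrite /lv m1E /= => ->.
  have colE v : v < n -> col m1 v = 1 by rewrite /col m1E /= => ->.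
  have cntE x y : cnt m1 x y = 0 by rewrite /cnt m1E.
  have pgE x y i : pg m1 x y i = i by rewrite /pg m1E.
  have qgE x y i : qg m1 x y i = i by rewrite /qg m1E.
  have hcE x c' : hc m1 x c' = 0 by rewrite /hc m1E.
  apply: (H r1 m1) => //; last by lia.
  split=> //.
  + by move=> x y xn; split; [rewrite cntE|move=> i; rewrite pgE qgE|move=> e; rewrite qgE pgE].
  + by move=> x u y *; rewrite /sm qgE cntE.
  + by move=> x c' xn; rewrite hcE /above big1.
  + by move=> x c' xn /andP[c0 _]; rewrite /sm qgE cntE hcE; case: (c') c0.
  + by move=> x xn; exists 0; rewrite lvE.
  + by move=> x xn; rewrite lvE //; lia.
  + by move=> x xn; rewrite colE.
Qed.

End Glue.

(** * Safety and expected cost of machine runs *)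

Section Cost.
Variables (w : nat) (P : seq instr) (n D : nat) (s : seq update).
Local Notation step := (Defs.step w P).
Local Notation at_read := (Defs.at_read P).

Definition Good c := (step c = [::] -> at_read c /\ inp c = [::]) /\
  (at_read c -> 1 <= ndone c -> proper_coloring n D (graph_of (take (ndone c) s)) (memory c)).

Fixpoint safe (f : nat) (c : config) : Prop :=
  if f is f'.+1 then Good c /\ forall c', List.In c' (step c) -> safe f' c' else True.

Definition ec (p : nat -> bool) := ecost w P (fun c => p (ndone c)).

(** Budgets are natural numbers and averaging is confined to [OK_rand], so the potential argument
    never leaves [nat]. Fixing the fuel also makes unbounded rejection loops accessible to
    induction. *)
Definition OK p f c (b : nat) := safe f c /\ (ec p f c <= b%:R)%R.

Lemma OK0 p c b : OK p 0 c b.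
Proof. by split=> //; rewrite /ec /= ler0n. Qed.

Lemma OK_le p f c b b' : b <= b' -> OK p f c b -> OK p f c b'.
Proof. by move=> h [h1 h2]; split=> //; apply: le_trans h2 _; rewrite ler_nat. Qed.

Lemma OK_one p f c c' b : Good c -> step c = [:: c'] -> OK p f c' b ->
  OK p f.+1 c (b + p (ndone c)).
Proof.
move=> G E [h1 h2]; split.
  by split=> // c''; rewrite E => -[<-|[]].
rewrite /ec /= E big_seq1 divr1 natrD addrC lerD2r; exact: h2.
Qed.

Lemma OK_dsteps p k f c c' b : dsteps w P k c c' -> OK p (f - k) c' b ->
  OK p f c (b + k * p (ndone c)).
Proof.
move=> H; elim: H f b => {k c c'} [c|k c c1 c2 [E1 E2 E3 E4] _ IH] f b h.
  by rewrite subn0 in h; rewrite mul0n addn0.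
case: f h => [|f] h; first exact: OK0.
rewrite subSS in h; have := IH f b h; rewrite E4 => H.
have G : Good c by split; rewrite ?E1 // (negbTE E2).
by have := OK_one G E1 H; apply: OK_le; lia.
Qed.

Lemma in_map_iota (f : nat -> config) N c' :
  List.In c' [seq f i | i <- iota 0 N] -> exists2 i, i < N & c' = f i.
Proof.
have gen k : List.In c' [seq f i | i <- iota k N] -> exists2 i, i < k + N & c' = f i.
  elim: N k => [|N IH] k //= [<-|/IH [i hi ->]]; first by exists k => //; lia.
  by exists i => //; lia.
by move/gen.
Qed.

Lemma OK_rand p f c d a N (B : nat -> nat) X : pc c < size P -> nth IRead P (pc c) = IRand d a ->
  reg c a = N -> 0 < N -> (forall i, i < N -> OK p f (setreg w c d i) (B i)) ->
  \sum_(i < N) B i <= N * X -> OK p f.+1 c (X + p (ndone c)).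
Proof.
move=> h1 h2 h3 N0 H sB.
have E : step c = [seq setreg w c d i | i <- iota 0 N].
  by rewrite /Defs.step h1 h2 h3; case: eqP => // E; rewrite E in N0.
have G : Good c.
  split; first by rewrite E; case: (N) N0.
  by rewrite /Defs.at_read h1 h2.
split.
  split=> // c'; rewrite E => /in_map_iota [i iN ->].
  by case: (H i iN).
rewrite /ec /= E natrD [leRHS]addrC.
case EN: [seq setreg w c d i | i <- iota 0 N] => [|c1 cs].
  by rewrite addr_ge0 ?ler0n.
rewrite -EN size_map size_iota lerD2l ler_pdivrMr ?ltr0n //.
rewrite big_map -{1}[N]subn0 -/(index_iota 0 N) big_mkord.
apply: (@le_trans _ _ ((\sum_(i < N) B i)%:R)%R); last by rewrite -natrM ler_nat mulnC.
by rewrite natr_sum; apply: ler_sum => i _; case: (H i (ltn_ord i)).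
Qed.

Lemma OK_halt p f c : Good c -> step c = [::] -> OK p f c 0.
Proof.
move=> G E; case: f => [|f]; first exact: OK0.
by split; [split=> //; rewrite E|rewrite /ec /= E].
Qed.

Lemma step_ndone c c' : List.In c' (step c) -> ndone c <= ndone c'.
Proof.
rewrite /Defs.step; case: ifP => // _; case: (nth _ _ _) => [d k|d a b|d a b|d a b|d a b|d a|a r|a l|a b l|d a|] /=;
  try by case=> [<-|[]].
  case: ifP => _; first by case=> [<-|[]].
  by move/in_map_iota => [i _ ->].
by case: (inp c) => [|up rest] //=; case: up => x y /= [<-|[]] //=; lia.
Qed.

(** [ndone] never decreases, so after the first read no step counts as preprocessing. *)
Lemma ec0_zero f c : 0 < ndone c -> ec (fun k => k == 0) f c = 0%R.
Proof.
elim: f c => [|f IH] c h //; rewrite /ec /=.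
case E: (step c) => [|c1 cs] //; rewrite -E gtn_eqF // add0r.
suff -> : (\sum_(c' <- step c) ecost w P (fun c0 => ndone c0 == 0) f c')%R = 0%R by rewrite mul0r.
have : forall c', List.In c' (step c) -> 0 < ndone c' by move=> c' /step_ndone; lia.
elim: (step c) => [|c2 l IHl] H; first by rewrite big_nil.
rewrite big_cons -[ecost _ _ _ f c2]/(ec (fun k => k == 0) f c2) IH ?add0r; last by apply: H; left.
by apply: IHl => c' hc'; apply: H; right.
Qed.

Lemma safe_reach c c' : reachable w P c c' -> (forall f, safe f c) -> Good c'.
Proof.
elim=> [c1 H|c1 c2 c3 hin _ IH H]; first by case: (H 1).
by apply: IH => f; case: (H f.+1) => _; apply.
Qed.

End Cost.

(** * Layout of the program *)

Definition boot :=
  [:: IAdd 10 0 30; IAdd 11 1 30; IConst 28 16; IAdd 29 10 11; IAdd 29 29 28].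

Definition pc_read := 5 + csize prep_cmd.
Definition pc_dispatch := pc_read.+1.
Definition pc_test := pc_dispatch + csize dispatch_cmd.
Definition pc_pick := pc_test.+2.
Definition pc_recolor := pc_pick + csize pick_cmd.
Definition pc_sample := pc_recolor + csize lift_cmd.
Definition pc_accept := pc_sample.+1 + csize scan_cmd.
Definition pc_next := pc_accept.+1 + csize finish_cmd.

(** [IRand 36 33] draws below the sum of the levels of two conflicting endpoints, [IRand 36 35]
    below the palette size. The jump to [pc_sample] rejects a color of score above 1; the one to
    [pc_recolor] continues with the single neighbor in conflict. *)
Definition program : seq instr :=
  boot ++ compile 5 prep_cmd ++ [:: IRead] ++ compile pc_dispatch dispatch_cmd ++
  [:: IJz 32 pc_read; IRand 36 33] ++ compile pc_pick pick_cmd ++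
  compile pc_recolor lift_cmd ++ [:: IRand 36 35] ++ compile pc_sample.+1 scan_cmd ++
  [:: IJlt 26 23 pc_sample] ++ compile pc_accept.+1 finish_cmd ++
  [:: IJlt 30 23 pc_recolor; IJz 30 pc_read].

(* Locked, because unification would otherwise expand the whole program. *)
Definition prog := locked program.

Definition code := code_at prog.

Lemma prog_code :
  [/\ code 0 boot, code 5 (compile 5 prep_cmd), code pc_read [:: IRead] &
  [/\ code pc_dispatch (compile pc_dispatch dispatch_cmd),
      code pc_test [:: IJz 32 pc_read; IRand 36 33],
      code pc_pick (compile pc_pick pick_cmd) & code pc_recolor (compile pc_recolor lift_cmd)] /\
  [/\ code pc_sample [:: IRand 36 35], code pc_sample.+1 (compile pc_sample.+1 scan_cmd),
      code pc_accept [:: IJlt 26 23 pc_sample],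
      code pc_accept.+1 (compile pc_accept.+1 finish_cmd) &
      code pc_next [:: IJlt 30 23 pc_recolor; IJz 30 pc_read]]].
Proof.
have H : code 0 program by exists [::], [::]; rewrite cats0 /prog -lock.
rewrite /program in H.
have [c1 {}H] := code_at_cat H; rewrite -[0 + size boot]/5 in H.
have [c2 {}H] := code_at_cat H; rewrite size_compile -/pc_read in H.
have [c3 {}H] := code_at_cat H; rewrite addn1 -/pc_dispatch in H.
have [c4 {}H] := code_at_cat H; rewrite size_compile -/pc_test in H.
have [c5 {}H] := code_at_cat H; rewrite [size [:: _; _]]/= addn2 -/pc_pick in H.
have [c6 {}H] := code_at_cat H; rewrite size_compile -/pc_recolor in H.
have [c7 {}H] := code_at_cat H; rewrite size_compile -/pc_sample in H.
have [c8 {}H] := code_at_cat H; rewrite addn1 in H.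
have [c9 {}H] := code_at_cat H; rewrite size_compile -/pc_accept in H.
have [c10 {}H] := code_at_cat H; rewrite addn1 in H.
have [c11 {}H] := code_at_cat H; rewrite size_compile -/pc_next in H.
by split=> //; split.
Qed.

Lemma code_size l c : code l c -> 0 < size c -> l < size prog.
Proof. by case=> A [B [E <-]] h; rewrite E !size_cat; lia. Qed.

Lemma is_pairP u v x y : is_pair u v x y -> (x, y) = (u, v) \/ (x, y) = (v, u).
Proof. by move=> /orP[] /andP[/eqP -> /eqP ->]; [left|right]. Qed.

Section Input.
Variables (n D : nat) (s : seq update).
Hypothesis valid : valid_seq n D s.
Let g k := graph_of (take k s).

Lemma graphS k : k < size s -> g k.+1 = apply_update (g k) (nth (Ins 0 0) s k).
Proof. by move=> h; rewrite /g (take_nth (Ins 0 0)) // /graph_of -cats1 foldl_cat. Qed.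

Lemma graph_sym k x y : g k x y = g k y x.
Proof.
rewrite /g; elim/last_ind: (take k s) => [|l up IH] //.
rewrite /graph_of -cats1 foldl_cat /= -/(graph_of l).
by case: up => u v /=; rewrite IH is_pair_sym.
Qed.

Lemma graph_irr k x : g k x x = false.
Proof.
elim: k => [|k IH]; first by rewrite /g take0.
case: (ltnP k (size s)) => h; last by move: IH; rewrite /g !take_oversize //; lia.
rewrite graphS //; have [+ _] := valid h; rewrite -/(g k).
case: (nth _ s k) => u v /= /and4P[_ _ uv _]; rewrite IH //=.
by apply/negbTE/negP => /is_pairP [[-> E]|[-> E]]; rewrite E eqxx in uv.
Qed.

Lemma graph_deg k v : k <= size s -> v < n -> deg n (g k) v <= D.
Proof.
case: k => [|k] hk vn; first by rewrite /g take0 /deg big1.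
by have [_] := valid hk; apply.
Qed.

End Input.

(** * The amortized analysis of a run *)

Section Run.
Variables (cW : nat).
Hypothesis cWb : 4200 <= cW.
Variables (w n D S : nat) (s : seq update).
Hypothesis SE : S = n + D + 16.
Hypothesis SW4 : S ^ 4 <= 2 ^ w.
Hypothesis valid : valid_seq n D s.

Local Notation W := (2 ^ w).
Local Notation P := prog.
Local Notation regs_ok := (regs_ok n D S).
Local Notation Inv := (Inv n D S).
Local Notation Rel := (Rel w S).
Local Notation OK := (OK w P n D s).
Local Notation Good := (Good w P n D s).
Local Notation counted := (fun k => 1 <= k).
Local Notation g k := (graph_of (take k s)).

Lemma S16 : 16 <= S. Proof. by rewrite SE leq_addl. Qed.

Lemma SW : 4 * S <= W.
Proof.
apply: leq_trans SW4; have h := S16; rewrite (expnS S 3) mulnC leq_mul2l; apply/orP; right.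
by apply: (@leq_trans (S ^ 1)); [rewrite expn1; lia|rewrite leq_pexp2l //; lia].
Qed.

(** [ins] counts insertions and exists only in the analysis; it is not lowered by deletions and so
    keeps bounding the degree. *)
Record State (k : nat) (ins : nat -> nat) (r : nat -> nat) (m : mem4) (c : config) : Prop :=
  MkState {
  s_rel : Rel c (MkSt r m);
  s_regs : regs_ok r;
  s_inp : inp c = drop k s;
  s_done : ndone c = k;
  s_k : 0 < k <= size s;
  s_deg : forall v, v < n -> deg n (g k) v <= ins v }.

Definition proper_off (A : pred nat) k m := forall a b, a < n -> b < n -> ~~ A a -> ~~ A b ->
  g k a b -> col m a != col m b.

Definition low_levels (ins : nat -> nat) m := forall v, v < n -> lv m v <= (ins v).+1.

Definition ReadOK f := forall k ins stamp r m c,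
  State k ins r m c -> pc c = pc_read -> Inv (g k) m -> low_levels ins m ->
  proper_off pred0 k m ->
  OK counted f c (Phi cW n ins m stamp (drop k s)).

Definition RecolorOK f := forall k ins stamp r m c v,
  State k ins r m c -> pc c = pc_recolor -> Inv (g k) m -> low_levels ins m ->
  r 2 = v -> v < n -> proper_off (pred1 v) k m ->
  OK counted f c (PhiX cW n ins m stamp (drop k s) v + cQ cW * lv m v).

(** The first bracket is the cost after acceptance: [722 * i] steps and the budget of the next
    vertex. The second covers the expected attempts and the expected threat of the accepted
    color. *)
Definition SampleOK f := forall k ins stamp r m c v i ts,
  State k ins r m c -> pc c = pc_sample -> Sampling n D S (g k) v i ts m -> low_levels ins m ->
  r 2 = v -> v < n -> r 18 = size ts -> r 19 = i -> r 34 = cnt m v 0 ->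
  r 35 = D.+1 - cnt m v 0 -> proper_off (pred1 v) k m ->
  OK counted f c (PhiX cW n ins m stamp (drop k s) v +
     (722 * i + 4 * cW * i) + (448 * i + 2 * cW * i)).

Lemma State_rel k ins r m c r' m' c' : State k ins r m c -> Rel c' (MkSt r' m') ->
  regs_ok r' -> inp c' = inp c -> ndone c' = ndone c -> State k ins r' m' c'.
Proof. by case=> *; split=> //; congruence. Qed.

Lemma run_cmd c l k ins r m conf f b Q : State k ins r m conf -> wf c -> code l (compile l c) ->
  pc conf = l -> wp S W c (MkSt r m) Q ->
  (forall r' m' kk conf', Q (MkSt r' m') kk -> pc conf' = l + csize c ->
     (regs_ok r' -> State k ins r' m' conf') -> Rel conf' (MkSt r' m') ->
     exists b', b' + kk <= b /\ OK counted (f - kk) conf' b') ->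
  OK counted f conf b.
Proof.
move=> st hwf hc hp hw H.
have [[r' m'] [kk [conf' [Q' D' R' p']]]] := wp_sound S16 SW4 hwf hc hp (s_rel st) hw.
have [Ei En] := dsteps_inp D'.
have [|b' [hb O]] := H r' m' kk conf' Q' p' _ R'.
  by move=> rok; apply: State_rel st R' rok Ei En.
have := OK_dsteps D' O; rewrite (s_done st) => H'; apply: OK_le H'.
by case/andP: (s_k st) => -> _; rewrite muln1.
Qed.

Lemma jump_ok k ins r m c i b l f B : State k ins r m c -> pc c < size P ->
  nth IRead P (pc c) = i ->
  (if i is IJz a l' then b = (r a == 0) /\ l' = l /\ a != 28
   else if i is IJlt a a' l' then [/\ b = (r a < r a'), l' = l, a != 28 & a' != 28] else False) ->
  (forall c', State k ins r m c' -> pc c' = (if b then l else (pc c).+1) -> OK counted f.-1 c' B) ->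
  OK counted f c B.+1.
Proof.
move=> st h1 h2 h3 H; case: f H => [|f] H; first exact: OK0.
have J : dstep w P c (jump c b l).
  apply: (@jump_dstep w prog c b l i) => //.
    by move=> a l' E; move: h3; rewrite E => -[-> [-> a28]]; rewrite (relR (s_rel st)).
  by case: i h3 {h2} => // a a' l' [-> -> a28 a28']; rewrite !(relR (s_rel st)).
have st' : State k ins r m (jump c b l).
  by apply: (State_rel st) => //; [exact: Rel_pc (s_rel st) _ _|exact: (s_regs st)].
have := OK_dsteps (dsteps1 J) (f := f.+1) (b := B) (p := counted); rewrite subn1 => /(_ n D s).
move=> HH; apply: OK_le (HH _); last exact: H.
by rewrite (s_done st); case/andP: (s_k st) => -> _; rewrite mul1n addn1.
Qed.

(** Write [Z = 448 * k + 2 * cW * k]. An attempt costs [111 * k] and, with probability at most 3/4,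
    [Z] again; the threat averages at most [k / 32], worth [cW * k / 2]. Since
    [3/4 * Z + 111 * k + cW * k / 2 = Z - k], the budget reproduces itself, which is how [Z] is
    chosen; the 1 taken off pays for the draw. *)
Lemma sample_sum F k X0 (bad : nat -> bool) (tau : nat -> nat) :
  0 < k -> k <= F -> 4 * \sum_(a < F) bad a <= 3 * F -> 32 * \sum_(a < F) tau a <= k * k ->
  \sum_(a < F) (111 * k + X0 + (if bad a then 448 * k + 2 * cW * k else cB cW * tau a))
    <= F * (X0 + (448 * k + 2 * cW * k)).-1.
Proof.
move=> k0 kF h1 h2; set Z := 448 * k + 2 * cW * k.
apply: (@leq_trans (\sum_(a < F) (111 * k + X0) + (\sum_(a < F) Z * bad a + \sum_(a < F) cB cW * tau a))).
  rewrite -!big_split /=; apply: leq_sum => a _; rewrite leq_add2l.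
  by case: (bad a); rewrite ?muln1 ?leq_addr // leq_addl.
rewrite sum_nat_const card_ord -!big_distrr /=.
move: h1 h2; set nb := \sum_(a < F) _; set T := \sum_(a < F) _ => h1 h2.
have e1 : 4 * (Z * nb) <= Z * (3 * F) by rewrite mulnCA leq_mul2l h1 orbT.
have e2 : 32 * T <= k * F by apply: leq_trans h2 _; rewrite leq_mul2l kF orbT.
have e3 : 4 * (cB cW * T) <= 2 * cW * (k * F).
  have -> : 4 * (cB cW * T) = 2 * cW * (32 * T) by rewrite /cB; lia.
  by rewrite leq_mul2l e2 orbT.
have Z0 : 0 < Z by rewrite /Z; lia.
have e4 : F * Z = 448 * (k * F) + 2 * cW * (k * F) by rewrite /Z mulnDr; lia.
have -> : F * (X0 + Z).-1 = F * X0 + F * Z - F by rewrite -subn1 mulnBr muln1 mulnDr.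
have e5 : F * (111 * k + X0) = 111 * (k * F) + F * X0 by lia.
have e6 : F <= k * F by rewrite leq_pmull.
have e7 : Z * (3 * F) = 3 * (F * Z) by lia.
rewrite e5; move: (F * X0) (Z * nb) (cB cW * T) (F * Z) (2 * cW * (k * F)) (k * F) e1 e3 e4 e6 e7 => *.
lia.
Qed.

Lemma low_levels_eq ins m m' : (forall x, lv m' x = lv m x) -> low_levels ins m -> low_levels ins m'.
Proof. by move=> E H x xn; rewrite E; apply: H. Qed.

Lemma Phi_recolor ins m m' stamp q v c : v < n -> (forall x, lv m' x = lv m x) ->
  (forall x, col m' x = if x == v then c else col m x) ->
  Phi cW n ins m' (newstamp n stamp v) q <= PhiX cW n ins m stamp q v +
    cB cW * threat (fun u => (col m u == c) && (u != v)) (lv m v) (partners v q).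
Proof.
move=> vn El Ec; rewrite (Phi_split _ _ _ _ _ vn); apply: leq_add.
  rewrite /PhiX /PotA El leq_add2r leq_add2r; apply: Rest_recolor => // x xv.
  by rewrite Ec (negbTE xv).
rewrite leq_mul2l -El; apply/orP; right; apply: Th_recolor; last by rewrite Ec eqxx.
by move=> u uv; rewrite Ec (negbTE uv).
Qed.

Lemma child_cost l i : 2 * l <= i -> cQ cW * l <= 4 * cW * i.
Proof.
have -> : cQ cW * l = 4 * cW * (2 * l) by rewrite /cQ; lia.
by rewrite leq_mul2l => ->; rewrite orbT.
Qed.

Lemma sample_step f : (forall f', f' < f -> SampleOK f') -> (forall f', f' < f -> RecolorOK f') ->
  (forall f', f' < f -> ReadOK f') -> SampleOK f.
Proof.
case: f => [|f] HS HR HD k ins stamp r m c v i ts st hp sa low r2 vn r18 r19 r34 r35 prop.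
  exact: OK0.
have [_ _ _ [_ [c8 c9 c10 c11 c12]]] := prog_code.
have /andP[k0 ks] := s_k st; have rok := s_regs st; have I := sa_inv sa.
have degD := graph_deg valid ks vn.
have gsym : forall x y, g k x y = g k y x by exact: graph_sym.
have girr : forall x, g k x x = false by exact: (graph_irr valid).
have psz := palette_size vn degD sa; have inj := palette_inj vn degD sa.
have i0 := level_pos sa; have iF := level_le_palette vn degD sa.
have ok := i_ok I 0 vn.
set F := D.+1 - cnt m v 0 in r35 psz inj iF.
pose fa a := pg m v 0 (cnt m v 0 + a).+1.
pose tau a := threat (fun u => (col m u == fa a) && (u != v)) i (partners v (drop k s)).
pose bad a := 1 < score m i ts (fa a).
set X0 := PhiX cW n ins m stamp (drop k s) v + (722 * i + 4 * cW * i).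
set Z := 448 * i + 2 * cW * i.
pose B a := 111 * i + X0 + (if bad a then Z else cB cW * tau a).
have hsum : \sum_(a < F) B a <= F * (X0 + Z).-1.
  apply: sample_sum => //; first exact: (bad_colors vn degD sa).
  exact: threat_sum.
have psz' : pc c < size prog by rewrite hp; exact: (code_size c8).
have Z0 : 0 < Z by rewrite /Z; lia.
have tsz := sa_size sa.
have [[_ n8] _] := code_at_cons c8.
have r35' : reg c 35 = F by rewrite (relR (s_rel st)).
have F0 : 0 < F by lia.
apply: (OK_le (b := (X0 + Z).-1 + (0 < ndone c))).
  by rewrite (s_done st) k0; lia.
apply: (OK_rand (d := 36) (a := 35) (N := F) (B := B));
  [exact: psz'|by rewrite hp|exact: r35'|exact: F0| |exact: hsum].
move=> a ha; have [/andP[fa1 faD] hfree] := palette_free vn degD sa ha.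
have aW : a < W by have := SW; lia.
set r1 := upd r 36 a.
have q1 : eqr [:: 36] r r1 by exact: eqr_upd.
have R1 : Rel (setreg w c 36 a) (MkSt r1 m) by exact: (Rel_setr (s := MkSt r m)) (s_rel st) aW.
have rok1 : regs_ok r1 by exact: regs_ok_eqr rok q1 _.
have st1 : State k ins r1 m (setreg w c 36 a) by exact: State_rel st R1 rok1 erefl erefl.
pose Q (s' : state) kk := [/\ mm s' = m, eqr scan_regs r1 (rg s'), rg s' 37 = fa a,
    rg s' 23 = score m i ts (fa a) /\
    (rg s' 23 = 1 -> [/\ rg s' 24 \in ts, col m (rg s' 24) = fa a & lv m (rg s' 24) < i]) &
    kk <= 40 * size ts + 30].
apply: (run_cmd (Q := Q) st1 (c := scan_cmd) isT c9).
- by rewrite /= hp.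
- apply: (scan_spec SE SW (v := v) (g := g k) (i := i) (ts := ts) (a := a));
    [exact: rok1|exact: r2|exact: vn|exact: (sa_ts sa)|exact: ok|exact: r18|exact: r19|exact: r34
    |by rewrite /r1 upd_eq|by move: ha; rewrite /F; lia|].
  move=> r' kk q e37 e23 e24 hkk; rewrite /Q -[mm _]/m -[rg _]/r' e37.
  rewrite e37 in e23 e24; split; [by []|exact: q|by []| |exact: hkk].
  by split; [exact: e23|exact: e24].
move=> r3 m3 kk3 conf3 [mE q3 e37 [e23 e24] hk3] p3 st3 R3.
rewrite [rg _]/= in q3 e37 e23 e24; rewrite [mm _]/= in mE; subst m3.
have q03 := eqr_tr q1 q3 (L := 36 :: scan_regs) isT.
have rok3 : regs_ok r3 by exact: regs_ok_eqr rok q03 _.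
move/(_ rok3) in st3.
have [[s10 n10] _] := code_at_cons c10.
have sz3 : pc conf3 < size prog by rewrite p3; exact: (code_size c10).
have e3i i' : i' \notin 36 :: scan_regs -> r3 i' = r i' by move=> hi; rewrite q03.
(* An accepted attempt scans at 40 and pushes back at 350 steps per stacked vertex; per unit of [i]
   it may use [833 = 722 + 111]. *)
have prod_bound : 390 * size ts + 55 <= 833 * i by lia.
exists ((if bad a then X0 + Z else X0 + cB cW * tau a + 833 * i - 722 * i - 40 * size ts - 31).+1).
split.
  rewrite /B; case: (bad a); first by lia.
  by rewrite /X0; lia.
apply: (jump_ok (i := IJlt 26 23 pc_sample) (b := bad a) (l := pc_sample) st3);
  [exact: sz3|rewrite p3; exact: n10| |].
- by have [_ _ o3 _ _] := rok3; split; rewrite ?e23 ?o3.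
move=> c4 st4; case: ifP => hbad p4.
  (* A rejected color leads back to the same situation with less fuel and the same budget. *)
  have h4 : (f - kk3).-1 < f.+1 by lia.
  exact: (HS _ h4 k ins stamp r3 m c4 v i ts st4 p4 sa low (etrans (e3i 2 isT) r2) vn
    (etrans (e3i 18 isT) r18) (etrans (e3i 19 isT) r19) (etrans (e3i 34 isT) r34)
    (etrans (e3i 35 isT) r35) prop).
have sc1 : score m i ts (fa a) <= 1 by rewrite leqNgt; move: hbad; rewrite /bad => ->.
have h24 : r3 24 < W.
  have E : reg conf3 24 = r3 24 := relR R3 (i := 24) isT.
  by rewrite -E; exact: (relRW R3).
pose Q2 (s' : state) kk := [/\ eqr (2 :: pull_regs) r3 (rg s'), rg s' 2 = r3 24,
    Inv (g k) (mm s'), (forall x, lv (mm s') x = lv m x) /\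
    (forall x, col (mm s') x = if x == v then fa a else col m x) &
    kk <= 350 * size ts + 20].
apply: (run_cmd (Q := Q2) st4 (c := finish_cmd) isT c11).
- by rewrite p4 p3.
- apply: (finish_spec SE SW (v := v) (g := g k) (ts := ts));
    [exact: gsym|exact: girr|exact: rok3|exact: etrans (e3i 2 isT) r2|exact: vn|exact: I
    |exact: (sa_ts sa)|exact: etrans (e3i 18 isT) r18| |by rewrite e37 fa1|exact: h24|].
    by move=> u un gvu; rewrite (sa_mem sa) // (sa_lv sa) -ltnNge.
  move=> r' m' kk q e2 I' El Ec hkk; rewrite e37 in Ec.
  split; [exact: q|exact: e2|exact: I'|by split; [exact: El|exact: Ec]|exact: hkk].
move=> r5 m5 kk5 conf5 [q5 e52 I5 [El Ec] hk5] p5 st5 R5.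
rewrite [rg _]/= in q5 e52; rewrite [mm _]/= in I5 El Ec.
have rok5 : regs_ok r5 by exact: regs_ok_eqr rok3 q5 _.
move/(_ rok5) in st5.
have [[s12 n12] c12'] := code_at_cons c12.
have [[s13 n13] _] := code_at_cons c12'.
have sz5 : pc conf5 < size prog by rewrite p5; exact: (code_size c12).
have low5 := low_levels_eq El low.
pose stamp' := newstamp n stamp v.
have HPhi := Phi_recolor ins stamp (drop k s) vn El Ec.
rewrite (sa_lv sa) -/(tau a) in HPhi.
have r523 : r5 23 = score m i ts (fa a) by rewrite q5.
have r530 : r5 30 = 0 by have [] := rok5.
pose BB := PhiX cW n ins m stamp (drop k s) v + cB cW * tau a + 4 * cW * i.
exists (BB.+2); split; first by rewrite /BB /X0; lia.
apply: (jump_ok (i := IJlt 30 23 pc_recolor) (b := 0 < score m i ts (fa a)) (l := pc_recolor) st5);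
  [exact: sz5|rewrite p5; exact: n12|by rewrite r523 r530|].
have prop5 (A : pred nat) : (forall b, b < n -> ~~ A b -> g k v b -> col m b != fa a) ->
    proper_off A k m5.
  move=> HA x y xn yn Ax Ay gxy; rewrite !Ec.
  case: (eqVneq x v) gxy => [->|xv] gxy; case: (eqVneq y v) gxy => [->|yv] gxy.
  - by rewrite girr in gxy.
  - by rewrite eq_sym; apply: HA.
  - by apply: HA => //; rewrite gsym.
  - by apply: prop.
have free x : x < n -> g k v x -> col m x = fa a -> x \in ts.
  by move=> xn gvx cx; apply: (free_not_above girr vn degD sa ha).
move=> c6 st6; case: ifP => hsc p6.
  (* Exactly one lower neighbor has the chosen color; register 24 holds it, and properness can now
     fail only there. *)
  have sc1' : score m i ts (fa a) = 1 by lia.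
  have [|w1 w2 w3] := e24; first by rewrite e23.
  set x := r3 24 in w1 w2 w3 e52.
  have [xn gvx] := ts_mem (sa_ts sa) w1.
  have h6' : (f - kk3).-1 - kk5 < f.+1 by lia.
  have h6 : ((f - kk3).-1 - kk5).-1 < f.+1 by lia.
  have xb : proper_off (pred1 x) k m5.
    apply: prop5 => b bn bx gvb; apply/eqP => cb.
    have := score_two vn degD sa (free _ bn gvb cb) w1 bx cb w2.
    by rewrite sc1'.
  have := HR _ h6 k ins stamp' r5 m5 c6 x st6 p6 I5 low5 e52 xn xb.
  apply: OK_le; rewrite El.
  have [jx ex] := i_lv I xn; have [jv ev] := sa_pow sa.
  (* Levels are powers of two, so strictly lower means at most half. *)
  have half : 2 * lv m x <= i.
    move: w3; rewrite ev ex ltn_exp2l // => lt.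
    by rewrite -expnS leq_exp2l.
  apply: leqW; apply: leq_add (child_cost half); apply: leq_trans HPhi; exact: PhiX_le.
have sc0 : score m i ts (fa a) = 0 by lia.
have h6 : (((f - kk3).-1 - kk5).-1).-1 < f.+1 by lia.
have xb : proper_off pred0 k m5.
  apply: prop5 => b bn _ gvb; apply/eqP => cb.
  by have [] := score_nbr i (free _ bn gvb cb) cb; rewrite sc0; lia.
apply: (OK_le (b := (BB).+1)); first by [].
apply: (jump_ok (i := IJz 30 pc_read) (b := true) (l := pc_read) st6);
  [rewrite p6 p5; exact: (code_size c12')|rewrite p6 p5; exact: n13|by rewrite r530|].
move=> c7 st7 p7.
have := HD _ h6 k ins stamp' r5 m5 c7 st7 p7 I5 low5 xb.
by apply: OK_le; apply: leq_trans HPhi _; rewrite /BB leq_addr.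
Qed.

Lemma recolor_step f : (forall f', f' <= f -> SampleOK f') -> RecolorOK f.
Proof.
move=> HS k ins stamp r m c v st hp I low r2 vn prop.
have [_ _ _ [[_ _ _ c7] _]] := prog_code.
have /andP[k0 ks] := s_k st; have rok := s_regs st.
have degD := graph_deg valid ks vn.
have gsym : forall x y, g k x y = g k y x by exact: graph_sym.
have girr : forall x, g k x x = false by exact: (graph_irr valid).
pose Q (s' : state) kk := exists ts i, [/\ eqr lift_regs r (rg s'),
   Lifted n D S (g k) v m i ts (mm s') /\ lv (mm s') v = i,
   [/\ rg s' 18 = size ts, rg s' 19 = i, rg s' 34 = cnt (mm s') v 0 & rg s' 35 = D.+1 - cnt (mm s') v 0],
   [/\ exists j, i = 2 ^ j, size ts < 2 * i & i = 1 \/ i <= count (fun u => lv m u < i) ts] &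
   kk <= 3000 * (lv m v + i)].
apply: (run_cmd (Q := Q) st (c := lift_cmd) isT c7); first exact: hp.
  apply: (lift_spec SE SW gsym girr vn I rok r2).
  move=> r' m' ts i kk q L lvi e18 e19 p2 sz hl e34 e35 hk.
  by exists ts, i; split; [exact: q|split|split|split|exact: hk].
move=> r' m' kk c' [ts [i [q [L lvi] [e18 e19 e34 e35] [p2 sz hl] hk]]] p' st' R'.
rewrite [rg _]/= in q e18 e19 e34 e35; rewrite [mm _]/= in L lvi e34 e35.
have rok' : regs_ok r' by exact: regs_ok_eqr rok q _.
move/(_ rok') in st'.
have tsv u : u \in ts -> u != v by move=> /(ts_mem (li_ts L)) [_]; exact: (@nbr_neq (g k) v girr u).
have sa : Sampling n D S (g k) v i ts m'.
  split; [exact: (li_inv L)|exact: (li_ts L)| |exact: lvi|exact: p2|exact: sz|].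
    by move=> u un gvu; rewrite (li_mem L) // (li_lv L (@nbr_neq (g k) v girr u gvu)).
  case: hl => h; [by left|right]; apply: leq_trans h _; rewrite leq_eqVlt; apply/orP; left.
  by apply/eqP/eq_in_count => u /tsv uv; rewrite (li_lv L uv).
(* A level above 1 is at most the number of stacked neighbors, hence at most the degree, hence at
   most the number of insertions. *)
have iins : i <= (ins v).+1.
  case: (low_le_size sa) => [->|h]; first by [].
  apply: leqW; apply: leq_trans h _; apply: leq_trans _ (s_deg st vn).
  by apply: leq_trans _ (used_le_deg vn degD sa); rewrite leq_addr.
have low' : low_levels ins m'.
  by move=> x xn; case: (eqVneq x v) => [->|xv]; rewrite ?lvi // (li_lv L xv); apply: low.
have prop' : proper_off (pred1 v) k m'.
  by move=> a b an bn av bv gab; rewrite !(li_col L); apply: prop.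
have r'2 : r' 2 = v by rewrite q.
have H := HS _ (leq_subr kk f) k ins stamp r' m' c' v i ts st' p' sa low' r'2 vn e18 e19 e34 e35 prop'.
exists (PhiX cW n ins m' stamp (drop k s) v + (722 * i + 4 * cW * i) + (448 * i + 2 * cW * i)).
split; last exact: H.
have HR : Rest cW n ins m' stamp (drop k s) v <= Rest cW n ins m stamp (drop k s) v.
  apply: leq_sum => x xv; rewrite /Pot /PotA /Th (li_lv L xv) leq_add2l leq_mul2l.
  apply/orP; right; apply: threat_mono => u /and3P[h1 h2 h3].
  by rewrite /matching -!(li_col L) h1 h2.
have lN := low v vn; rewrite /PhiX /PotA lvi.
(* Moving from level [l] to [i] releases [cA * i] and takes back [cA * l]; with the budget [cQ * l]
   this leaves [7 * cW * i + cW * l] for [3000 * (l + i)] lifting steps and the sampling budget. It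
   suffices that [4200 >= 3000 + 722 + 448]. *)
have e1 : cA cW * ((ins v).+1 - i) + cA cW * i = cA cW * (ins v).+1 by rewrite -mulnDr subnK.
have e2 : cA cW * ((ins v).+1 - lv m v) + cA cW * lv m v = cA cW * (ins v).+1 by rewrite -mulnDr subnK.
have e3 : 4200 * i <= cW * i by rewrite leq_mul2r cWb orbT.
have e4 : 4200 * lv m v <= cW * lv m v by rewrite leq_mul2r cWb orbT.
have e5 : cA cW * i = 7 * (cW * i) by rewrite /cA mulnA.
have e6 : cA cW * lv m v = 7 * (cW * lv m v) by rewrite /cA mulnA.
have e7 : cQ cW * lv m v = 8 * (cW * lv m v) by rewrite /cQ mulnA.
rewrite e7 -(mulnA 4 cW i) -(mulnA 2 cW i).
move: (cW * i) (cW * lv m v) (cA cW * ((ins v).+1 - i)) (cA cW * ((ins v).+1 - lv m v)) e1 e2 e3 e4 e5 e6.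
move: HR; move: (Rest _ _ _ _ _ _ _) (Rest _ _ _ _ _ _ _) (cK cW * _) (cA cW * (ins v).+1) (cA cW * i) (cA cW * lv m v).
clear -hk; move: (lv m v) hk => l hk *; lia.
Qed.

Lemma deg_insert (G : graph) u v x : u != v ->
  deg n (fun a b => G a b || is_pair u v a b) x <= deg n G x + ((x == u) || (x == v)).
Proof.
move=> uv; rewrite /deg.
apply: (@leq_trans (\sum_(y < n) G x y + \sum_(y < n) is_pair u v x y)).
  by rewrite -big_split /=; apply: leq_sum => y _; case: (G x y); case: (is_pair _ _ _ _).
rewrite leq_add2l /is_pair.
have one c : \sum_(y < n) (if (y : nat) == c then 1 else 0) <= 1.
  exact: (@sum_pick n id c 1 (fun _ _ _ _ E => E)).
case: (eqVneq x u) => [->|xu] /=.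
  rewrite (negbTE uv) /=; apply: leq_trans _ (one v); apply: leq_sum => y _.
  by rewrite orbF; case: eqP.
case: (eqVneq x v) => [_|xv] /=; last by rewrite big1.
by apply: leq_trans _ (one u); apply: leq_sum => y _; case: eqP.
Qed.

Lemma sum_two a b (x y : nat) :
  \sum_(i < a + b) (if i < a then x else y) = a * x + b * y.
Proof.
rewrite big_split_ord /=; congr (_ + _).
  by rewrite (eq_bigr (fun=> x)) ?sum_nat_const ?card_ord // => i _; rewrite ltn_ord.
rewrite (eq_bigr (fun=> y)) ?sum_nat_const ?card_ord // => i _.
by rewrite ltnNge leq_addr.
Qed.

Section AfterRead.
Variables (f k : nat) (c : config) (m : mem4) (ins stamp r : nat -> nat) (u v : nat).
Hypothesis HD : forall f', f' <= f -> ReadOK f'.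
Hypothesis HR : forall f', f' <= f -> RecolorOK f'.
Hypothesis R : Rel c (MkSt r m).
Hypothesis rok : regs_ok r.
Hypothesis ks : k < size s.
Hypothesis hp : pc c = pc_dispatch.
Hypothesis hi : inp c = drop k.+1 s.
Hypothesis hn : ndone c = k.+1.
Hypothesis I : Inv (g k) m.
Hypothesis low : low_levels ins m.
Hypothesis prop : proper_off pred0 k m.
Hypothesis hdeg : forall x, x < n -> deg n (g k) x <= ins x.
Hypothesis r1 : r 1 = u.
Hypothesis r2 : r 2 = v.

Lemma after_delete : nth (Ins 0 0) s k = Del u v -> r 0 = 2 ->
  OK counted f c (Phi cW n ins m stamp (drop k s)).-1.
Proof.
move=> hs r0.
have [_ _ _ [[c4 c5 _ _] _]] := prog_code.
have [/= legal_ _] := valid ks; rewrite hs in legal_; case/and4P: legal_ => un vn uv guv.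
have gS x y : setE (g k) u v false x y = g k.+1 x y.
  by rewrite (graphS ks) hs /= /setE; case: (is_pair _ _ _ _); rewrite ?andbF ?andbT.
have st : State k.+1 ins r m c.
  split; [exact: R|exact: rok|exact: hi|exact: hn|by rewrite ks|].
  move=> x xn; apply: leq_trans (hdeg xn); apply: leq_sum => y _.
  by rewrite -gS /setE; case: ifP.
pose Q (s' : state) kk := [/\ eqr [:: 25, 32, 33 & edge_regs] r (rg s'), Inv (g k.+1) (mm s'),
  (forall x, lv (mm s') x = lv m x) /\ (forall x, col (mm s') x = col m x),
  rg s' 32 = 0 & kk <= 400].
apply: (run_cmd (Q := Q) st (c := dispatch_cmd) isT c4); first exact: hp.
  apply: (dispatch_spec (b := false) SE SW rok r0 I); rewrite ?r1 ?r2; try assumption.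
  move=> r' m' kk q I' El Ec e32 _ hkk; split; [exact: q| |by split|exact: e32|exact: hkk].
  exact: (Inv_ext gS I').
move=> r' m' kk c' [q I' [El Ec] e32 hk] p' st' R'.
rewrite [rg _]/= in q e32; rewrite [mm _]/= in I' El Ec.
have rok' : regs_ok r' by exact: regs_ok_eqr rok q _.
move/(_ rok') in st'.
have [[_ n5] _] := code_at_cons c5.
have dE : drop k s = Del u v :: drop k.+1 s by rewrite (drop_nth (Ins 0 0)) // hs.
have PE : Phi cW n ins m stamp (drop k s) = Phi cW n ins m' stamp (drop k.+1 s) + cK cW.
  rewrite dE /Phi [size _]/= mulnS [cK cW + _]addnC addnA; congr (_ + _ + _).
  apply: eq_bigr => x _; rewrite /Pot /PotA El; congr (_ + _ * _).
  by rewrite (Th_eq stamp El Ec).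
exists (Phi cW n ins m' stamp (drop k.+1 s)).+1; split.
  by rewrite PE /cK; lia.
apply: (jump_ok (i := IJz 32 pc_read) (b := true) (l := pc_read) st');
  [rewrite p'; exact: (code_size c5)|rewrite p'; exact: n5|by rewrite e32|].
move=> c6 st6 p6.
have hle : (f - kk).-1 <= f by lia.
apply: (@HD _ hle _ _ stamp _ _ _ st6 p6 I' (low_levels_eq El low)).
move=> x y xn yn _ _ gxy; rewrite !Ec; apply: prop => //.
by move: gxy; rewrite -gS /setE; case: ifP.
Qed.

Lemma after_insert : nth (Ins 0 0) s k = Ins u v -> r 0 = 1 ->
  OK counted f c (Phi cW n ins m stamp (drop k s)).-1.
Proof.
move=> hs r0.
have [_ _ _ [[c4 c5 c6 _] _]] := prog_code.
have [/= legal_ _] := valid ks; rewrite hs in legal_; case/and4P: legal_ => un vn uv guv.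
have gS x y : setE (g k) u v true x y = g k.+1 x y.
  by rewrite (graphS ks) hs /= /setE; case: (is_pair _ _ _ _); rewrite ?orbF ?orbT.
pose ins' := addins ins u v.
have st : State k.+1 ins' r m c.
  split; [exact: R|exact: rok|exact: hi|exact: hn|by rewrite ks|].
  move=> x xn; rewrite (graphS ks) hs; apply: leq_trans (deg_insert _ _ uv) _.
  by rewrite /ins' /addins leq_add2r; apply: hdeg.
pose Q (s' : state) kk := [/\ eqr [:: 25, 32, 33 & edge_regs] r (rg s'), Inv (g k.+1) (mm s'),
  (forall x, lv (mm s') x = lv m x) /\ (forall x, col (mm s') x = col m x),
  [/\ rg s' 32 = (col m u == col m v), rg s' 13 = lv m u & rg s' 33 = lv m u + lv m v] & kk <= 400].
apply: (run_cmd (Q := Q) st (c := dispatch_cmd) isT c4); first exact: hp.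
  apply: (dispatch_spec (b := true) SE SW rok r0 I); rewrite ?r1 ?r2; try assumption.
    exact: negbTE.
  move=> r' m' kk q I' El Ec e32 e33 hkk; have [e13 e33'] := e33 isT.
  split; [exact: q| |by split|by split|exact: hkk].
  exact: (Inv_ext gS I').
move=> r' m' kk c' [q I' [El Ec] [e32 e13 e33] hk] p' st' R'.
rewrite [rg _]/= in q e32 e13 e33; rewrite [mm _]/= in I' El Ec.
have rok' : regs_ok r' by exact: regs_ok_eqr rok q _.
move/(_ rok') in st'.
have [[_ n5] c5'] := code_at_cons c5; have [[s5 n5'] _] := code_at_cons c5'.
have dE : drop k s = Ins u v :: drop k.+1 s by rewrite (drop_nth (Ins 0 0)) // hs.
have low' : low_levels ins' m'.
  by move=> x xn; rewrite El /ins' /addins; apply: leq_trans (low xn) _; rewrite ltnS leq_addr.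
have P1 : Phi cW n ins' m' stamp (drop k.+1 s) + 1000 <= Phi cW n ins m stamp (drop k s).
  by rewrite dE; exact: Phi_insert.
have propS A : (forall x y, (x, y) = (u, v) \/ (x, y) = (v, u) -> ~~ A x -> ~~ A y -> col m x != col m y) ->
    proper_off A k.+1 m'.
  move=> HA x y xn yn Ax Ay; rewrite -gS /setE !Ec; case: ifP => [/is_pairP h _|_ gxy].
    exact: HA.
  exact: prop.
(* Dispatching, the draw and the jumps are paid out of the 1000 that the insertion leaves over. *)
set X := Phi cW n ins m stamp (drop k s) - 1000.
exists (X + 5); split; first by rewrite /X; lia.
have -> : X + 5 = (X + 4).+1 by lia.
apply: (jump_ok (i := IJz 32 pc_read) (b := (r' 32 == 0)) (l := pc_read) st');
  [rewrite p'; exact: (code_size c5)|rewrite p'; exact: n5|by []|].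
move=> c7 st7; rewrite e32; case: (eqVneq (col m u) (col m v)) => cuv p7; last first.
  apply: (OK_le (b := Phi cW n ins' m' stamp (drop k.+1 s))); first by rewrite /X; lia.
  have hle : (f - kk).-1 <= f by lia.
  apply: (@HD _ hle _ _ stamp _ _ _ st7 p7 I' low').
  by apply: propS => x y [[-> ->]|[-> ->]] _ _ //; rewrite eq_sym.
have {}p7 : pc c7 = (pc c').+1 := p7.
have h8 : (f - kk).-1 <= f by lia.
case: (f - kk).-1 h8 => [|f8] h8; first exact: OK0.
have lu0 := lv_gt0 I un; have lv0 := lv_gt0 I vn.
pose a1 := PhiX cW n ins' m' stamp (drop k.+1 s) v + cQ cW * lv m v.
pose a2 := PhiX cW n ins' m' stamp (drop k.+1 s) u + cQ cW * lv m u.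
apply: (OK_le (b := X + 3 + (0 < ndone c7))); first by case: (0 < _); lia.
have e33c : reg c7 33 = lv m u + lv m v.
  have E : reg c7 33 = r' 33 := relR (s_rel st7) (i := 33) isT.
  by rewrite E.
(* Numbers below [lv m u] select [v], the others [u], so each endpoint is drawn with the level of
   the other as its weight. *)
apply: (OK_rand (d := 36) (a := 33) (N := lv m u + lv m v) (B := fun i => (if i < lv m u then a1 else a2) + 3));
  [by rewrite p7 p'|by rewrite p7 p'|exact: e33c|by lia| |]; last first.
  rewrite big_split /= sum_two sum_nat_const card_ord mulnDr leq_add2r.
  have := Phi_conflict cW ins stamp (drop k.+1 s) un vn uv El Ec cuv; rewrite -dE -/ins' -/a1 -/a2.
  by rewrite /X mulnBr; lia.
move=> i hi'.
have lS := i_lvS I un; have lS' := i_lvS I vn.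
have iW : i < W by have := SW; lia.
set r8 := upd r' 36 i.
have q8 : eqr [:: 36] r' r8 by exact: eqr_upd.
have R8 : Rel (setreg w c7 36 i) (MkSt r8 m') by exact: (Rel_setr (s := MkSt r' m')) (s_rel st7) iW.
have rok8 : regs_ok r8 by exact: regs_ok_eqr rok' q8 _.
have st8 : State k.+1 ins' r8 m' (setreg w c7 36 i) by exact: State_rel st7 R8 rok8 erefl erefl.
have r81 : r8 1 = u by rewrite q8 // q.
have r82 : r8 2 = v by rewrite q8 // q.
have r813 : r8 13 = lv m u by rewrite q8.
have r836 : r8 36 = i by rewrite /r8 upd_eq.
pose x := if i < lv m u then v else u.
have xn : x < n by rewrite /x; case: ifP.
pose Q2 (s' : state) kk := [/\ eqr [:: 2; 9] r8 (rg s'), mm s' = m', rg s' 2 = x & kk <= 3].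
apply: (run_cmd (Q := Q2) st8 (c := pick_cmd) isT c6).
- by rewrite /= p7 p'.
- apply: (pick_spec SE SW rok8); first by rewrite r81; lia.
  move=> r9 kk9 q9; rewrite r836 r813 r81 r82 => e9 hk9.
  by split; [exact: q9|by []|exact: e9|exact: hk9].
move=> r9 m9 kk9 c9 [q9 mE e9 hk9] p9 st9 R9.
rewrite [rg _]/= in q9 e9; rewrite [mm _]/= in mE; subst m9.
have rok9 : regs_ok r9 by exact: regs_ok_eqr rok8 q9 _.
move/(_ rok9) in st9.
exists (PhiX cW n ins' m' stamp (drop k.+1 s) x + cQ cW * lv m' x); split.
  by rewrite El /x /a1 /a2; case: ifP => _; lia.
have hle : f8 - kk9 <= f by lia.
apply: (@HR _ hle _ _ stamp _ _ _ _ st9 p9 I' low' e9 xn).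
apply: propS => a b hab; rewrite /= /x; case: hab => -[-> ->]; case: ifP => _; by rewrite eqxx.
Qed.

End AfterRead.

Lemma read_at c : pc c = pc_read -> pc c < size P /\ nth IRead P (pc c) = IRead.
Proof.
move=> ->; have [_ _ c3 _] := prog_code; have [h _] := code_at_cons c3; exact: h.
Qed.

Lemma Good_read k r m c : Rel c (MkSt r m) -> pc c = pc_read -> ndone c = k ->
  Inv (g k) m -> proper_off pred0 k m -> Good c.
Proof.
move=> R hp hn I prop; have [h1 h2] := read_at hp.
have hr : at_read P c by rewrite /at_read h1 h2.
split.
  rewrite /step h1 h2 => E; split; first exact: hr.
  by case: (inp c) E => // up rest; case: up.
(* Colors have tag 0 and zero middle digits, so the color of [v] sits at address [v], as the output
   convention demands. *)
move=> _ _; have mE v : v < n -> memory c v = col m v.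
  move=> vn; have S0 : 0 < S by rewrite SE; lia.
  have vS : v < S by rewrite SE; lia.
  by have := relM R S0 S0 S0 vS; rewrite /addr !mul0n.
rewrite hn; split=> [v vn|u v un vn guv]; first by rewrite mE //; exact: (i_col I).
by rewrite !mE //; apply: prop.
Qed.

Lemma read_step k c r m : Rel c (MkSt r m) -> regs_ok r -> pc c = pc_read ->
  ndone c = k -> inp c = drop k s -> k < size s ->
  exists r' c', [/\ step w P c = [:: c'], Rel c' (MkSt r' m), regs_ok r',
    [/\ pc c' = pc_dispatch, ndone c' = k.+1 & inp c' = drop k.+1 s] &
    encode (nth (Ins 0 0) s k) = (r' 0, r' 1, r' 2)].
Proof.
move=> R rok hp hn hi ks; have [h1 h2] := read_at hp.
have dE : drop k s = nth (Ins 0 0) s k :: drop k.+1 s by rewrite (drop_nth (Ins 0 0)).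
have [legal_ _] := valid ks.
have SWn := SW; have S16n := S16.
set up := nth _ s k in dE legal_ *.
case Eu: (encode up) => [[kind u] v].
have [kb ub vb] : [/\ kind < W, u < W & v < W].
  by case: up legal_ Eu {dE} => a b /= /and4P[an bn _ _] [<- <- <-]; split; lia.
pose r' := upd (upd (upd r 0 kind) 1 u) 2 v.
pose c' := Config (pc c).+1
  (upd (upd (upd (reg c) 0 (Defs.wrap w kind)) 1 (Defs.wrap w u)) 2 (Defs.wrap w v))
  (memory c) (drop k.+1 s) (ndone c).+1.
exists r', c'; split.
- by rewrite /step h1 h2 hi dE Eu.
- case: R => e1 e2 e3 e4 e5 e6; split=> //=.
  + move=> i hi'; rewrite /r' /upd !wrapE //; case: (i == 2) => //; case: (i == 1) => //.
    by case: (i == 0) => //; apply: e1.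
  + by do 3 (apply: upd_lt; last exact: wrap_lt).
- by case: rok.
- by rewrite /= hp hn.
- by [].
Qed.

Lemma read_ok f k c r m ins stamp :
  (forall f', f' < f -> ReadOK f') -> (forall f', f' < f -> RecolorOK f') ->
  Rel c (MkSt r m) -> regs_ok r -> pc c = pc_read ->
  ndone c = k -> inp c = drop k s -> k <= size s -> Inv (g k) m -> low_levels ins m ->
  proper_off pred0 k m -> (forall x, x < n -> deg n (g k) x <= ins x) ->
  OK counted f c (Phi cW n ins m stamp (drop k s)).
Proof.
move=> HD HR R rok hp hn hi ks I low prop hdeg.
have G := Good_read R hp hn I prop.
have [h1 h2] := read_at hp.
case: f HD HR => [|f] HD HR; first exact: OK0.
case: (ltnP k (size s)) => ks'; last first.
  have dn : drop k s = [::] by rewrite drop_oversize.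
  by apply: (OK_le (b := 0)) => //; apply: OK_halt => //; rewrite /step h1 h2 hi dn.
have [r' [c' [E R' rok' [p' n' i'] Ee]]] := read_step R rok hp hn hi ks'.
have dE : drop k s = nth (Ins 0 0) s k :: drop k.+1 s by rewrite (drop_nth (Ins 0 0)).
have pos : 0 < Phi cW n ins m stamp (drop k s) by rewrite /Phi dE /= mulnS /cK; lia.
have key : OK counted f c' (Phi cW n ins m stamp (drop k s)).-1.
  case Eup: (nth (Ins 0 0) s k) Ee => [u v|u v] [e0 e1 e2].
    exact: (after_insert stamp HD HR R' rok' ks' p' i' n' I low prop hdeg (esym e1) (esym e2) Eup (esym e0)).
  exact: (after_delete stamp HD R' rok' ks' p' i' n' I low prop hdeg (esym e1) (esym e2) Eup (esym e0)).
apply: OK_le (OK_one G E key); rewrite hn.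
by case: (0 < k); lia.
Qed.

Lemma all_ok f : [/\ SampleOK f, RecolorOK f & ReadOK f].
Proof.
elim/ltn_ind: f => f IH.
(* Sampling comes first: it consumes fuel by its draw and refers to smaller fuels only, whereas
   recoloring may refer to sampling at the same fuel, no lower bound on the lifting steps being at
   hand. *)
have HS : SampleOK f by apply: sample_step => f' /IH [].
have HR : RecolorOK f.
  apply: recolor_step => f'; rewrite leq_eqVlt => /orP[/eqP -> //|/IH [] //].
split=> // k ins stamp r m c [R rok hi hn /andP[_ ks] hd] hp I low prop.
by apply: (read_ok _ _ _ R rok hp hn hi ks I low prop hd) => f' /IH [].
Qed.

Let c0 := init_config w n D s.

Lemma boot_ok : exists r c, [/\ dsteps w P 5 c0 c, Rel c (MkSt r (fun _ _ _ _ => 0)), pc c = 5 &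
  [/\ r 10 = n, r 11 = D, r 29 = S & r 30 = 0]].
Proof.
have SWn := SW; have S16n := S16.
have [b0 _ _ _] := prog_code.
have wn : Defs.wrap w n = n by apply: wrapE; lia.
have wD : Defs.wrap w D = D by apply: wrapE; lia.
pose c1 := setreg w c0 10 n; pose c2 := setreg w c1 11 D; pose c3 := setreg w c2 28 16.
pose c4 := setreg w c3 29 (n + D); pose c5 := setreg w c4 29 S.
have [[s0 n0] {}b0] := code_at_cons b0; have [[s1 n1] {}b0] := code_at_cons b0.
have [[s2 n2] {}b0] := code_at_cons b0; have [[s3 n3] {}b0] := code_at_cons b0.
have [[s4 n4] _] := code_at_cons b0.
have w16 : Defs.wrap w 16 = 16 by apply: wrapE; lia.
have wnD : Defs.wrap w (n + D) = n + D by apply: wrapE; lia.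
have wS : Defs.wrap w S = S by apply: wrapE; lia.
exists (reg c5), c5; split=> //.
- apply: (dsS (c1 := c1)).
    apply: (one_dstep (i := IAdd 10 0 30)) => //.
    by rewrite /step s0 n0 /= /upd /= wn addn0.
  apply: (dsS (c1 := c2)).
    apply: (one_dstep (i := IAdd 11 1 30)) => //.
    by rewrite /step s1 n1 /= /upd /= wD addn0.
  apply: (dsS (c1 := c3)).
    apply: (one_dstep (i := IConst 28 16)) => //.
    by rewrite /step s2 n2.
  apply: (dsS (c1 := c4)).
    apply: (one_dstep (i := IAdd 29 10 11)) => //.
    by rewrite /step s3 n3 /= /upd /= wn wD.
  apply: dsteps1; apply: (one_dstep (i := IAdd 29 29 28)) => //.
  by rewrite /step s4 n4 /= /upd /= w16 wnD -SE.
- have c5W : forall i, reg c5 i < W.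
    do 7 (apply: upd_lt; last exact: wrap_lt).
    by move=> i; rewrite expn_gt0.
  split; [by []|exact: wS|by []|exact: c5W|by move=> a; rewrite expn_gt0|by []].
Qed.

Lemma start_ok : exists r m c j, [/\ dsteps w P j c0 c, Rel c (MkSt r m), regs_ok r,
  pc c = pc_read & [/\ Inv empty_graph m, forall v, v < n -> lv m v = 1 & j <= 20 * n + 15]].
Proof.
have [r [c [d1 R p1 [r10 r11 r29 z]]]] := boot_ok.
have [_ c2 _ _] := prog_code.
have := @wp_sound w P S S16 SW4 prep_cmd 5 c _
  (fun s' k => [/\ regs_ok (rg s'), Inv empty_graph (mm s'),
     (forall v, v < n -> lv (mm s') v = 1) & k <= 20 * n + 10]) isT c2 p1 R.
case.
  apply: (prep_spec SE SW r10 r11 r29 z) => r' m' k h1 h2 h3 _ h5.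
  by split; [exact: h1|exact: h2|exact: h3|exact: h5].
move=> [r' m'] [k [c' [[h1 h2 h3 h4] d2 R' p2]]].
exists r', m', c', (5 + k); split; [exact: dsteps_trans d1 d2|exact: R'|exact: h1|exact: p2|].
by split; [exact: h2|exact: h3|lia].
Qed.

Lemma run_ok fuel :
  OK counted fuel c0 (cK cW * size s) /\ OK (fun k => k == 0) fuel c0 (20 * n + 16).
Proof.
have [r [m [c [j [dj R rok hp [I lv1 hj]]]]]] := start_ok.
have [hi hn] := dsteps_inp dj.
rewrite -[inp c0]/s in hi; rewrite -[ndone c0]/0 in hn.
have hi0 : inp c = drop 0 s by rewrite drop0.
have g0 : g 0 = empty_graph by rewrite take0.
have I0 : Inv (g 0) m by rewrite g0.
have prop0 : proper_off pred0 0 m by move=> a b _ _ _ _; rewrite g0.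
pose ins (_ : nat) := 0.
have low : low_levels ins m by move=> v vn; rewrite lv1.
have hdeg x : x < n -> deg n (g 0) x <= ins x by rewrite g0 /deg big1.
(* Initially there are no insertions and all levels are 1, so [PotA] is 0, and threats at level at
   most 16 vanish. The constant function [ins] also serves as the stamps. *)
have PE : Phi cW n ins m ins (drop 0 s) = cK cW * size s.
  rewrite drop0 /Phi big1 // => v _.
  by rewrite /Pot /PotA /Th lv1 // threat_small // !muln0.
have H f : OK counted f c (cK cW * size s).
  rewrite -PE; apply: (read_ok ins _ _ R rok hp hn hi0 (leq0n _) I0 low prop0 hdeg) => f' _;
  by case: (all_ok f').
split.
  have := OK_dsteps dj (H (fuel - j)); rewrite -[ndone c0]/0 muln0 addn0; exact.
(* Of the steps from here on only the first read still counts as preprocessing; afterwards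
   [ec0_zero] applies. *)
have H0 f : OK (fun k => k == 0) f c 1.
  split; first by case: (H f).
  case: f => [|f]; first by rewrite /ec /= ler01.
  have [h1 h2] := read_at hp.
  case: (posnP (size s)) => sz.
    have E : step w P c = [::] by rewrite /step h1 h2 hi; case: (s) sz.
    by rewrite /ec /= E ler01.
  have [r' [c' [E _ _ [_ n' _] _]]] := read_step R rok hp hn hi0 sz.
  rewrite /ec /= E big_seq1 divr1 -[ecost _ _ _ _ c']/(ec w P (fun k => k == 0) f c').
  by rewrite ec0_zero ?n' // addr0 hn.
have := OK_dsteps dj (H0 (fuel - j)); rewrite -[ndone c0]/0 muln1.
by apply: OK_le; lia.
Qed.

End Run.

(** With [N = n + D + 2 >= 2] one has [n + D + 16 <= 8 N <= N ^ 4], so four digits fit below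
    [N ^ 16]; hence the factor 16 in the word length. *)
Lemma word_size n D : (n + D + 16) ^ 4 <= 2 ^ (16 * up_log 2 (n + D + 2)).
Proof.
set N := n + D + 2; have N2 : 2 <= N by rewrite /N addn2.
rewrite mulnC expnM; apply: (@leq_trans (N ^ 16)); last first.
  by rewrite leq_exp2r //; apply: up_logP.
rewrite (expnM N 4 4) leq_exp2r //.
apply: (@leq_trans (8 * N)); first by rewrite /N; lia.
by rewrite expnS mulnC leq_mul2l -[8]/(2 ^ 3) leq_exp2r // N2 orbT.
Qed.

Theorem theorem1 :
  exists (P : seq instr) (kw C : nat),
  forall (n D : nat) (s : seq update),
    valid_seq n D s ->
    let w := kw * up_log 2 (n + D + 2) in
    let c0 := init_config w n D s in
    (* with probability 1 the algorithm only halts after all updates are read *)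
    (forall c, reachable w P c0 c -> step w P c = [::] ->
        at_read P c /\ inp c = [::]) /\
    (* after every update, memory cells 0..n-1 hold a proper (D+1)-coloring *)
    (forall c, reachable w P c0 c -> at_read P c -> 1 <= ndone c ->
        proper_coloring n D (graph_of (take (ndone c) s)) (memory c)) /\
    (* expected total time for the updates is O(|s| * log D) *)
    (forall fuel, (ecost w P (fun c => (1 <= ndone c)%N) fuel c0
                   <= ((C * size s * (trunc_log 2 D).+1)%N)%:R)%R) /\
    (* expected preprocessing time on the empty graph is O(n) *)
    (forall fuel, (ecost w P (fun c => (ndone c == 0)%N) fuel c0
                   <= ((C * n.+1)%N)%:R)%R).
Proof.
(* Hiding the value keeps [cW] an abstract variable, so the large constants are not computed
   with. *)
have [cW hcW] : exists cW, 4200 <= cW by exists 4200.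
exists prog, 16, (cK cW) => n D s valid w c0.
have H fuel := run_ok hcW (erefl (n + D + 16)) (word_size n D) valid fuel.
have G c : reachable w prog c0 c -> Good w prog n D s c.
  by move=> /safe_reach; apply=> f; case: (H f) => -[].
split; first by move=> c /G [].
split; first by move=> c /G [].
split=> fuel; case: (H fuel) => -[_ h1] [_ h2].
(* The bound obtained is linear in the number of updates; the logarithmic factor is at least 1. *)
- apply: le_trans h1 _; rewrite ler_nat leq_pmulr //.
- apply: le_trans h2 _; rewrite ler_nat /cK; lia.
Qed.
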